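(* Let $A=\mathscr{D}(\mathsf{w},\ell-m)$ be an $m$-Koszul Artin--Schelter regular algebra, generated in degree $1$, of Gorenstein parameter $\ell$ and of global dimension and GK dimension $d$, where $V=A_1$ and $\mathsf{w}\in V^{\otimes \ell}$ is a $\sigma$-twisted superpotential. Let $H$ be a semisimple Hopf algebra such that $A$ is a left $H$-module algebra, each $A_i$ is an $H$-submodule of $A$, and the action is inner-faithful. Let $\Psi:T_\Bbbk(V)\# H\to T_H(V\otimes H)$ be the algebra isomorphism $$\Psi((u_1\otimes\cdots\otimes u_k)\# h)=(u_1\otimes1)\otimes_H\cdots\otimes_H(u_{k-1}\otimes1)\otimes_H(u_k\otimes h).$$ Then $$A\# H\cong\mathscr D(\Psi(\mathsf w\#1),\ell-m),$$ where $\Psi(\mathsf w\#1)\in (V\otimes H)^{\otimes_H\ell}$ is a $\nu$-twisted superpotential, the twist $\nu$ being the graded automorphism of $T_H(V\otimes H)$ given by $\nu|_H=\Xi$ and $\nu(v\otimes h)=\sigma(v)\otimes\Xi(h)$, where $\Xi(h)=\operatorname{hdet}_A(h_{(1)})h_{(2)}$ is the left winding automorphism of $H$ associated to the homological determinant.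
   Context: $\Bbbk$ is an algebraically closed field of characteristic $0$; unadorned tensor products are over $\Bbbk$; $\Delta(h)=h_{(1)}\otimes h_{(2)}$, $\varepsilon$, $S$ denote coproduct, counit, antipode. Semisimple Hopf algebras are finite-dimensional with $S^2=\mathrm{id}$. AS regular: a connected graded $\Bbbk$-algebra $A$ ($\mathbb{N}$-graded, $A_0=\Bbbk$) is AS regular of dimension $d$ with Gorenstein parameter $\ell$ if its left and right injective dimensions equal $d<\infty$; $\operatorname{Ext}^i_A({}_A\Bbbk,{}_AA)$ is $0$ for $i\ne d$ and is $\Bbbk[\ell]$ ($M[\ell]_n=M_{\ell+n}$) for $i=d$, and symmetrically on the right with the same $\ell$; $A$ has global dimension $d$ and finite GK dimension. $m$-Koszul: $A=T_\Bbbk(V)/\langle\mathcal R\rangle$ with $V=A_1$ finite-dimensional, $\mathcal R\subseteq V^{\otimes m}$, and the $m$-Koszul complex of $A$ is exact; equivalently $\operatorname{Tor}_i^A(\Bbbk,\Bbbk)$ is concentrated in degree $\rho(i)$ for all $i$, where $\rho(i)=mi/2$ ($i$ even), $m(i-1)/2+1$ ($i$ odd). Over $\Bbbk$: with $\theta(u_1\otimes\cdots\otimes u_\ell)=u_2\otimes\cdots\otimes u_\ell\otimes u_1$, $\mathsf w\in V^{\otimes\ell}$ is a $\sigma$-twisted superpotential ($\sigma\in\mathrm{GL}(V)$) if $(\mathrm{id}^{\otimes(\ell-1)}\otimes\sigma)\theta(\mathsf w)=\mathsf w$; $\mathscr D(\mathsf w,i)=T_\Bbbk(V)/\langle\partial^i\mathsf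 w\rangle$, $\partial^i\mathsf w=\{(\psi_1\otimes\cdots\otimes\psi_i\otimes\mathrm{id}^{\otimes(\ell-i)})(\mathsf w)\mid \psi_j\in V^*\}$. Over $H$: let $M$ be an $(H,H)$-bimodule and $M^*=\operatorname{Hom}_\Bbbk(M,\Bbbk)$. The trace function $\operatorname{Tr}:H\to\Bbbk$ is the integral in $H^*$ ($\phi*\operatorname{Tr}=\phi(1)\operatorname{Tr}=\operatorname{Tr}*\phi$ for all $\phi\in H^*$) normalised by $\operatorname{Tr}(1_H)=1$; the form $\operatorname{Tr}(hk)$ is nondegenerate. For $\psi\in M^*$, let $R\psi:M\to H$ (right $H$-linear) and $L\psi:M\to H$ (left $H$-linear) be determined by $\operatorname{Tr}((R\psi)(x))=\psi(x)=\operatorname{Tr}((L\psi)(x))$. Put $\llbracket\psi,x_1\otimes\cdots\otimes x_\ell\rrbracket=(R\psi)(x_1)x_2\otimes\cdots\otimes x_\ell$, $\llbracket x_1\otimes\cdots\otimes x_\ell,\psi\rrbracket=x_1\otimes\cdots\otimes x_{\ell-1}(L\psi)(x_\ell)$, and $\llbracket\psi_1\otimes\cdots\otimes\psi_i,x\rrbracket=\llbracket\psi_1,\llbracket\psi_2,\dots\llbracket\psi_i,x\rrbracket\dots\rrbracket\rrbracket$. Let $\nu$ be a graded automorphism of $T_H(M)$ preserving $\operatorname{Tr}$, and $\psi^{\nu^*}=\psi\circ\nu$. An element $\mathsf u\in M^{\otimes_H\ell}$ is a $\nu$-twisted superpotential if $h\,\mathsf u=\mathsf u\,\nu(h)$ for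 all $h\in H$ and $\llbracket\psi^{\nu^*},\mathsf u\rrbracket=\llbracket\mathsf u,\psi\rrbracket$ for all $\psi\in M^*$. Then $\mathscr D(\mathsf u,i)=T_H(M)/\langle\operatorname{im}\partial^i_{\mathsf u}\rangle$, where $\partial^i_{\mathsf u}(\psi_1\otimes\cdots\otimes\psi_i\otimes h)=\llbracket\psi_1\otimes\cdots\otimes\psi_i,\mathsf u h\rrbracket$. Hopf actions: $A$ is a left $H$-module algebra if $h\cdot(ab)=(h_{(1)}\cdot a)(h_{(2)}\cdot b)$ and $h\cdot 1=\varepsilon(h)1$; $A\# H$ is $A\otimes H$ with $(a\# h)(b\# k)=a(h_{(1)}\cdot b)\# h_{(2)}k$. Inner-faithful: $IA\ne0$ for every nonzero Hopf ideal $I$ of $H$. $H$ acts on $T_\Bbbk(V)$ via the coproduct. $V\otimes H$ is an $H$-bimodule with diagonal left action $h(v\otimes k)=h_{(1)}v\otimes h_{(2)}k$ and right action by right multiplication on $H$. The homological determinant is $\operatorname{hdet}_A=\eta\circ S$, where $\eta:H\to\Bbbk$ is the character by which $H$ acts on the one-dimensional module $\operatorname{Ext}^d_A(\Bbbk,\Bbbk)$ (computed with a graded $A\# H$-projective resolution of $\Bbbk$). *)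

(* Defs.v *)
Set Warnings "-notation-overridden,-ambiguous-paths,-notation-incompatible-prefix,-redundant-canonical-projection".
From HB Require Import structures.
From mathcomp Require Import all_boot all_order all_algebra all_field.
From mathcomp Require Import generic_quotient.
From mathcomp Require Import boolp classical_sets reals ereal sequences exp.
Set Implicit Arguments.
Unset Strict Implicit.
Unset Printing Implicit Defensive.
Import GRing.Theory.
Local Open Scope ring_scope.

(* [{univ C}] is the k-vector space on generators [X] that is universal for the
   maps [f : X -> W] in the class [C]: formal linear combinations of generators,
   two of them being identified when all the maps of [C] agree on them.  Tensor
   products and tensor algebras are instances of this construction. *)
Section Universal.
Variables (k : fieldType) (X : choiceType).
Variable C : forall W : lmodType k, (X -> W) -> Prop.

Definition lsum (W : lmodType k) (f : X -> W) (s : seq (k * X)) : W :=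
  \sum_(p <- s) p.1 *: f p.2.

Definition univ_rel (s t : seq (k * X)) : bool :=
  `[< forall (W : lmodType k) (f : X -> W), C f -> lsum f s = lsum f t >].

Lemma univ_rel_refl : reflexive univ_rel.
Proof. by move=> s; apply/asboolP. Qed.

Lemma univ_rel_sym : symmetric univ_rel.
Proof.
by move=> s t; apply/asboolP/asboolP => h W f Cf; rewrite (h W f Cf).
Qed.

Lemma univ_rel_trans : transitive univ_rel.
Proof.
move=> t s r /asboolP h1 /asboolP h2; apply/asboolP => W f Cf.
by rewrite (h1 W f Cf) (h2 W f Cf).
Qed.

Definition univ_eqv := EquivRel univ_rel univ_rel_refl univ_rel_sym univ_rel_trans.

Definition univ : Type := {eq_quot univ_eqv}%qT.
HB.instance Definition _ : EqQuotient _ univ_eqv univ := EqQuotient.on univ.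
HB.instance Definition _ := Choice.on univ.

Definition uclass (s : seq (k * X)) : univ := (\pi_univ s)%qT.
Definition urepr (x : univ) : seq (k * X) := repr x.

Definition lift (W : lmodType k) (f : X -> W) (x : univ) : W := lsum f (urepr x).

Lemma uclassK x : uclass (urepr x) = x.
Proof. exact: reprK. Qed.

Lemma lift_uclass (W : lmodType k) (f : X -> W) s :
  C f -> lift f (uclass s) = lsum f s.
Proof.
move=> Cf; have /eqquotP /asboolP h : (uclass (urepr (uclass s))) = uclass s.
  exact: uclassK.
exact: h.
Qed.

Lemma univ_ext (x y : univ) :
  (forall (W : lmodType k) (f : X -> W), C f -> lift f x = lift f y) -> x = y.
Proof.
move=> h; rewrite -[x]uclassK -[y]uclassK; apply/eqquotP/asboolP => W f Cf.
exact: h.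
Qed.

Lemma lsum_cat (W : lmodType k) (f : X -> W) s t :
  lsum f (s ++ t) = lsum f s + lsum f t.
Proof. by rewrite /lsum big_cat. Qed.

Definition univ_add (x y : univ) : univ := uclass (urepr x ++ urepr y).
Definition univ_scale (c : k) (x : univ) : univ :=
  uclass [seq (c * p.1, p.2) | p <- urepr x].

Lemma lsum_scale (W : lmodType k) (f : X -> W) c s :
  lsum f [seq (c * p.1, p.2) | p <- s] = c *: lsum f s.
Proof.
by rewrite /lsum big_map scaler_sumr; apply: eq_bigr => p _ /=; rewrite scalerA.
Qed.

Lemma lift_add (W : lmodType k) (f : X -> W) x y :
  C f -> lift f (univ_add x y) = lift f x + lift f y.
Proof. by move=> Cf; rewrite lift_uclass // lsum_cat. Qed.

Lemma lift_scale (W : lmodType k) (f : X -> W) c x :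
  C f -> lift f (univ_scale c x) = c *: lift f x.
Proof. by move=> Cf; rewrite lift_uclass // lsum_scale. Qed.

Lemma lift_zero (W : lmodType k) (f : X -> W) : C f -> lift f (uclass [::]) = 0.
Proof. by move=> Cf; rewrite lift_uclass // /lsum big_nil. Qed.

Lemma univ_addA : associative univ_add.
Proof. by move=> x y z; apply: univ_ext => W f Cf; rewrite !lift_add // addrA. Qed.
Lemma univ_addC : commutative univ_add.
Proof. by move=> x y; apply: univ_ext => W f Cf; rewrite !lift_add // addrC. Qed.
Lemma univ_add0 : left_id (uclass [::]) univ_add.
Proof.
by move=> x; apply: univ_ext => W f Cf; rewrite !lift_add // lift_zero // add0r.
Qed.
Lemma univ_addN : left_inverse (uclass [::]) (univ_scale (-1)) univ_add.
Proof.
move=> x; apply: univ_ext => W f Cf.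
by rewrite lift_add // lift_scale // lift_zero // scaleN1r addNr.
Qed.

HB.instance Definition _ :=
  GRing.isZmodule.Build univ univ_addA univ_addC univ_add0 univ_addN.

Lemma univ_scaleA a b x : univ_scale a (univ_scale b x) = univ_scale (a * b) x.
Proof. by apply: univ_ext => W f Cf; rewrite !lift_scale // scalerA. Qed.
Lemma univ_scale1 : left_id 1 univ_scale.
Proof. by move=> x; apply: univ_ext => W f Cf; rewrite !lift_scale // scale1r. Qed.
Lemma univ_scaleDr : right_distributive univ_scale +%R.
Proof.
move=> a x y; apply: univ_ext => W f Cf.
by rewrite !(lift_add, lift_scale) // scalerDr.
Qed.
Lemma univ_scaleDl x : {morph univ_scale^~ x : a b / a + b}.
Proof.
move=> a b; apply: univ_ext => W f Cf.
by rewrite !(lift_add, lift_scale) // scalerDl.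
Qed.

HB.instance Definition _ := GRing.Zmodule_isLmodule.Build k univ
  univ_scaleA univ_scale1 univ_scaleDr univ_scaleDl.

Definition ugen (x : X) : univ := uclass [:: (1, x)].

Lemma lift_linear (W : lmodType k) (f : X -> W) : C f -> linear (lift f).
Proof. by move=> Cf c x y; rewrite lift_add // lift_scale. Qed.

Lemma lift_ugen (W : lmodType k) (f : X -> W) x : C f -> lift f (ugen x) = f x.
Proof. by move=> Cf; rewrite lift_uclass // /lsum big_seq1 scale1r. Qed.

Lemma liftD (W : lmodType k) (f : X -> W) x y :
  C f -> lift f (x + y) = lift f x + lift f y.
Proof. exact: lift_add. Qed.

Lemma liftZ (W : lmodType k) (f : X -> W) c x :
  C f -> lift f (c *: x) = c *: lift f x.
Proof. exact: lift_scale. Qed.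

Lemma univ_sum (x : univ) : x = \sum_(p <- urepr x) p.1 *: ugen p.2.
Proof.
apply: univ_ext => W f Cf; rewrite {1}/lift /lsum.
elim: (urepr x) => [|p s IH]; first by rewrite !big_nil; exact/esym/lift_zero.
by rewrite !big_cons lift_add // lift_scale // lift_ugen // IH.
Qed.

Lemma univ_ind (P : univ -> Prop) :
  P 0 -> (forall c x y, P y -> P (c *: ugen x + y)) -> forall x, P x.
Proof.
move=> P0 PS x; rewrite (univ_sum x).
by elim: (urepr x) => [|p s IH]; rewrite ?big_nil ?big_cons //; apply: PS.
Qed.

Lemma univ_eq (W : lmodType k) (f g : univ -> W) :
  linear f -> linear g -> (forall x, f (ugen x) = g (ugen x)) -> f =1 g.
Proof.
move=> lf lg fg; have f0 : f 0 = 0.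
  by have := lf (-1) 0 0; rewrite scaler0 addr0 scaleN1r addNr.
have g0 : g 0 = 0 by have := lg (-1) 0 0; rewrite scaler0 addr0 scaleN1r addNr.
by apply: univ_ind => [|c x y IH]; rewrite ?f0 ?g0 // lf lg fg IH.
Qed.

End Universal.


Arguments lift {k X C W} f x.
Arguments ugen {k X C} x.

Section Tensor.
Variables (k : fieldType) (U W : lmodType k).

Definition bilin (Z : lmodType k) (f : U * W -> Z) : Prop :=
  (forall w, linear (fun u => f (u, w))) /\ (forall u, linear (fun w => f (u, w))).

Definition tensor : Type := univ bilin.
HB.instance Definition _ := GRing.Lmodule.copy tensor (univ bilin).

Definition tens (u : U) (w : W) : tensor := ugen (u, w).

Definition tlift (Z : lmodType k) (f : U -> W -> Z) (x : tensor) : Z :=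
  lift (fun p => f p.1 p.2) x.

End Tensor.

Section TensorTheory.
Variables (k : fieldType) (U W : lmodType k).
Implicit Types (x y : tensor U W) (Z : lmodType k).

Definition bilin2 Z (f : U -> W -> Z) : Prop :=
  (forall w, linear (f^~ w)) /\ (forall u, linear (f u)).

Lemma bilin2E Z (f : U -> W -> Z) :
  bilin2 f -> bilin (fun p : U * W => f p.1 p.2).
Proof. by []. Qed.

Lemma tlift_linear Z (f : U -> W -> Z) : bilin2 f -> linear (tlift f).
Proof. by move/bilin2E => h; apply: lift_linear. Qed.

Lemma tlift_tens Z (f : U -> W -> Z) u w : bilin2 f -> tlift f (tens u w) = f u w.
Proof. by move/bilin2E => h; rewrite /tlift /tens lift_ugen. Qed.

Lemma tens_bilin : bilin2 (@tens k U W).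
Proof.
split=> [w c u u'|u c w w']; apply: univ_ext => Z f [fl fr];
  rewrite liftD // liftZ // !lift_ugen //.
- exact: fl.
- exact: fr.
Qed.

Lemma tensDl u u' (w : W) : tens (u + u') w = tens u w + tens u' w :> tensor U W.
Proof. by have := tens_bilin.1 w 1 u u'; rewrite !scale1r. Qed.
Lemma tensDr (u : U) w w' : tens u (w + w') = tens u w + tens u w' :> tensor U W.
Proof. by have := tens_bilin.2 u 1 w w'; rewrite !scale1r. Qed.
Lemma tensZl c u (w : W) : tens (c *: u) w = c *: tens u w :> tensor U W.
Proof.
have z : tens (0 : U) w = 0.
  by have := tens_bilin.1 w (-1) 0 0; rewrite scaler0 addr0 scaleN1r addNr.
by have := tens_bilin.1 w c u 0; rewrite z !addr0.
Qed.
Lemma tensZr c (u : U) w : tens u (c *: w) = c *: tens u w :> tensor U W.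
Proof.
have z : tens u (0 : W) = 0.
  by have := tens_bilin.2 u (-1) 0 0; rewrite scaler0 addr0 scaleN1r addNr.
by have := tens_bilin.2 u c w 0; rewrite z !addr0.
Qed.

Lemma tens_eq Z (f g : tensor U W -> Z) :
  linear f -> linear g -> (forall u w, f (tens u w) = g (tens u w)) -> f =1 g.
Proof. by move=> lf lg fg; apply: univ_eq => // -[u w]; apply: fg. Qed.

End TensorTheory.

Section LinearFun.
Variables (k : fieldType).
Implicit Types U V W Z : lmodType k.

Lemma linear_comp U V W (g : V -> W) (f : U -> V) :
  linear g -> linear f -> linear (fun x => g (f x)).
Proof. by move=> lg lf c x y; rewrite lf lg. Qed.

Lemma linear_fun0 U V : linear (fun _ : U => 0 : V).
Proof. by move=> c x y; rewrite scaler0 addr0. Qed.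

(* If [f s] is bilinear for each [s] and depends linearly on [s], so does
   [tlift (f s) x]. *)
Lemma tlift_linear_par U V W Z (f : Z -> U -> V -> W) (x : tensor U V) :
  (forall u v, linear (fun s => f s u v)) -> linear (fun s => tlift (f s) x).
Proof.
move=> lf c s t; rewrite /tlift /lift /lsum scaler_sumr -big_split /=.
apply: eq_bigr => p _; rewrite lf scalerDr !scalerA.
by rewrite [c * _]mulrC.
Qed.

Lemma lift_linear_par (X : choiceType)
    (C : forall W : lmodType k, (X -> W) -> Prop) W Z (f : Z -> X -> W)
    (x : univ C) :
  (forall w, linear (fun s => f s w)) -> linear (fun s => lift (f s) x).
Proof.
move=> lf c s t; rewrite /lift /lsum scaler_sumr -big_split /=.
apply: eq_bigr => p _; rewrite lf scalerDr !scalerA.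
by rewrite [c * _]mulrC.
Qed.

End LinearFun.

(* The tensor algebra T_H(M) of a bimodule M over an algebra H. *)
Record bimodule (k : fieldType) (H : algType k) (M : lmodType k) := Bimodule {
  lact : H -> M -> M;
  ract : M -> H -> M;
  lact_bilin : bilin2 lact;
  ract_bilin : bilin2 ract;
  lact1 : forall x, lact 1 x = x;
  ract1 : forall x, ract x 1 = x;
  lactM : forall g h x, lact (g * h) x = lact g (lact h x);
  ractM : forall x g h, ract x (g * h) = ract (ract x g) h;
  lractA : forall g x h, ract (lact g x) h = lact g (ract x h)
}.

Section TensorAlgebra.
Variables (k : fieldType) (H : algType k) (M : lmodType k) (B : bimodule H M).
Local Notation lact := (lact B).
Local Notation ract := (ract B).

(* The pair ([:: x_1; ...; x_n], h) stands for x_1 (x)_H ... (x)_H x_n h; so the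
   words of length n span M^(x)_H n (x)_H H = M^(x)_H n, which is H if n = 0. *)
Definition tword := (seq M * H)%type.

Definition balanced (W : lmodType k) (f : tword -> W) : Prop :=
  [/\ forall xs, linear (fun h => f (xs, h)),
      forall xs ys h, linear (fun x => f (xs ++ x :: ys, h)),
      forall xs ys x g y h,
        f (xs ++ ract x g :: y :: ys, h) = f (xs ++ x :: lact g y :: ys, h) &
      forall xs x g h, f (xs ++ [:: ract x g], h) = f (xs ++ [:: x], g * h)].

Definition TA : Type := univ balanced.
HB.instance Definition _ := GRing.Lmodule.copy TA (univ balanced).

Definition TAword (w : tword) : TA := ugen w.

Definition wmul (v w : tword) : tword :=
  match w.1 with
  | [::] => (v.1, v.2 * w.2)
  | y :: ys => (v.1 ++ lact v.2 y :: ys, w.2)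
  end.

Lemma wmulA : associative wmul.
Proof.
move=> [xs g] [[|y ys] h] [[|z zs] l]; rewrite /wmul /=.
- by rewrite mulrA.
- by rewrite lactM.
- by [].
- by rewrite -catA.
Qed.

Lemma wmul1w : left_id ([::], 1) wmul.
Proof. by move=> [[|x xs] h]; rewrite /wmul /= ?mul1r ?lact1. Qed.

Lemma wmulw1 : right_id ([::], 1) wmul.
Proof. by move=> [xs h]; rewrite /wmul /= mulr1. Qed.

Lemma TAword_balanced : balanced TAword.
Proof.
split=> [xs c h h'|xs ys h c x x'|xs ys x g y h|xs x g h];
  apply: univ_ext => W f bf; have [f1 f2 f3 f4] := bf.
- by rewrite liftD // liftZ // !lift_ugen //; apply: f1.
- by rewrite liftD // liftZ // !lift_ugen //; apply: f2.
- by rewrite !lift_ugen.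
- by rewrite !lift_ugen.
Qed.

Lemma balanced_wmull (W : lmodType k) (f : tword -> W) w :
  balanced f -> balanced (fun v => f (wmul v w)).
Proof.
case: w => [[|z zs] l] bf; have [f1 f2 f3 f4] := bf; rewrite /wmul /=.
- split=> [xs c h h'|xs ys h|xs ys x g y h|xs x g h] /=.
  + by rewrite mulrDl -scalerAl f1.
  + exact: f2.
  + by rewrite f3.
  + by rewrite f4 mulrA.
- split=> [xs c h h'|xs ys h|xs ys x g y h|xs x g h] /=.
  + by rewrite (lact_bilin B).1 f2.
  + by move=> c x x'; rewrite -!catA /= f2.
  + by rewrite -!catA /= f3.
  + by rewrite -!catA /= f3 lactM.
Qed.

Lemma balanced_wmulr (W : lmodType k) (f : tword -> W) v :
  balanced f -> balanced (fun w => f (wmul v w)).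
Proof.
case: v => [zs l] bf; have [f1 f2 f3 f4] := bf; rewrite /wmul /=.
split=> [[|x xs] c h h'|[|x0 xs] ys h c x x'|[|x0 xs] ys x g y h|[|x0 xs] x g h] /=.
- by rewrite mulrDr -scalerAr f1.
- exact: f1.
- by rewrite (lact_bilin B).2 f2.
- by have := f2 (zs ++ lact l x0 :: xs) ys h c x x'; rewrite -!catA.
- by rewrite -lractA f3.
- by have := f3 (zs ++ lact l x0 :: xs) ys x g y h; rewrite -!catA.
- by rewrite -lractA f4.
- by have := f4 (zs ++ lact l x0 :: xs) x g h; rewrite -!catA.
Qed.

Definition TAmul (x y : TA) : TA :=
  lift (fun v => lift (fun w => TAword (wmul v w)) y) x.

Lemma TAmul_bal (y : TA) : balanced (fun v => lift (fun w => TAword (wmul v w)) y).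
Proof.
have b w := balanced_wmull w TAword_balanced.
split=> [xs|xs ys h|xs ys x g y' h|xs x g h]; last 2 first.
- by apply: eq_bigr => p _; have [_ _ -> _] := b p.2.
- by apply: eq_bigr => p _; have [_ _ _ ->] := b p.2.
- by apply: (lift_linear_par (f := fun h w => TAword (wmul (xs, h) w))) => w;
    have [] := b w.
- apply: (lift_linear_par (f := fun x w => TAword (wmul (xs ++ x :: ys, h) w))) => w.
  by have [_ h2 _ _] := b w; apply: h2.
Qed.

Lemma TAmul_linl y : linear (TAmul^~ y).
Proof. exact: lift_linear (TAmul_bal y). Qed.

Lemma TAmul_linr x : linear (TAmul x).
Proof.
apply: lift_linear_par => v; apply: lift_linear.
exact: balanced_wmulr TAword_balanced.
Qed.

Lemma TAmul_word v w : TAmul (TAword v) (TAword w) = TAword (wmul v w).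
Proof.
rewrite /TAmul {1}/TAword lift_ugen; last exact: TAmul_bal.
by rewrite lift_ugen //; apply: balanced_wmulr TAword_balanced.
Qed.

Lemma TAmulA : associative TAmul.
Proof.
move=> x y z; move: x.
apply: (univ_eq (f := fun x => TAmul x (TAmul y z))
                (g := fun x => TAmul (TAmul x y) z)) => [||v].
- exact: TAmul_linl.
- by apply: (linear_comp (g := TAmul^~ z) (f := TAmul^~ y)); apply: TAmul_linl.
move: y; apply: (univ_eq (f := fun y => TAmul (TAword v) (TAmul y z))
                (g := fun y => TAmul (TAmul (TAword v) y) z)) => [||w].
- apply: (linear_comp (g := TAmul (TAword v)) (f := TAmul^~ z)).
    exact: TAmul_linr.
  exact: TAmul_linl.
- apply: (linear_comp (g := TAmul^~ z) (f := TAmul (TAword v))).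
    exact: TAmul_linl.
  exact: TAmul_linr.
move: z; apply: (univ_eq (f := fun z => TAmul (TAword v) (TAmul (TAword w) z))
                (g := fun z => TAmul (TAmul (TAword v) (TAword w)) z)) => [||u].
- apply: (linear_comp (g := TAmul (TAword v)) (f := TAmul (TAword w)));
  exact: TAmul_linr.
- exact: TAmul_linr.
by rewrite -!/(TAword _) !TAmul_word wmulA.
Qed.

Lemma TAmul1 : left_id (TAword ([::], 1)) TAmul.
Proof.
apply: (univ_eq (g := fun x => x)) => [||w]; first exact: TAmul_linr.
  by move=> c x y.
by rewrite -/(TAword _) TAmul_word wmul1w.
Qed.

Lemma TAmulr1 : right_id (TAword ([::], 1)) TAmul.
Proof.
apply: (univ_eq (f := fun x => TAmul x _) (g := fun x => x)) => [||w].
- exact: TAmul_linl.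
- by move=> c x y.
by rewrite -/(TAword _) TAmul_word wmulw1.
Qed.

Lemma TAmulDl : left_distributive TAmul +%R.
Proof. by move=> x y z; have := TAmul_linl z 1 x y; rewrite !scale1r. Qed.
Lemma TAmulDr : right_distributive TAmul +%R.
Proof. by move=> x y z; have := TAmul_linr x 1 y z; rewrite !scale1r. Qed.

(* The component in M^(x)_H 0 = H of an element of T_H(M). *)
Definition TAproj0 (t : TA) : H :=
  lift (fun w : tword => if w.1 is [::] then w.2 else 0) t.

Lemma TAproj0_bal :
  balanced (fun w : tword => (if w.1 is [::] then w.2 else 0) : H).
Proof.
split=> [[|x xs]|[|x xs] ys h|[|x0 xs] ys x g y h|[|x0 xs] x g h] //=;
  exact: linear_fun0.
Qed.

Lemma TA1_neq0 : TAword ([::], 1) != 0 :> TA.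
Proof.
apply/eqP => /(congr1 TAproj0); rewrite /TAproj0 lift_ugen /=; last exact: TAproj0_bal.
rewrite [X in _ = X](_ : _ = 0); first by move/eqP; rewrite oner_eq0.
have /(_ (-1) 0 0) := lift_linear TAproj0_bal.
by rewrite scaler0 addr0 scaleN1r addNr.
Qed.

HB.instance Definition _ := GRing.Zmodule_isNzRing.Build TA
  TAmulA TAmul1 TAmulr1 TAmulDl TAmulDr TA1_neq0.

Lemma TAscalerAl c (x y : TA) : c *: (x * y) = (c *: x) * y.
Proof.
have h0 : TAmul 0 y = 0.
  by have := TAmul_linl y (-1) 0 0; rewrite scaler0 addr0 scaleN1r addNr.
by have := TAmul_linl y c x 0; rewrite h0 !addr0.
Qed.
Lemma TAscalerAr c (x y : TA) : c *: (x * y) = x * (c *: y).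
Proof.
have h0 : TAmul x 0 = 0.
  by have := TAmul_linr x (-1) 0 0; rewrite scaler0 addr0 scaleN1r addNr.
by have := TAmul_linr x c y 0; rewrite h0 !addr0.
Qed.

HB.instance Definition _ := GRing.Lmodule_isLalgebra.Build k TA TAscalerAl.
HB.instance Definition _ := GRing.Lalgebra_isAlgebra.Build k TA TAscalerAr.

Definition TAin0 (h : H) : TA := TAword ([::], h).
Definition TAin1 (x : M) : TA := TAword ([:: x], 1).

(* The component in M^(x)_H 1 = M of an element of T_H(M). *)
Definition TAproj1 (t : TA) : M :=
  lift (fun w : tword => if w.1 is [:: x] then ract x w.2 else 0) t.

Lemma TAproj1_bal :
  balanced (fun w : tword => (if w.1 is [:: x] then ract x w.2 else 0) : M).
Proof.
have [r1 r2] := ract_bilin B.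
split=> [[|x [|x' xs]]|[|x0 [|x1 xs]] [|y ys] h|[|x0 [|x1 xs]] ys x g y h|
         [|x0 [|x1 xs]] x g h] //=; do ?exact: linear_fun0; do ?exact: r2; do ?exact: r1.
by rewrite ractM.
Qed.

Definition TAdeg (n : nat) (t : TA) : Prop :=
  exists s : seq tword, all (fun w => size w.1 == n) s /\ t = \sum_(w <- s) TAword w.

(* x_1 (x) ... (x) x_n |-> f(x_1) x_2 (x) ... (x) x_n, for f right H-linear. *)
Definition lcontract (f : M -> H) (t : TA) : TA :=
  lift (fun w : tword =>
    if w.1 is x :: xs then TAin0 (f x) * TAword (xs, w.2) else 0) t.

Lemma lcontract_bal (f : M -> H) :
  linear f -> (forall x h, f (ract x h) = f x * h) ->
  balanced (fun w : tword =>
    (if w.1 is x :: xs then TAin0 (f x) * TAword (xs, w.2) else 0) : TA).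
Proof.
move=> lf fr; pose F x := fun w => TAword (wmul ([::], f x) w).
have E0 a w : TAin0 a * TAword w = TAword (wmul ([::], a) w) by apply: TAmul_word.
have E x w : TAin0 (f x) * TAword w = F x w by apply: E0.
have bF x : balanced (F x) := balanced_wmulr _ TAword_balanced.
split=> [[|x xs]|[|x xs] ys h c|[|x0 xs] ys x g y h|[|x0 xs] x g h] //=;
  do ?exact: linear_fun0.
- by move=> c h h'; rewrite !E; have [-> _ _ _] := bF x.
- move=> x x'; rewrite !E /F lf.
  have [b1 _ _ _] := balanced_wmull (ys, h) TAword_balanced.
  exact: (b1 [::] c (f x) (f x')).
- by move=> y y'; rewrite !E; have [_ b2 _ _] := bF x; apply: b2.
- by rewrite fr !E0 /wmul /= lactM.
- by rewrite !E; have [_ _ b3 _] := bF x0; apply: b3.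
- by rewrite fr !E0 /wmul /= mulrA.
- by rewrite !E; have [_ _ _ b4] := bF x0; apply: b4.
Qed.

(* x_1 (x) ... (x) x_n |-> x_1 (x) ... (x) x_(n-1) f(x_n), for f left H-linear. *)
Definition rcontract (f : M -> H) (t : TA) : TA :=
  lift (fun w : tword =>
    if rev w.1 is x :: xs then TAword (rev xs, f (ract x w.2)) else 0) t.

Lemma rcontract_bal (f : M -> H) :
  linear f -> (forall h x, f (lact h x) = h * f x) ->
  balanced (fun w : tword =>
    (if rev w.1 is x :: xs then TAword (rev xs, f (ract x w.2)) else 0) : TA).
Proof.
move=> lf fl; have [b1 b2 b3 b4] := TAword_balanced; have [r1 r2] := ract_bilin B.
have E xs x h : (if rev (xs ++ [:: x]) is y :: ys
                 then TAword (rev ys, f (ract y h)) else 0) = TAword (xs, f (ract x h)).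
  by rewrite rev_cat /= revK.
split=> [xs|xs ys h|xs ys x g y h|xs x g h] /=.
- elim/last_ind: xs => [|xs x _]; first exact: linear_fun0.
  by move=> c h h'; rewrite -cats1 !E r2 lf b1.
- elim/last_ind: ys => [|ys y _] c x x'; first by rewrite !E r1 lf b1.
  by rewrite -cats1 -!cat_cons !catA !E b2.
- elim/last_ind: ys => [|ys z _].
    by rewrite -!cat_rcons !cats0 -!cats1 !E lractA fl b4.
  by rewrite -cats1 -!cat_cons !catA !E b3.
- by rewrite !E ractM.
Qed.

End TensorAlgebra.

Section Quotient.
Variables (k : fieldType) (R : algType k) (S : R -> Prop).

Inductive ideal_gen : R -> Prop :=
| ideal_gen0 : ideal_gen 0
| ideal_genD x y : ideal_gen x -> ideal_gen y -> ideal_gen (x + y)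
| ideal_genM a s b : S s -> ideal_gen (a * s * b).

Lemma ideal_genMl a x : ideal_gen x -> ideal_gen (a * x).
Proof.
elim=> [|y z _ IHy _ IHz|b s c Ss]; first by rewrite mulr0; apply: ideal_gen0.
  by rewrite mulrDr; apply: ideal_genD.
by rewrite !mulrA; apply: ideal_genM.
Qed.

Lemma ideal_genMr x a : ideal_gen x -> ideal_gen (x * a).
Proof.
elim=> [|y z _ IHy _ IHz|b s c Ss]; first by rewrite mul0r; apply: ideal_gen0.
  by rewrite mulrDl; apply: ideal_genD.
by rewrite -!mulrA mulrA; apply: ideal_genM.
Qed.

Lemma ideal_genZ c x : ideal_gen x -> ideal_gen (c *: x).
Proof. by move=> h; rewrite -[x]mul1r scalerAl; apply: ideal_genMl. Qed.

Lemma ideal_genN x : ideal_gen x -> ideal_gen (- x).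
Proof. by rewrite -scaleN1r; apply: ideal_genZ. Qed.

Definition ideal_rel (x y : R) : bool := `[< ideal_gen (x - y) >].

Lemma ideal_rel_refl : reflexive ideal_rel.
Proof. by move=> x; apply/asboolP; rewrite subrr; apply: ideal_gen0. Qed.

Lemma ideal_rel_sym : symmetric ideal_rel.
Proof.
by move=> x y; apply/asboolP/asboolP => /ideal_genN; rewrite opprB.
Qed.

Lemma ideal_rel_trans : transitive ideal_rel.
Proof.
move=> y x z /asboolP h1 /asboolP h2; apply/asboolP.
by have := ideal_genD h1 h2; rewrite addrA subrK.
Qed.

Definition ideal_eqv :=
  EquivRel ideal_rel ideal_rel_refl ideal_rel_sym ideal_rel_trans.

(* R / <S>.  Only a [pzRingType] and an [lmodType k], as it may be zero. *)
Definition alg_quot : Type := {eq_quot ideal_eqv}%qT.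
HB.instance Definition _ : EqQuotient _ ideal_eqv alg_quot :=
  EqQuotient.on alg_quot.
HB.instance Definition _ := Choice.on alg_quot.

Definition qclass (x : R) : alg_quot := (\pi_alg_quot x)%qT.
Definition qrepr (x : alg_quot) : R := repr x.

Lemma qreprK x : qclass (qrepr x) = x.
Proof. exact: reprK. Qed.

Lemma qclassP x y : qclass x = qclass y <-> ideal_gen (x - y).
Proof. by split => [/eqquotP/asboolP|h]; last exact/eqquotP/asboolP. Qed.

Lemma qrepr_class x : ideal_gen (qrepr (qclass x) - x).
Proof. by apply/qclassP; rewrite qreprK. Qed.

Definition qadd x y := qclass (qrepr x + qrepr y).
Definition qopp x := qclass (- qrepr x).
Definition qmul x y := qclass (qrepr x * qrepr y).
Definition qscale (c : k) x := qclass (c *: qrepr x).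

Lemma qaddE x y : qadd (qclass x) (qclass y) = qclass (x + y).
Proof.
apply/qclassP; rewrite opprD addrACA; apply: ideal_genD; exact: qrepr_class.
Qed.
Lemma qoppE x : qopp (qclass x) = qclass (- x).
Proof. by apply/qclassP; rewrite -opprD; apply/ideal_genN/qrepr_class. Qed.
Lemma qscaleE c x : qscale c (qclass x) = qclass (c *: x).
Proof. by apply/qclassP; rewrite -scalerBr; apply/ideal_genZ/qrepr_class. Qed.
Lemma qmulE x y : qmul (qclass x) (qclass y) = qclass (x * y).
Proof.
apply/qclassP; set x' := qrepr _; set y' := qrepr _.
rewrite (_ : _ - _ = (x' - x) * y' + x * (y' - y)).
  by apply: ideal_genD; [apply: ideal_genMr | apply: ideal_genMl];
    apply: qrepr_class.
by rewrite mulrBl mulrBr addrA subrK.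
Qed.

Lemma qind (P : alg_quot -> Prop) : (forall x, P (qclass x)) -> forall x, P x.
Proof. by move=> h x; rewrite -(qreprK x). Qed.

Lemma qaddA : associative qadd.
Proof. by do 3!elim/qind => ?; rewrite !qaddE addrA. Qed.
Lemma qaddC : commutative qadd.
Proof. by do 2!elim/qind => ?; rewrite !qaddE addrC. Qed.
Lemma qadd0 : left_id (qclass 0) qadd.
Proof. by elim/qind => ?; rewrite qaddE add0r. Qed.
Lemma qaddN : left_inverse (qclass 0) qopp qadd.
Proof. by elim/qind => ?; rewrite qoppE qaddE addNr. Qed.

HB.instance Definition _ := GRing.isZmodule.Build alg_quot qaddA qaddC qadd0 qaddN.

Lemma qclassD x y : qclass x + qclass y = qclass (x + y).
Proof. exact: qaddE. Qed.

Lemma qmulA : associative qmul.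
Proof. by do 3!elim/qind => ?; rewrite !qmulE mulrA. Qed.
Lemma qmul1 : left_id (qclass 1) qmul.
Proof. by elim/qind => ?; rewrite qmulE mul1r. Qed.
Lemma qmulr1 : right_id (qclass 1) qmul.
Proof. by elim/qind => ?; rewrite qmulE mulr1. Qed.
Lemma qmulDl : left_distributive qmul +%R.
Proof. by do 3!elim/qind => ?; rewrite !(qmulE, qclassD) mulrDl. Qed.
Lemma qmulDr : right_distributive qmul +%R.
Proof. by do 3!elim/qind => ?; rewrite !(qmulE, qclassD) mulrDr. Qed.

HB.instance Definition _ := GRing.Zmodule_isPzRing.Build alg_quot
  qmulA qmul1 qmulr1 qmulDl qmulDr.

Lemma qscaleA a b x : qscale a (qscale b x) = qscale (a * b) x.
Proof. by elim/qind: x => ?; rewrite !qscaleE scalerA. Qed.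
Lemma qscale1 : left_id 1 qscale.
Proof. by elim/qind => ?; rewrite !qscaleE scale1r. Qed.
Lemma qscaleDr : right_distributive qscale +%R.
Proof. by move=> a; do 2!elim/qind => ?; rewrite !(qscaleE, qclassD) scalerDr. Qed.
Lemma qscaleDl x : {morph qscale^~ x : a b / a + b}.
Proof. by move=> a b; elim/qind: x => ?; rewrite !(qscaleE, qclassD) scalerDl. Qed.

HB.instance Definition _ := GRing.Zmodule_isLmodule.Build k alg_quot
  qscaleA qscale1 qscaleDr qscaleDl.

End Quotient.

Section Hopf.
Variables (k : fieldType) (H : algType k).

Definition tensor_mul (x y : tensor H H) : tensor H H :=
  tlift (fun a b => tlift (fun a' b' => tens (a * a') (b * b')) y) x.

Record hopf := Hopf {
  coprod : {linear H -> tensor H H};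
  counit : {linear H -> k^o};
  antipode : {linear H -> H};
  coprod_coassoc : forall h,
    tlift (fun a b => tlift (fun a1 a2 => tens a1 (tens a2 b)) (coprod a))
          (coprod h)
    = tlift (fun a b => tens a (coprod b)) (coprod h) :> tensor H (tensor H H);
  counitl : forall h, tlift (fun a b => counit a *: b) (coprod h) = h;
  counitr : forall h, tlift (fun a b => counit b *: a) (coprod h) = h;
  coprod1 : coprod 1 = tens 1 1;
  coprodM : forall g h, coprod (g * h) = tensor_mul (coprod g) (coprod h);
  counit1 : counit 1 = 1;
  counitM : forall g h, counit (g * h) = counit g * counit h;
  antipodel : forall h,
    tlift (fun a b => antipode a * b) (coprod h) = counit h *: 1;
  antipoder : forall h,
    tlift (fun a b => a * antipode b) (coprod h) = counit h *: 1
}.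

Record hmodule (V : lmodType k) := Hmodule {
  hact : H -> V -> V;
  hact_bilin : bilin2 hact;
  hact1 : forall v, hact 1 v = v;
  hactM : forall g h v, hact (g * h) v = hact g (hact h v)
}.

Variable hH : hopf.

(* Sweedler notation: f(h_(1), h_(2)), for f bilinear. *)
Definition sweedler (W : lmodType k) (f : H -> H -> W) (h : H) : W :=
  tlift f (coprod hH h).

Record module_algebra (A : algType k) := ModuleAlgebra {
  ma_module :> hmodule A;
  ma_mul : forall h a b, hact ma_module h (a * b) =
    sweedler (fun h1 h2 => hact ma_module h1 a * hact ma_module h2 b) h;
  ma_one : forall h, hact ma_module h 1 = counit hH h *: 1
}.

Lemma lift_comp (X : choiceType) (C : forall W : lmodType k, (X -> W) -> Prop)
    (W Z : lmodType k) (F : W -> Z) (f : X -> W) (x : univ C) :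
  linear F -> F (lift f x) = lift (fun v => F (f v)) x.
Proof.
move=> lF; have F0 : F 0 = 0.
  by have := lF (-1) 0 0; rewrite scaler0 addr0 scaleN1r addNr.
rewrite /lift /lsum; elim: (urepr x) => [|p s IH]; rewrite ?big_nil ?big_cons //.
by rewrite lF IH.
Qed.

Lemma sweedler_comp (W Z : lmodType k) (F : W -> Z) (f : H -> H -> W) h :
  linear F -> F (sweedler f h) = sweedler (fun a b => F (f a b)) h.
Proof. exact: lift_comp. Qed.

Lemma eq_sweedler (W : lmodType k) (f g : H -> H -> W) h :
  (forall a b, f a b = g a b) -> sweedler f h = sweedler g h.
Proof. by move=> fg; apply: eq_bigr => p _; rewrite fg. Qed.

Lemma sweedler_linear (W : lmodType k) (f : H -> H -> W) :
  bilin2 f -> linear (sweedler f).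
Proof. by move=> bf c x y; rewrite /sweedler linearP tlift_linear. Qed.

Lemma sweedler_par (U W : lmodType k) (f : U -> H -> H -> W) h :
  (forall a b, linear (fun s => f s a b)) -> linear (fun s => sweedler (f s) h).
Proof. exact: tlift_linear_par. Qed.

Lemma exchange_sweedler (W : lmodType k) (f : H -> H -> H -> H -> W) g h :
  sweedler (fun a b => sweedler (fun c d => f a b c d) h) g
  = sweedler (fun c d => sweedler (fun a b => f a b c d) g) h.
Proof.
rewrite /sweedler /tlift /lift /lsum.
under eq_bigr do rewrite scaler_sumr.
rewrite exchange_big /=; apply: eq_bigr => p _; rewrite scaler_sumr.
by apply: eq_bigr => q _; rewrite !scalerA mulrC.
Qed.

Definition trilin (W : lmodType k) (f : H -> H -> H -> W) : Prop :=
  [/\ forall b c, linear (fun a => f a b c), forall a c, linear (fun b => f a b c)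
    & forall a b, linear (fun c => f a b c)].

Lemma sweedler_coassoc (W : lmodType k) (f : H -> H -> H -> W) h : trilin f ->
  sweedler (fun a b => sweedler (fun a1 a2 => f a1 a2 b) a) h
  = sweedler (fun a b => sweedler (fun b1 b2 => f a b1 b2) b) h.
Proof.
move=> [f1 f2 f3]; pose F := tlift (fun a (y : tensor H H) => tlift (f a) y).
have bF : bilin2 (fun a (y : tensor H H) => tlift (f a) y).
  split=> [y|a]; first by apply: tlift_linear_par.
  by apply: tlift_linear; split=> *; [apply: f2 | apply: f3].
have lF : linear F by apply: tlift_linear.
have := congr1 F (coprod_coassoc hH h).
rewrite -!/(sweedler _ _) [LHS](sweedler_comp _ _ lF) [RHS](sweedler_comp _ _ lF).
move=> E; transitivity (sweedler (fun a b =>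
  F (tlift (fun a1 a2 => tens a1 (tens a2 b)) (coprod hH a))) h).
  apply: eq_sweedler => a b; rewrite -/(sweedler _ _) sweedler_comp //.
  apply: eq_sweedler => a1 a2; rewrite /F tlift_tens // tlift_tens //.
by rewrite E; apply: eq_sweedler => a b; rewrite /F tlift_tens.
Qed.

Lemma sweedlerM (W : lmodType k) (f : H -> H -> W) g h : bilin2 f ->
  sweedler f (g * h) =
  sweedler (fun g1 g2 => sweedler (fun h1 h2 => f (g1 * h1) (g2 * h2)) h) g.
Proof.
move=> bf; rewrite {1}/sweedler coprodM /tensor_mul.
have lF : linear (tlift f) by apply: tlift_linear.
rewrite -/(sweedler _ _) sweedler_comp //; apply: eq_sweedler => a b.
rewrite -/(sweedler _ _) sweedler_comp //; apply: eq_sweedler => a' b'.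
by rewrite tlift_tens.
Qed.

Lemma sweedler1 (W : lmodType k) (f : H -> H -> W) : bilin2 f ->
  sweedler f 1 = f 1 1.
Proof. by move=> bf; rewrite /sweedler coprod1 tlift_tens. Qed.

End Hopf.

(* The smash product A # H; the underlying space does not depend on the action,
   which is a parameter for the sake of the product defined below. *)
Definition smash (k : fieldType) (H A : algType k) (hH : hopf H)
  (act : module_algebra hH A) : Type := tensor A H.

Section Smash.
Variables (k : fieldType) (H A : algType k) (hH : hopf H).
Variable act : module_algebra hH A.
Local Notation "h |> a" := (hact act h a) (at level 45, right associativity).

Local Notation smash := (smash act).

HB.instance Definition _ := GRing.Lmodule.copy smash (tensor A H).

Definition smash_tens (a : A) (h : H) : smash := tens a h.

Definition smash_mul (x y : smash) : smash :=
  tlift (fun a h => tlift (fun b g =>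
    sweedler hH (fun h1 h2 => smash_tens (a * (h1 |> b)) (h2 * g)) h) y) x.

Let aDl b : linear (fun h => h |> b). Proof. exact: (hact_bilin act).1. Qed.
Let aDr h : linear (fun b => h |> b). Proof. exact: (hact_bilin act).2. Qed.
Let tDl h : linear (fun a => smash_tens a h). Proof. exact: (tens_bilin _ _).1. Qed.
Let tDr a : linear (fun h => smash_tens a h). Proof. exact: (tens_bilin _ _).2. Qed.
Let mDl (R : algType k) (y : R) : linear (fun x => x * y).
Proof. by move=> c x x'; rewrite mulrDl scalerAl. Qed.
Let mDr (R : algType k) (x : R) : linear (fun y => x * y).
Proof. by move=> c y y'; rewrite mulrDr scalerAr. Qed.

Let F (a : A) (h : H) (b : A) (g : H) : smash :=
  sweedler hH (fun h1 h2 => smash_tens (a * (h1 |> b)) (h2 * g)) h.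

Let Fa h b g : linear (fun a => F a h b g).
Proof. by apply: sweedler_par => x y c a a'; rewrite mDl tDl. Qed.
Let Fh a b g : linear (fun h => F a h b g).
Proof.
apply: sweedler_linear; split=> [y c x x'|x c y y'].
  by rewrite aDl mDr tDl.
by rewrite mDl tDr.
Qed.
Let Fb a h g : linear (fun b => F a h b g).
Proof. by apply: sweedler_par => x y c b b'; rewrite aDr mDr tDl. Qed.
Let Fg a h b : linear (fun g => F a h b g).
Proof. by apply: sweedler_par => x y c g g'; rewrite mDr tDr. Qed.

Let bF a h : bilin2 (F a h). Proof. by split=> [g|b]; [apply: Fb | apply: Fg]. Qed.

Let bG y : bilin2 (fun a h => tlift (F a h) y).
Proof.
split=> [h|a].
- by apply: (tlift_linear_par (f := fun a => F a h)) => b g; apply: Fa.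
- by apply: (tlift_linear_par (f := fun h => F a h)) => b g; apply: Fh.
Qed.

Lemma smash_mul_tens a h b g :
  smash_mul (smash_tens a h) (smash_tens b g) =
  sweedler hH (fun h1 h2 => smash_tens (a * (h1 |> b)) (h2 * g)) h.
Proof.
by rewrite /smash_mul (tlift_tens _ _ (bG _)) (tlift_tens _ _ (bF _ _)).
Qed.

Lemma smash_mul_linl y : linear (smash_mul^~ y).
Proof. exact: (tlift_linear (bG y)). Qed.

Lemma smash_mul_linr x : linear (smash_mul x).
Proof.
apply: (lift_linear_par (f := fun y p => tlift (F p.1 p.2) y)) => p.
exact: tlift_linear.
Qed.

Lemma smash_mulA : associative smash_mul.
Proof.
move=> x y z; move: x.
apply: (tens_eq (f := fun x => smash_mul x (smash_mul y z))
                (g := fun x => smash_mul (smash_mul x y) z)) => [||a h].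
- exact: smash_mul_linl.
- by apply: (linear_comp (g := smash_mul^~ z) (f := smash_mul^~ y));
    apply: smash_mul_linl.
move: y; apply: (tens_eq (f := fun y => smash_mul (smash_tens a h) (smash_mul y z))
    (g := fun y => smash_mul (smash_mul (smash_tens a h) y) z)) => [||b g].
- apply: (linear_comp (g := smash_mul (smash_tens a h)) (f := smash_mul^~ z)).
    exact: smash_mul_linr.
  exact: smash_mul_linl.
- apply: (linear_comp (g := smash_mul^~ z) (f := smash_mul (smash_tens a h))).
    exact: smash_mul_linl.
  exact: smash_mul_linr.
move: z; apply: (tens_eq
    (f := fun z => smash_mul (smash_tens a h) (smash_mul (smash_tens b g) z))
    (g := fun z => smash_mul (smash_mul (smash_tens a h) (smash_tens b g)) z))
  => [||c l].
- apply: (linear_comp (g := smash_mul (smash_tens a h))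
    (f := smash_mul (smash_tens b g))); exact: smash_mul_linr.
- exact: smash_mul_linr.
rewrite -/(smash_tens c l) !smash_mul_tens.
rewrite (sweedler_comp hH _ _ (smash_mul_linr _)).
rewrite (sweedler_comp (F := smash_mul^~ (smash_tens c l)) hH _ _ (smash_mul_linl _)).
pose T h1 h2 h3 g1 g2 :=
  smash_tens (a * (h1 |> b) * (h2 |> g1 |> c)) (h3 * g2 * l).
transitivity (sweedler hH (fun g1 g2 => sweedler hH (fun h1 h2 =>
    sweedler hH (fun h11 h12 => T h11 h12 h2 g1 g2) h1) h) g).
  apply: eq_sweedler => g1 g2; rewrite smash_mul_tens; apply: eq_sweedler => h1 h2.
  rewrite ma_mul (sweedler_comp (F := fun s => smash_tens (a * s) (h2 * (g2 * l))) hH).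
    by apply: eq_sweedler => h11 h12; rewrite /T !mulrA.
  by move=> e u v; rewrite mDr tDl.
have Tlin g1 g2 : trilin (fun h1 h2 h3 => T h1 h2 h3 g1 g2).
  rewrite /T; split=> [y z e x x'|x z e y y'|x y e z z'].
  - by rewrite aDl mDr mDl tDl.
  - by rewrite aDl mDr tDl.
  - by rewrite !mDl tDr.
under eq_sweedler do rewrite (sweedler_coassoc hH _ (Tlin _ _)).
rewrite exchange_sweedler; apply: eq_sweedler => h1 h2.
rewrite smash_mul_tens sweedlerM; last first.
  split=> [y e x x'|x e y y']; first by rewrite aDl mDr tDl.
  by rewrite mDl tDr.
rewrite [LHS]exchange_sweedler; apply: eq_sweedler => h21 h22.
by apply: eq_sweedler => g1 g2; rewrite /T hactM.
Qed.

Lemma smash_mul1 : left_id (smash_tens 1 1) smash_mul.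
Proof.
apply: (tens_eq (g := fun x => x)) => [||a h] //; first exact: smash_mul_linr.
rewrite -/(smash_tens a h) smash_mul_tens sweedler1 ?hact1 ?mul1r //.
split=> [y e x x'|x e y y']; first by rewrite aDl mDr tDl.
by rewrite mDl tDr.
Qed.

Lemma smash_mulr1 : right_id (smash_tens 1 1) smash_mul.
Proof.
apply: (tens_eq (f := fun x => smash_mul x _) (g := fun x => x)) => [||a h] //.
  exact: smash_mul_linl.
rewrite -/(smash_tens a h) smash_mul_tens.
rewrite -[in RHS](counitl hH h) -/(sweedler _ _ _).
rewrite (sweedler_comp (F := smash_tens a) hH) //; apply: eq_sweedler => h1 h2.
by rewrite ma_one mulr1 -scalerAr mulr1 /smash_tens tensZl tensZr.
Qed.

Lemma smash_mulDl : left_distributive smash_mul +%R.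
Proof. by move=> x y z; have := smash_mul_linl z 1 x y; rewrite !scale1r. Qed.
Lemma smash_mulDr : right_distributive smash_mul +%R.
Proof. by move=> x y z; have := smash_mul_linr x 1 y z; rewrite !scale1r. Qed.

Lemma smash1_neq0 : smash_tens 1 1 != 0.
Proof.
pose f (a : A) (h : H) : A := counit hH h *: a.
have bf : bilin2 f.
  split=> [h c a a'|a c h h']; rewrite /f.
    by rewrite scalerDr !scalerA mulrC.
  by rewrite linearP /= scalerDl scalerA.
apply/eqP => /(congr1 (tlift f)); rewrite tlift_tens // /f counit1 scale1r.
have /(_ (-1) 0 0) := tlift_linear bf; rewrite scaler0 addr0 scaleN1r addNr => ->.
by move/eqP; rewrite oner_eq0.
Qed.

HB.instance Definition _ := GRing.Zmodule_isNzRing.Build smash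
  smash_mulA smash_mul1 smash_mulr1 smash_mulDl smash_mulDr smash1_neq0.

Lemma smash_scalerAl c (x y : smash) : c *: (x * y) = (c *: x) * y.
Proof.
have h0 : smash_mul 0 y = 0.
  by have := smash_mul_linl y (-1) 0 0; rewrite scaler0 addr0 scaleN1r addNr.
by have := smash_mul_linl y c x 0; rewrite h0 !addr0.
Qed.
Lemma smash_scalerAr c (x y : smash) : c *: (x * y) = x * (c *: y).
Proof.
have h0 : smash_mul x 0 = 0.
  by have := smash_mul_linr x (-1) 0 0; rewrite scaler0 addr0 scaleN1r addNr.
by have := smash_mul_linr x c y 0; rewrite h0 !addr0.
Qed.

HB.instance Definition _ := GRing.Lmodule_isLalgebra.Build k smash smash_scalerAl.
HB.instance Definition _ := GRing.Lalgebra_isAlgebra.Build k smash smash_scalerAr.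

End Smash.

(* The H-bimodule V (x) H: diagonal left action, right multiplication on H. *)
Section InducedBimodule.
Variables (k : fieldType) (H : algType k) (hH : hopf H).
Variables (V : lmodType k) (actV : hmodule H V).
Local Notation "h |> v" := (hact actV h v) (at level 45, right associativity).

Definition VHlact (g : H) (x : tensor V H) : tensor V H :=
  tlift (fun v h => sweedler hH (fun g1 g2 => tens (g1 |> v) (g2 * h)) g) x.
Definition VHract (x : tensor V H) (g : H) : tensor V H :=
  tlift (fun v h => tens v (h * g)) x.

Let aDl b : linear (fun h => h |> b). Proof. exact: (hact_bilin actV).1. Qed.
Let aDr h : linear (fun b => h |> b). Proof. exact: (hact_bilin actV).2. Qed.
Let tDl h : linear (fun v : V => tens v h : tensor V H).
Proof. exact: (tens_bilin _ _).1. Qed.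
Let tDr v : linear (fun h => tens v h : tensor V H).
Proof. exact: (tens_bilin _ _).2. Qed.
Let mDl (y : H) : linear (fun x => x * y).
Proof. by move=> c x x'; rewrite mulrDl scalerAl. Qed.
Let mDr (x : H) : linear (fun y => x * y).
Proof. by move=> c y y'; rewrite mulrDr scalerAr. Qed.

Let L g v h : tensor V H := sweedler hH (fun g1 g2 => tens (g1 |> v) (g2 * h)) g.
Let Lbody v h : bilin2 (fun g1 g2 => tens (g1 |> v) (g2 * h) : tensor V H).
Proof.
by split=> [y e x x'|x e y y']; [rewrite aDl tDl | rewrite mDl tDr].
Qed.
Let Lg v h : linear (fun g => L g v h).
Proof. exact: sweedler_linear. Qed.
Let bL g : bilin2 (L g).
Proof.
split=> [h|v]; apply: sweedler_par => x y c u u'.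
  by rewrite aDr tDl.
by rewrite mDr tDr.
Qed.
Let bR g : bilin2 (fun (v : V) (h : H) => tens v (h * g) : tensor V H).
Proof. by split=> [h c v v'|v c h h']; [rewrite tDl | rewrite mDl tDr]. Qed.

Lemma VHlact_tens g v h :
  VHlact g (tens v h) = sweedler hH (fun g1 g2 => tens (g1 |> v) (g2 * h)) g.
Proof. by rewrite /VHlact (tlift_tens _ _ (bL g)). Qed.
Lemma VHract_tens g v h : VHract (tens v h) g = tens v (h * g).
Proof. by rewrite /VHract (tlift_tens _ _ (bR g)). Qed.

Lemma VHlact_bilin : bilin2 VHlact.
Proof.
split=> [x|g]; last exact: tlift_linear (bL g).
apply: (tlift_linear_par (f := fun g => L g)) => v h; exact: Lg.
Qed.

Lemma VHract_bilin : bilin2 VHract.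
Proof.
split=> [g|x]; first exact: tlift_linear (bR g).
apply: (tlift_linear_par (f := fun g v h => tens v (h * g))) => v h c g g'.
by rewrite mDr tDr.
Qed.

Lemma VHlact1 x : VHlact 1 x = x.
Proof.
move: x; apply: (tens_eq (f := VHlact 1) (g := fun x => x)) => [||v h] //.
  exact: VHlact_bilin.2.
by rewrite VHlact_tens sweedler1 // hact1 mul1r.
Qed.

Lemma VHract1 x : VHract x 1 = x.
Proof.
move: x; apply: (tens_eq (f := VHract^~ 1) (g := fun x => x)) => [||v h] //.
  exact: VHract_bilin.1.
by rewrite VHract_tens mulr1.
Qed.

Lemma VHlactM g h x : VHlact (g * h) x = VHlact g (VHlact h x).
Proof.
move: x; apply: (tens_eq (f := VHlact (g * h)) (g := fun x => VHlact g (VHlact h x)))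
  => [||v l].
- exact: VHlact_bilin.2.
- apply: (linear_comp (g := VHlact g) (f := VHlact h)); exact: VHlact_bilin.2.
rewrite !VHlact_tens sweedlerM // (sweedler_comp hH _ _ (VHlact_bilin.2 g)).
rewrite exchange_sweedler; apply: eq_sweedler => h1 h2; rewrite VHlact_tens.
by apply: eq_sweedler => g1 g2; rewrite hactM mulrA.
Qed.

Lemma VHractM x g h : VHract x (g * h) = VHract (VHract x g) h.
Proof.
move: x; apply: (tens_eq (f := VHract^~ (g * h)) (g := fun x => VHract (VHract x g) h))
  => [||v l].
- exact: VHract_bilin.1.
- apply: (linear_comp (g := VHract^~ h) (f := VHract^~ g)); exact: VHract_bilin.1.
by rewrite !VHract_tens mulrA.
Qed.

Lemma VHlractA g x h : VHract (VHlact g x) h = VHlact g (VHract x h).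
Proof.
move: x; apply: (tens_eq (f := fun x => VHract (VHlact g x) h)
    (g := fun x => VHlact g (VHract x h))) => [||v l].
- apply: (linear_comp (g := VHract^~ h) (f := VHlact g)).
    exact: VHract_bilin.1.
  exact: VHlact_bilin.2.
- apply: (linear_comp (g := VHlact g) (f := VHract^~ h)).
    exact: VHlact_bilin.2.
  exact: VHract_bilin.1.
rewrite VHract_tens !VHlact_tens.
rewrite (sweedler_comp (F := VHract^~ h) hH _ _ (VHract_bilin.1 h)).
by apply: eq_sweedler => g1 g2; rewrite VHract_tens mulrA.
Qed.

Definition VH_bimodule : bimodule H (tensor V H) :=
  Bimodule VHlact_bilin VHract_bilin VHlact1 VHract1 VHlactM VHractM VHlractA.

End InducedBimodule.

Definition alg_iso (k : fieldType) (R A : algType k) (S : R -> Prop)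
    (f : alg_quot S -> A) : Prop :=
  [/\ linear f, GRing.monoid_morphism f & bijective f].

Definition kspan (k : fieldType) (U : lmodType k) (P : U -> Prop) (x : U) : Prop :=
  exists s : seq (k * U), (forall p, p \in s -> P p.2) /\
    x = \sum_(p <- s) p.1 *: p.2.

Section FieldSuperpotential.
Variables (k : fieldType) (V : lmodType k).

Lemma scale_bilin : bilin2 (fun (c : k^o) (v : V) => c *: v).
Proof.
split=> [v a b c|b a v w]; first by rewrite scalerDl scalerA.
by rewrite scalerDr !scalerA mulrC.
Qed.

Lemma scale_bilinr : bilin2 (fun (v : V) (c : k^o) => c *: v).
Proof. by have [h1 h2] := scale_bilin; split. Qed.

Lemma scale_racA (v : V) (b c : k^o) : (b * c) *: v = c *: (b *: v).
Proof. by rewrite scalerA mulrC. Qed.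

Lemma scale_lracA (b : k^o) (v : V) (c : k^o) : c *: (b *: v) = b *: (c *: v).
Proof. by rewrite !scalerA mulrC. Qed.

Definition scalar_bimodule : bimodule (k^o : algType k) V :=
  Bimodule scale_bilin scale_bilinr (@scale1r k V) (@scale1r k V)
    (fun b c v => esym (scalerA b c v)) scale_racA scale_lracA.

(* T_k(V); here a word ([:: v_1; ...; v_n], c) stands for c v_1 (x) ... (x) v_n. *)
Definition TV : Type := TA scalar_bimodule.
HB.instance Definition _ := GRing.Algebra.copy TV (TA scalar_bimodule).

Lemma scalar_balanced (W : lmodType k) (f : tword (k^o : algType k) V -> W) :
  (forall xs, linear (fun c => f (xs, c))) ->
  (forall xs ys c, linear (fun x => f (xs ++ x :: ys, c))) ->
  balanced scalar_bimodule f.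
Proof.
have lZ (X : lmodType k) (g : X -> W) c x : linear g -> g (c *: x) = c *: g x.
  move=> lg; have g0 : g 0 = 0.
    by have := lg (-1) 0 0; rewrite scaler0 addr0 scaleN1r addNr.
  by have := lg c x 0; rewrite g0 !addr0.
move=> f1 f2; split=> // [xs ys x g y h|xs x g h] /=.
- rewrite (lZ _ _ g x (f2 xs (y :: ys) h)).
  have := lZ _ _ g y (f2 (xs ++ [:: x]) ys h); by rewrite -!catA /= => ->.
- by rewrite (lZ _ _ g x (f2 xs [::] h)) -(lZ _ _ g h (f1 (xs ++ [:: x]))).
Qed.

Let TVw1 xs : linear (fun c => TAword scalar_bimodule (xs, c)).
Proof. by have [] := TAword_balanced scalar_bimodule. Qed.
Let TVw2 xs ys c : linear (fun x => TAword scalar_bimodule (xs ++ x :: ys, c)).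
Proof. by have [_ h _ _] := TAword_balanced scalar_bimodule; apply: h. Qed.

Definition theta (t : TV) : TV :=
  lift (fun w => TAword scalar_bimodule (rot 1 w.1, w.2)) t.

Lemma theta_bal : balanced scalar_bimodule
  (fun w => TAword scalar_bimodule (rot 1 w.1, w.2)).
Proof.
apply: scalar_balanced => [xs|[|x0 xs] ys c].
- exact: (TVw1 (rot 1 xs)).
- by move=> a x y; rewrite /= !rot1_cons -!cats1 TVw2.
- by move=> a x y; rewrite /= !rot1_cons -!cats1 -!catA /= TVw2.
Qed.

(* id (x) ... (x) id (x) sigma *)
Definition on_last (sigma : V -> V) (t : TV) : TV :=
  lift (fun w => if rev w.1 is x :: xs
    then TAword scalar_bimodule (rev (sigma x :: xs), w.2)
    else TAword scalar_bimodule w) t.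

Lemma on_last_bal (sigma : V -> V) : linear sigma -> balanced scalar_bimodule
  (fun w => if rev w.1 is x :: xs
    then TAword scalar_bimodule (rev (sigma x :: xs), w.2)
    else TAword scalar_bimodule w).
Proof.
move=> ls; have E xs x c : (if rev (xs ++ [:: x]) is y :: ys
    then TAword scalar_bimodule (rev (sigma y :: ys), c)
    else TAword scalar_bimodule (xs ++ [:: x], c))
    = TAword scalar_bimodule (xs ++ [:: sigma x], c).
  by rewrite rev_cat /= rev_cons revK cats1.
apply: scalar_balanced => [xs|xs ys c] /=.
  by case: (rev xs) => [|x xs']; apply: TVw1.
elim/last_ind: ys => [|ys y _] a x x'; first by rewrite !E ls TVw2.
by rewrite -cats1 -!cat_cons !catA !E -!catA /= TVw2.
Qed.

Definition superpotential (l : nat) (sigma : V -> V) (w : TV) : Prop :=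
  TAdeg l w /\ on_last sigma (theta w) = w.

(* [foldl] applies psi_1 to the first tensor factor, then psi_2 to the second... *)
Definition partial (i : nat) (w : TV) (t : TV) : Prop :=
  exists psi : i.-tuple {linear V -> k^o},
    t = foldl (fun s (f : {linear V -> k^o}) => lcontract f s) w psi.

(* The derivation-quotient algebra D(w, i). *)
Definition dquot (w : TV) (i : nat) : Type := alg_quot (partial i w).

End FieldSuperpotential.

(* The degree n part of an algebra A identified with D(w, i) by phi. *)
Section Presentation.
Variables (k : fieldType) (V : lmodType k) (w : TV V) (i : nat).
Variables (A : algType k) (phi : dquot w i -> A).

Definition dquot_map (t : TV V) : A := phi (qclass _ t).

Definition dquot_deg (n : nat) (a : A) : Prop :=
  exists t : TV V, TAdeg n t /\ a = dquot_map t.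

End Presentation.

Section HopfSuperpotential.
Variables (k : fieldType) (H : algType k) (M : lmodType k) (B : bimodule H M).
Variable Tr : {linear H -> k^o}.

Definition Rpsi (psi : M -> k) : M -> H :=
  xget (fun _ => 0) [set f : M -> H | [/\ linear f,
    forall x h, f (ract B x h) = f x * h & forall x, Tr (f x) = psi x]]%classic.

Definition Lpsi (psi : M -> k) : M -> H :=
  xget (fun _ => 0) [set f : M -> H | [/\ linear f,
    forall h x, f (lact B h x) = h * f x & forall x, Tr (f x) = psi x]]%classic.

Definition graded_automorphism (nu : TA B -> TA B) : Prop :=
  [/\ linear nu, GRing.monoid_morphism nu, bijective nu &
      forall n t, TAdeg n t -> TAdeg n (nu t)].

Definition preserves_trace (nu : TA B -> TA B) : Prop :=
  forall h, Tr (TAproj0 (nu (TAin0 B h))) = Tr h.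

(* psi o nu, for nu of degree 0 *)
Definition dual_twist (nu : TA B -> TA B) (psi : M -> k) : M -> k :=
  fun x => psi (TAproj1 (nu (TAin1 B x))).

Definition Hsuperpotential (l : nat) (nu : TA B -> TA B) (u : TA B) : Prop :=
  [/\ graded_automorphism nu, preserves_trace nu, TAdeg l u,
      forall h, TAin0 B h * u = u * nu (TAin0 B h) &
      forall psi : {linear M -> k^o},
        lcontract (Rpsi (dual_twist nu psi)) u = rcontract (Lpsi psi) u].

(* The values of the map partial^i_u on pure tensors; they span its image. *)
Definition Hpartial (i : nat) (u : TA B) (t : TA B) : Prop :=
  exists (psi : i.-tuple {linear M -> k^o}) (h : H),
    t = foldr (fun (f : {linear M -> k^o}) s => lcontract (Rpsi f) s)
          (u * TAin0 B h) psi.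

Definition Hdquot (u : TA B) (i : nat) : Type := alg_quot (Hpartial i u).

End HopfSuperpotential.

Section SemisimpleHopf.
Variables (k : fieldType) (H : falgType k) (hH : hopf H).

Definition left_ideal (I : {vspace H}) : Prop :=
  forall h x, x \in I -> h * x \in I.

(* Every left ideal of H has a complement, i.e. the regular module is semisimple. *)
Definition semisimple_algebra : Prop :=
  forall I : {vspace H}, left_ideal I ->
  exists J : {vspace H}, [/\ left_ideal J, (I + J = fullv)%VS & (I :&: J = 0)%VS].

Definition semisimple_hopf : Prop :=
  semisimple_algebra /\ forall h, antipode hH (antipode hH h) = h.

Definition is_trace (Tr : {linear H -> k^o}) : Prop :=
  [/\ Tr 1 = 1,
      forall (phi : {linear H -> k^o}) h,
        sweedler hH (fun a b => phi a * Tr b) h = phi 1 * Tr h &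
      forall (phi : {linear H -> k^o}) h,
        sweedler hH (fun a b => Tr a * phi b) h = phi 1 * Tr h].

Definition hopf_ideal (I : {vspace H}) : Prop :=
  [/\ left_ideal I, forall x h, x \in I -> x * h \in I,
      forall x, x \in I -> counit hH x = 0,
      forall x, x \in I -> antipode hH x \in I &
      forall x, x \in I -> exists s : seq (H * H),
        (forall p, p \in s -> (p.1 \in I) || (p.2 \in I)) /\
        coprod hH x = \sum_(p <- s) tens p.1 p.2].

Definition inner_faithful (A : algType k) (act : module_algebra hH A) : Prop :=
  forall I : {vspace H}, hopf_ideal I -> I != 0%VS ->
  exists h a, h \in I /\ hact act h a != 0.

(* The left winding automorphism h |-> chi(h_(1)) h_(2). *)
Definition winding (chi : H -> k) (h : H) : H :=
  sweedler hH (fun h1 h2 => chi h1 *: h2) h.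

End SemisimpleHopf.

Section PsiMap.
Variables (k : fieldType) (H : algType k) (hH : hopf H).
Variables (V : lmodType k) (actV : hmodule H V).
Local Notation B := (VH_bimodule hH actV).

(* (u_1 (x) ... (x) u_n) # h |-> (u_1 (x) 1) ... (u_n (x) 1) h; in V (x) H one has
   (u_n (x) 1) h = u_n (x) h. *)
Definition Psi_word (h : H) (w : tword (k^o : algType k) V) : TA B :=
  (w.2 : k) *: ((\prod_(u <- w.1) TAin1 B (tens u 1)) * TAin0 B h : TA B).

(* Psi : T_k(V) # H -> T_H(V (x) H), as a map on the space T_k(V) (x) H. *)
Definition Psi (x : tensor (TV V) H) : TA B :=
  tlift (fun (t : TV V) h => lift (Psi_word h) t) x.

Lemma Psi_word_bal h : balanced (scalar_bimodule V) (Psi_word h).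
Proof.
have [w1 w2 _ _] := TAword_balanced B.
have [t1 t2] := tens_bilin V H.
rewrite /Psi_word; apply: scalar_balanced => [xs a c c'|xs ys c a x x'] /=.
  by rewrite scalerDl -scalerA.
rewrite !big_cat !big_cons /= t1 /TAin1 (w2 [::]) !mulrDl !mulrDr !mulrDl.
rewrite scalerDr; congr (_ + _).
by rewrite -!scalerAl -!scalerAr -!scalerAl !scalerA mulrC.
Qed.

Lemma Psi_bilin : bilin2 (fun (t : TV V) h => lift (Psi_word h) t).
Proof.
have [w1 w2 _ _] := TAword_balanced B.
split=> [h|t]; first exact: lift_linear (Psi_word_bal h).
apply: (lift_linear_par (f := Psi_word)) => w c h h' /=.
by rewrite /Psi_word /TAin0 w1 mulrDr scalerDr -scalerAr !scalerA mulrC.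
Qed.

End PsiMap.

Section Gradings.

Definition zgrading (M : zmodType) (G : int -> M -> Prop) : Prop :=
  [/\ forall n, G n 0, forall n x y, G n x -> G n y -> G n (x - y),
      forall x, exists s : seq (int * M), [/\ uniq (map fst s),
        forall p, p \in s -> G p.1 p.2 & x = \sum_(p <- s) p.2] &
      forall s : seq (int * M), uniq (map fst s) ->
        (forall p, p \in s -> G p.1 p.2) -> \sum_(p <- s) p.2 = 0 ->
        forall p, p \in s -> p.2 = 0].

Definition graded_ring (B : pzRingType) (GB : int -> B -> Prop) : Prop :=
  [/\ zgrading GB, GB 0 1 &
      forall i j a b, GB i a -> GB j b -> GB (i + j) (a * b)].

Definition graded_module (B : pzRingType) (GB : int -> B -> Prop)
    (M : lmodType B) (GM : int -> M -> Prop) : Prop :=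
  zgrading GM /\ forall i j b x, GB i b -> GM j x -> GM (i + j) (b *: x).

Definition zdeg (M : zmodType) (g : nat -> M -> Prop) (n : int) (x : M) : Prop :=
  if n is Posz m then g m x else x = 0.

Definition of_degree (M N : zmodType) (GM : int -> M -> Prop)
    (GN : int -> N -> Prop) (n : int) (f : M -> N) : Prop :=
  forall j x, GM j x -> GN (j + n) (f x).

Definition connected_graded (k : fieldType) (A : algType k)
    (g : nat -> A -> Prop) : Prop :=
  graded_ring (zdeg g) /\ forall a, g 0%N a <-> exists c : k, a = c%:A.

(* The augmentation A -> A / A_(>0) = k of a connected graded algebra. *)
Definition augmentation (k : fieldType) (A : algType k) (g : nat -> A -> Prop)
    (a : A) : k :=
  xget 0 [set c : k | exists s : seq A,
    (forall x, x \in s -> exists n, g n.+1 x) /\ a = c%:A + \sum_(x <- s) x]%classic.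

End Gradings.

Section Homological.
Variable B : pzRingType.

Definition projective (P : lmodType B) : Prop :=
  forall (M N : lmodType B) (f : {linear M -> N}) (g : {linear P -> N}),
    (forall y, exists x, f x = y) ->
    exists h : {linear P -> M}, forall x, f (h x) = g x.

Definition injective_module (I : lmodType B) : Prop :=
  forall (M N : lmodType B) (f : {linear M -> N}) (g : {linear M -> I}),
    injective f -> exists h : {linear N -> I}, forall x, h (f x) = g x.

(* Projective resolutions of the B-module given by the group M and the action
   [act]. *)
Record proj_resolution (M : zmodType) (act : B -> M -> M) := ProjResolution {
  pr_mod : nat -> lmodType B;
  pr_d : forall i, {linear pr_mod i.+1 -> pr_mod i};
  pr_aug : pr_mod 0%N -> M;
  pr_proj : forall i, projective (pr_mod i);
  pr_augD : forall x y, pr_aug (x + y) = pr_aug x + pr_aug y;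
  pr_augZ : forall b x, pr_aug (b *: x) = act b (pr_aug x);
  pr_aug_surj : forall z, exists x, pr_aug x = z;
  pr_exact0 : forall x, pr_aug x = 0 <-> exists y, x = pr_d 0 y;
  pr_exact : forall i x, pr_d i x = 0 <-> exists y, x = pr_d i.+1 y
}.

Arguments pr_aug {M act} p x.

Record inj_resolution (M : lmodType B) := InjResolution {
  ir_mod : nat -> lmodType B;
  ir_d : forall i, {linear ir_mod i -> ir_mod i.+1};
  ir_aug : {linear M -> ir_mod 0%N};
  ir_inj : forall i, injective_module (ir_mod i);
  ir_aug_inj : injective ir_aug;
  ir_exact0 : forall x, ir_d 0 x = 0 <-> exists y, x = ir_aug y;
  ir_exact : forall i x, ir_d i.+1 x = 0 <-> exists y, x = ir_d i y
}.

Arguments ir_aug {M} i0.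

Definition proj_dim_le (M : lmodType B) (n : nat) : Prop :=
  exists R : proj_resolution (fun (b : B) (x : M) => b *: x),
    forall i, (n < i)%N -> forall x : pr_mod R i, x = 0.

Definition inj_dim_le (M : lmodType B) (n : nat) : Prop :=
  exists R : inj_resolution M, forall i, (n < i)%N -> forall x : ir_mod R i, x = 0.

Definition inj_dim (M : lmodType B) (d : nat) : Prop :=
  inj_dim_le M d /\ forall n, inj_dim_le M n -> (d <= n)%N.

(* Left global dimension. *)
Definition gl_dim (d : nat) : Prop :=
  (forall M, proj_dim_le M d) /\ forall n, (forall M, proj_dim_le M n) -> (d <= n)%N.

Variable GB : int -> B -> Prop.

Definition graded_resolution (M : zmodType) (act : B -> M -> M)
    (GM : int -> M -> Prop) (R : proj_resolution act)
    (G : forall i, int -> pr_mod R i -> Prop) : Prop :=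
  [/\ forall i, graded_module GB (G i),
      forall i, of_degree (G i.+1) (G i) 0 (pr_d R i) &
      of_degree (G 0%N) GM 0 (pr_aug R)].

End Homological.

(* Graded Ext^i_B(k, B), where k is the module on which b acts by chi(b), and the
   Artin--Schelter Gorenstein condition. *)
Section Gorenstein.
Variables (k : fieldType) (B : pzRingType) (GB : int -> B -> Prop) (chi : B -> k).

Definition triv_act (b : B) (c : k) : k := chi b * c.
Definition triv_deg (n : int) (c : k) : Prop := n <> 0 -> c = 0.

Section Ext.
Variables (R : proj_resolution triv_act) (G : forall i, int -> pr_mod R i -> Prop).

Definition ext_cocycle (i : nat) (f : pr_mod R i -> B) : Prop :=
  forall y, f (pr_d R i y) = 0.

Definition ext_coboundary (n : int) (i : nat) : (pr_mod R i -> B) -> Prop :=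
  match i with
  | 0%N => fun f => forall x, f x = 0
  | j.+1 => fun f => exists g : {linear pr_mod R j -> B^o},
      of_degree (@G j) GB n g /\ forall x, f x = g (pr_d R j x)
  end.

(* Ext^i_B(k, B)_n = 0 *)
Definition ext_zero (i : nat) (n : int) : Prop :=
  forall f : {linear pr_mod R i -> B^o}, of_degree (@G i) GB n f ->
  ext_cocycle f -> ext_coboundary n f.

(* dim Ext^i_B(k, B)_n = 1, the scalars being those of B_0 = k. *)
Definition ext_line (i : nat) (n : int) : Prop :=
  exists e : {linear pr_mod R i -> B^o},
    [/\ of_degree (@G i) GB n e, ext_cocycle e, ~ ext_coboundary n e &
        forall f : {linear pr_mod R i -> B^o}, of_degree (@G i) GB n f ->
        ext_cocycle f -> exists c, GB 0 c /\ ext_coboundary n (fun x => f x - e x * c)].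

End Ext.

(* Ext^d_B(k, B) is one-dimensional and sits in degree -l, i.e. is k[l] (B_(>0)
   acts by zero for degree reasons), and the other Ext^i_B(k, B) vanish. *)
Definition gorenstein (d l : nat) : Prop :=
  exists (R : proj_resolution triv_act) (G : forall i, int -> pr_mod R i -> Prop),
  [/\ graded_resolution GB triv_deg G,
      forall i n, ~ (i = d /\ n = - (l%:Z)) -> ext_zero G i n &
      ext_line G d (- (l%:Z))].

End Gorenstein.

Section GKdimension.
Variables (R : realType) (k : fieldType) (A : algType k).

Definition has_dim (U : A -> Prop) (n : nat) : Prop :=
  exists b : 'I_n -> A, [/\ forall i, U (b i),
    forall c : 'I_n -> k, \sum_i c i *: b i = 0 -> forall i, c i = 0 &
    forall x, U x -> exists c : 'I_n -> k, x = \sum_i c i *: b i].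

Definition dimension (U : A -> Prop) : nat := xget 0%N [set n | has_dim U n]%classic.

(* k + U + U^2 + ... + U^n, for U the span of the elements of us. *)
Definition growth_space (us : seq A) (n : nat) : A -> Prop :=
  kspan (fun x => exists s : seq A,
    [/\ (size s <= n)%N, {subset s <= us} & x = \prod_(a <- s) a]).

Definition GKdim : \bar R :=
  ereal_sup [set limn_esup (fun n : nat =>
    (ln (dimension (growth_space us n))%:R / ln (n%:R : R))%:E)
    | us in [set: seq A]]%classic.

End GKdimension.

(* A^c is the opposite algebra, so left A^c-modules are right A-modules. *)
Definition AS_regular (R : realType) (k : fieldType) (A : algType k)
    (g : nat -> A -> Prop) (d l : nat) : Prop :=
  [/\ connected_graded g,
      inj_dim (A^o : lmodType A) d /\ inj_dim (A^c^o : lmodType A^c) d,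
      gorenstein (B := A) (zdeg g) (augmentation g) d l /\
      gorenstein (B := A^c) (zdeg g) (augmentation g) d l,
      gl_dim A d /\ gl_dim A^c d &
      (GKdim R A < +oo)%E].

(* A is the quotient of T_k(V) by the relations Rel, with quotient map p. *)
Section Koszul.
Variables (k : fieldType) (V : lmodType k) (m : nat) (Rel : TV V -> Prop).
Variables (A : algType k) (g : nat -> A -> Prop) (p : TV V -> A).

(* V^(x)a (x) R (x) V^(x)b, for R the span of Rel. *)
Definition rel_space (a b : nat) : TV V -> Prop :=
  kspan (fun t => exists x r y : TV V,
    [/\ TAdeg a x, Rel r, TAdeg b y & t = x * r * y]).

(* The intersection of the V^(x)a (x) R (x) V^(x)b, a + m + b = n; it is V^(x)n
   if n < m. *)
Definition koszul_space (n : nat) (t : TV V) : Prop :=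
  TAdeg n t /\ forall a b, (a + m + b = n)%N -> rel_space a b t.

Definition rho (i : nat) : nat := if odd i then (m * i./2).+1 else (m * i./2)%N.

Definition koszul_term (i : nat) : tensor A (TV V) -> Prop :=
  kspan (fun x => exists a t, koszul_space (rho i) t /\ x = tens a t).

(* v_1 ... v_n |-> v_1 ... v_r (x) v_(r+1) ... v_n *)
Definition split_word (r : nat) (t : TV V) : tensor (TV V) (TV V) :=
  lift (fun w => tens (TAword (scalar_bimodule V) (take r w.1, 1) : TV V)
                      (TAword (scalar_bimodule V) (drop r w.1, w.2) : TV V)) t.

Lemma split_word_bal r : balanced (scalar_bimodule V) (fun w =>
  tens (TAword (scalar_bimodule V) (take r w.1, 1) : TV V)
       (TAword (scalar_bimodule V) (drop r w.1, w.2) : TV V)).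
Proof.
have [w1 w2 _ _] := TAword_balanced (scalar_bimodule V).
have [t1 t2] := tens_bilin (TV V) (TV V).
apply: scalar_balanced => [xs a c c'|xs ys c a x x'] /=; first by rewrite w1 t2.
rewrite !take_cat !drop_cat; case: ltnP => [_|le]; first by rewrite w2 t2.
case: (r - size xs)%N => [|q] /=; first by rewrite (w2 [::]) t2.
by rewrite w2 t1.
Qed.

Definition koszul_map (r : nat) (x : tensor A (TV V)) : tensor A (TV V) :=
  tlift (fun a t => tlift (fun t1 t2 => tens (a * p t1) t2) (split_word r t)) x.

Definition koszul_d (i : nat) : tensor A (TV V) -> tensor A (TV V) :=
  koszul_map (rho i.+1 - rho i).

Definition koszul_aug (x : tensor A (TV V)) : k^o :=
  tlift (fun a (t : TV V) => augmentation g a * TAproj0 t : k^o) x.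

Definition koszul_exact : Prop :=
  (forall x, koszul_term 0 x ->
     koszul_aug x = 0 <-> exists y, koszul_term 1 y /\ x = koszul_d 0 y) /\
  (forall i x, koszul_term i.+1 x ->
     koszul_d i x = 0 <-> exists y, koszul_term i.+2 y /\ x = koszul_d i.+1 y).

Definition m_koszul : Prop :=
  [/\ (2 <= m)%N, forall r, Rel r -> TAdeg m r & koszul_exact].

End Koszul.

Section HomologicalDeterminant.
Variables (k : fieldType) (H A : algType k) (hH : hopf H).
Variables (act : module_algebra hH A) (g : nat -> A -> Prop).

Definition smash_deg (n : nat) : smash act -> Prop :=
  kspan (fun x => exists a h, g n a /\ x = smash_tens act a h).

(* The action of A # H on the trivial module k. *)
Definition smash_aug (x : smash act) : k :=
  tlift (fun a h => augmentation g a * counit hH h : k^o) x.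

Section Character.
Variable R : proj_resolution (triv_act smash_aug).

(* Hom_A(P_i, k) *)
Definition hom_cochain (i : nat) (f : pr_mod R i -> k) : Prop :=
  (forall x y, f (x + y) = f x + f y) /\
  forall a x, f (smash_tens act a 1 *: x) = augmentation g a * f x.

Definition hom_cocycle (i : nat) (f : pr_mod R i -> k) : Prop :=
  hom_cochain f /\ forall y, f (pr_d R i y) = 0.

Definition hom_coboundary (i : nat) : (pr_mod R i -> k) -> Prop :=
  match i with
  | 0%N => fun f => forall x, f x = 0
  | j.+1 => fun f => exists f' : pr_mod R j -> k,
      hom_cochain f' /\ forall x, f x = f' (pr_d R j x)
  end.

(* The action of H on Hom_A(P, N) is (h . f)(x) = h_(2) f(S^-1(h_(1)) x); for N = k
   and S^2 = id it reduces to f(S(h) x). *)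
Definition hom_act (i : nat) (h : H) (f : pr_mod R i -> k) : pr_mod R i -> k :=
  fun x => f (smash_tens act 1 (antipode hH h) *: x).

(* Ext^d_A(k, k) is one-dimensional, and H acts on it by eta. *)
Definition acts_on_ext (d : nat) (eta : H -> k) : Prop :=
  exists e : pr_mod R d -> k,
    [/\ hom_cocycle e, ~ hom_coboundary e,
        forall f, hom_cocycle f -> exists c : k, hom_coboundary (fun x => f x - c * e x) &
        forall h, hom_coboundary (fun x => hom_act h e x - eta h * e x)].

End Character.

Definition ext_character (d : nat) (eta : H -> k) : Prop :=
  exists (R : proj_resolution (triv_act smash_aug))
         (G : forall i, int -> pr_mod R i -> Prop),
    graded_resolution (zdeg smash_deg) (@triv_deg k) G /\ acts_on_ext R d eta.

Definition is_hdet (d : nat) (hdet : H -> k) : Prop :=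
  exists eta : H -> k, ext_character d eta /\ forall h, hdet h = eta (antipode hH h).

End HomologicalDeterminant.

(* Main.v *)
(* Write K_n for the intersection of the spaces V^a R V^b inside V^(x)n, so that
   A (x) K_rho(i) are the terms of the Koszul complex, a minimal resolution of k.
   Comparing it with a graded resolution that computes Ext(k, A), the Gorenstein
   condition gives rho(d) = l, K_l = k w, and that psi |-> lcontract psi w is
   injective on V^*: a psi in its kernel would give a class in Ext^1(k, A), but d <> 1.

   H acts diagonally on the Koszul complex, compatibly with A # H, hence through a
   character chi on the line k w.  Comparing it with a resolution over A # H, the
   character of H on Ext^d(k, k) is chi o S, so chi = hdet because S^2 = id.
   Applying rcontract and lcontract to h w = hdet(h) w and using that w is
   nondegenerate and twisted by sigma, one gets the relation
     hdet(h_2) sigma(h_1 v) = hdet(h_1) h_2 sigma(v),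
   which says that v (x) h |-> sigma(v) (x) Xi(h) is compatible with the left action.

   The trace form of the semisimple H is symmetric and nondegenerate, so R psi and
   L psi exist and contractions of Psi(w # 1) reduce to contractions of w.  Finally,
   since h w lies in k w, the span of the i-fold contractions of w is H-stable; hence
   Psi carries <partial^i w> # H onto the ideal defining D(Psi(w # 1), i). *)
Require Import Defs.
Set Warnings "-notation-overridden,-ambiguous-paths,-notation-incompatible-prefix,-redundant-canonical-projection,-projection-no-head-constant".
From mathcomp Require Import ring.
From HB Require Import structures.
From mathcomp Require Import all_boot all_order all_algebra all_field.
From mathcomp Require Import boolp classical_sets reals ereal.
Set Implicit Arguments.
Unset Strict Implicit.
Unset Printing Implicit Defensive.
Import GRing.Theory.
Local Open Scope ring_scope.

(** The resolutions in [gorenstein] and [is_hdet] are known only to exist, while the Koszul terms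
    are subspaces of the single module A (x) T(V). Information therefore passes through chain maps f
    from the Koszul complex to a resolution and h back. What is used about them is that h f is the
    identity modulo A_+, which follows from minimality. A functional on K_rho(i) whose A-linear
    extension kills boundaries becomes a cocycle by composition with h, and is read off again by
    evaluation along f; a coboundary evaluates to 0 there because the Koszul differential lands in
    A_+.

    The Koszul complex consists of left A-modules and its differential moves letters off the left of
    T(V), so maps to A come from contracting the last letter. The twist exchanges the two ends: the
    left contraction of w by psi is the right one by psi o sigma^-1. This is how a kernel vector of
    psi |-> [lcontract psi w] becomes a class in Ext^1.

    The maps R psi and L psi are known only through Tr. Identities over H are thus tested by
    applying Tr(h -) to the H-factor, where the integral property moves coproducts from an unknown
    element of H onto h. *)

Section LinearProp.
Variables (R : pzRingType) (U V : lmodType R) (f : U -> V).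
Hypothesis lf : linear f.

Lemma lin0 : f 0 = 0.
Proof. by have := lf (-1) 0 0; rewrite scaler0 addr0 scaleN1r addNr. Qed.

Lemma linZ c x : f (c *: x) = c *: f x.
Proof. by have := lf c x 0; rewrite lin0 !addr0. Qed.

Lemma linD x y : f (x + y) = f x + f y.
Proof. by have := lf 1 x y; rewrite !scale1r. Qed.

Lemma linN x : f (- x) = - f x.
Proof. by rewrite -scaleN1r linZ scaleN1r. Qed.

Lemma linB x y : f (x - y) = f x - f y.
Proof. by rewrite linD linN. Qed.

Lemma lin_sum (I : Type) (r : seq I) (Q : pred I) (F : I -> U) :
  f (\sum_(i <- r | Q i) F i) = \sum_(i <- r | Q i) f (F i).
Proof. exact: (big_morph f linD lin0). Qed.

End LinearProp.

(** Maps built below are bare functions with a linearity proof, while [partial], [Hsuperpotential]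
    and the Ext conditions quantify over [{linear _}]; this bridges the two. *)
Lemma linear_packed (R : pzRingType) (U V : lmodType R) (f : U -> V) :
  linear f -> exists g : {linear U -> V}, forall x, g x = f x.
Proof.
move=> lf; pose g : {linear U -> V} := HB.pack f (GRing.isLinear.Build R U V *:%R f lf).
by exists g.
Qed.

(** * Tensor algebra of a bimodule: universal property, grading, contractions *)

Section TensorAlgebraFacts.
Variables (k : fieldType) (H : algType k) (M : lmodType k) (B : bimodule H M).
Local Notation TA := (TA B).
Local Notation in0 := (TAin0 B).
Local Notation in1 := (TAin1 B).

Lemma TAwordM v w : TAword B v * TAword B w = TAword B (wmul B v w).
Proof. exact: TAmul_word. Qed.

Lemma TAin0_linear : linear in0.
Proof. by have [h _ _ _] := TAword_balanced B; apply: h. Qed.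

Lemma TAin1_linear : linear in1.
Proof. by have [_ h _ _] := TAword_balanced B; apply: (h [::]). Qed.

Lemma TAin0M g h : in0 (g * h) = in0 g * in0 h.
Proof. by rewrite TAwordM. Qed.

Lemma TAin0_1 : in0 1 = 1.
Proof. by []. Qed.

Lemma TAin01 h x : in0 h * in1 x = in1 (lact B h x).
Proof. by rewrite TAwordM. Qed.

Lemma TAin1_word x w : in1 x * TAword B w = TAword B (x :: w.1, w.2).
Proof.
case: w => [[|y xs] h] /=; rewrite TAwordM /wmul /= ?mul1r ?lact1 //.
Qed.

Lemma TAin10 x h : in1 x * in0 h = in1 (ract B x h).
Proof.
rewrite TAin1_word /=; have [_ _ _ b4] := TAword_balanced B.
by have := b4 [::] x h 1; rewrite mulr1.
Qed.

Lemma TAwordE xs h : TAword B (xs, h) = (\prod_(x <- xs) in1 x) * in0 h.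
Proof.
elim: xs => [|x xs IH]; first by rewrite big_nil mul1r.
by rewrite big_cons -mulrA -IH TAin1_word.
Qed.

(** Words are built one letter at a time on the left, so most identities in a tensor algebra reduce
    to H and to left multiplication by a letter. *)
Lemma TA_spanind (P : TA -> Prop) :
  (forall c x y, P x -> P y -> P (c *: x + y)) -> (forall h, P (in0 h)) ->
  (forall x t, P t -> P (in1 x * t)) -> forall t, P t.
Proof.
move=> PL P0 P1; have P00 : P 0.
  by have := PL (-1) _ _ (P0 0) (P0 0); rewrite scaleN1r addNr.
apply: univ_ind => // c [xs h] y; apply: PL.
rewrite -/(TAword B _); elim: xs => [|x xs IH]; first exact: P0.
by have := P1 x _ IH; rewrite TAin1_word.
Qed.

Lemma TA_word_lineq (W : lmodType k) (f g : TA -> W) : linear f -> linear g ->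
  (forall w, f (TAword B w) = g (TAword B w)) -> f =1 g.
Proof. exact: univ_eq. Qed.

Lemma TA_lineq (W : lmodType k) (f g : TA -> W) : linear f -> linear g ->
  (forall h, f (in0 h) = g (in0 h)) ->
  (forall x t, f t = g t -> f (in1 x * t) = g (in1 x * t)) -> f =1 g.
Proof.
move=> lf lg f0 f1; apply: TA_spanind => // c x y ex ey.
by rewrite lf lg ex ey.
Qed.

Lemma mull_linear (R : algType k) (x : R) : linear (fun y => x * y).
Proof. by move=> c y z; rewrite mulrDr -scalerAr. Qed.

Lemma mulr_linear (R : algType k) (x : R) : linear (fun y => y * x).
Proof. by move=> c y z; rewrite mulrDl -scalerAl. Qed.

Lemma scale_linear (W : lmodType k) (c : k) : linear (fun x : W => c *: x).
Proof. by move=> a x y; rewrite scalerDr !scalerA mulrC. Qed.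

Section Lift.
Variables (E : algType k) (f0 : H -> E) (f1 : M -> E).
Hypotheses (f0_lin : linear f0) (f0_1 : f0 1 = 1).
Hypothesis f0M : forall g h, f0 (g * h) = f0 g * f0 h.
Hypothesis f1_lin : linear f1.
Hypothesis f1l : forall h x, f1 (lact B h x) = f0 h * f1 x.
Hypothesis f1r : forall x h, f1 (ract B x h) = f1 x * f0 h.

(** Universal property of T_H(M): [f0] is an algebra map on H and [f1] a map of bimodules along it.
    It yields both the twist [twist_nu] and the map [to_smash] to A # H. *)
Definition TAlift_word (w : tword H M) : E := (\prod_(x <- w.1) f1 x) * f0 w.2.
Definition TAlift (t : TA) : E := Defs.lift TAlift_word t.

Lemma TAlift_bal : balanced B TAlift_word.
Proof.
rewrite /TAlift_word; split=> [xs c h h'|xs ys h c x x'|xs ys x g y h|xs x g h] /=.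
- by rewrite f0_lin mulrDr scalerAr.
- by rewrite !big_cat !big_cons /= f1_lin mulrDl mulrDr mulrDl -!scalerAl -scalerAr -scalerAl.
- by rewrite !big_cat !big_cons /= f1l f1r !mulrA.
- by rewrite !big_cat !big_seq1 /= f1r f0M !mulrA.
Qed.

Lemma TAlift_linear : linear TAlift.
Proof. exact: lift_linear TAlift_bal. Qed.

Lemma TAlift_TAword w : TAlift (TAword B w) = TAlift_word w.
Proof. by rewrite /TAlift lift_ugen //; apply: TAlift_bal. Qed.

Lemma TAlift0 h : TAlift (in0 h) = f0 h.
Proof. by rewrite TAlift_TAword /TAlift_word big_nil mul1r. Qed.

Lemma TAlift1 x : TAlift (in1 x) = f1 x.
Proof. by rewrite TAlift_TAword /TAlift_word big_seq1 f0_1 mulr1. Qed.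

Lemma TAlift_word_cons x w :
  TAlift_word (x :: w.1, w.2) = f1 x * TAlift_word w.
Proof. by rewrite /TAlift_word big_cons mulrA. Qed.

Lemma TAliftM s t : TAlift (s * t) = TAlift s * TAlift t.
Proof.
move: s; apply: TA_lineq.
- exact: (linear_comp TAlift_linear (mulr_linear t)).
- exact: (linear_comp (mulr_linear _) TAlift_linear).
- move=> h; move: t; apply: (@TA_word_lineq _ (fun t => TAlift (in0 h * t))
    (fun t => TAlift (in0 h) * TAlift t)).
  + exact: (linear_comp TAlift_linear (mull_linear _)).
  + exact: (linear_comp (mull_linear _) TAlift_linear).
  move=> w; rewrite TAwordM !TAlift_TAword /TAlift_word /wmul /=.
  case: w => [[|x xs] g] /=; first by rewrite !big_nil !mul1r f0M.
  by rewrite !big_cons f1l big_nil mul1r !mulrA.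
move=> x s IH; rewrite -mulrA.
have lx u : TAlift (in1 x * u) = f1 x * TAlift u.
  move: u; apply: (@TA_word_lineq _ (fun u => TAlift (in1 x * u))
    (fun u => f1 x * TAlift u)).
  - exact: (linear_comp TAlift_linear (mull_linear _)).
  - exact: (linear_comp (mull_linear _) TAlift_linear).
  by move=> w; rewrite TAin1_word !TAlift_TAword TAlift_word_cons.
by rewrite !lx IH mulrA.
Qed.

Lemma TAlift_1 : TAlift 1 = 1.
Proof. by rewrite -TAin0_1 TAlift0. Qed.

End Lift.

Lemma TAdegD n s t : TAdeg n s -> TAdeg n t -> TAdeg (B := B) n (s + t).
Proof.
by move=> [r [hr ->]] [r' [hr' ->]]; exists (r ++ r'); rewrite all_cat hr hr' big_cat.
Qed.

Lemma TAdegZ n c t : TAdeg n t -> TAdeg (B := B) n (c *: t).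
Proof.
move=> [r [hr ->]]; exists [seq (w.1, c *: w.2) | w <- r]; split.
  by rewrite all_map; apply: sub_all hr.
rewrite big_map scaler_sumr; apply: eq_bigr => w _.
by have [h _ _ _] := TAword_balanced B; rewrite (linZ (h _)) -surjective_pairing.
Qed.

Lemma TAdeg0 n : TAdeg (B := B) n 0.
Proof. by exists [::]; rewrite big_nil. Qed.

Lemma TAdeg_sum n (I : eqType) (r : seq I) (F : I -> TA) :
  (forall i, i \in r -> TAdeg n (F i)) -> TAdeg n (\sum_(i <- r) F i).
Proof.
move=> h; rewrite big_seq; apply: big_ind => //; first exact: TAdeg0.
exact: TAdegD.
Qed.

Lemma TAdeg_word w : TAdeg (size w.1) (TAword B w).
Proof. by exists [:: w]; rewrite /= eqxx big_seq1. Qed.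

Lemma TAdeg_in0 h : TAdeg 0 (in0 h).
Proof. exact: (TAdeg_word ([::], h)). Qed.

Lemma TAdeg_in1 x : TAdeg 1 (in1 x).
Proof. exact: (TAdeg_word ([:: x], 1)). Qed.

Lemma TAdegM m n s t : TAdeg m s -> TAdeg n t -> TAdeg (B := B) (m + n) (s * t).
Proof.
move=> [r [/allP hr ->]] [r' [/allP hr' ->]]; rewrite mulr_suml.
apply: TAdeg_sum => v hv; rewrite mulr_sumr; apply: TAdeg_sum => u hu.
rewrite TAwordM -(eqP (hr _ hv)) -(eqP (hr' _ hu)).
have -> : (size v.1 + size u.1)%N = size (wmul B v u).1.
  by case: u {hu} => [[|y ys] h]; rewrite /wmul /= ?addn0 // size_cat.
exact: TAdeg_word.
Qed.

Lemma TAdeg0P t : TAdeg 0 t -> exists h, t = in0 h.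
Proof.
move=> [r [/allP hr ->]]; exists (\sum_(w <- r) w.2).
rewrite (lin_sum TAin0_linear) big_seq [RHS]big_seq; apply: eq_bigr => -[xs h] /hr /=.
by rewrite size_eq0 => /eqP ->.
Qed.

Lemma TAdegS_ind n (P : TA -> Prop) : P 0 ->
  (forall x y, P x -> P y -> P (x + y)) ->
  (forall x t, TAdeg n t -> P (in1 x * t)) -> forall t, TAdeg n.+1 t -> P t.
Proof.
move=> P0 PD P1 t [r [/allP hr ->]]; rewrite big_seq; apply: big_ind => //.
move=> [[|x xs] h] /hr //= /eqP [sxs].
have := P1 x (TAword B (xs, h)); rewrite TAin1_word; apply.
by rewrite -sxs; apply: (TAdeg_word (xs, h)).
Qed.

Lemma TAdegS_lineq n (W : lmodType k) (f g : TA -> W) : linear f -> linear g ->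
  (forall x t, TAdeg n t -> f (in1 x * t) = g (in1 x * t)) ->
  forall t, TAdeg n.+1 t -> f t = g t.
Proof.
move=> lf lg fg; apply: TAdegS_ind => //; first by rewrite !lin0.
by move=> x y ex ey; rewrite !linD // ex ey.
Qed.

(** Mirror of [TAdegS_ind], for use with right contractions. In degree one the coefficient in H is
    absorbed into the letter; in higher degrees the product is reassociated. *)
Lemma TAdegSr_ind n (P : TA -> Prop) : P 0 ->
  (forall x y, P x -> P y -> P (x + y)) ->
  (forall x t, TAdeg n t -> P (t * in1 x)) -> forall t, TAdeg n.+1 t -> P t.
Proof.
elim: n P => [|n IH] P P0 PD P1; apply: TAdegS_ind => // x t.
  move=> /TAdeg0P [h ->]; rewrite TAin10 -[in1 _]mul1r -TAin0_1.
  exact/P1/TAdeg_in0.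
move: t; apply: IH => [|s t Ps Pt|y t ht]; first by rewrite mulr0.
  by rewrite mulrDr; apply: PD.
by rewrite mulrA; apply: P1; apply: TAdegM (TAdeg_in1 x) ht.
Qed.

Lemma TAdegSr_lineq n (W : lmodType k) (f g : TA -> W) : linear f -> linear g ->
  (forall x t, TAdeg n t -> f (t * in1 x) = g (t * in1 x)) ->
  forall t, TAdeg n.+1 t -> f t = g t.
Proof.
move=> lf lg fg; apply: TAdegSr_ind => //; first by rewrite !lin0.
by move=> x y ex ey; rewrite !linD // ex ey.
Qed.

Lemma TAproj0_in0 h : TAproj0 (in0 h) = h.
Proof. by rewrite /TAproj0 lift_ugen //; apply: TAproj0_bal. Qed.

Lemma TAproj0_linear : linear (@TAproj0 _ _ _ B).
Proof. exact: lift_linear (TAproj0_bal B). Qed.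

Lemma TAproj0_in1M x t : TAproj0 (in1 x * t) = 0.
Proof.
move: t; apply: (@TA_word_lineq _ (fun t => TAproj0 (in1 x * t)) (fun _ => 0)).
- exact: (linear_comp TAproj0_linear (mull_linear _)).
- exact: linear_fun0.
move=> w; rewrite TAin1_word /TAproj0 lift_ugen //.
exact: TAproj0_bal.
Qed.

Lemma TAproj1_linear : linear (@TAproj1 _ _ _ B).
Proof. exact: lift_linear (TAproj1_bal B). Qed.

Lemma TAproj1_in1 x : TAproj1 (in1 x) = x.
Proof. by rewrite /TAproj1 lift_ugen /= ?ract1 //; apply: TAproj1_bal. Qed.

Section Contraction.
Variable f : M -> H.
Hypothesis f_lin : linear f.

Section Left.
Hypothesis fr : forall x h, f (ract B x h) = f x * h.

Lemma lcontract_linear : linear (lcontract (B := B) f).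
Proof. exact: lift_linear (lcontract_bal f_lin fr). Qed.

Lemma lcontract_in1M x t : lcontract f (in1 x * t) = in0 (f x) * t.
Proof.
move: t; apply: (@TA_word_lineq _ (fun t => lcontract f (in1 x * t))
   (fun t => in0 (f x) * t)).
- exact: (linear_comp lcontract_linear (mull_linear _)).
- exact: (mull_linear (in0 (f x))).
move=> w; rewrite TAin1_word /lcontract lift_ugen /=.
  by rewrite -surjective_pairing.
exact: lcontract_bal.
Qed.

Lemma lcontract_in0 h : lcontract (B := B) f (in0 h) = 0.
Proof. by rewrite /lcontract lift_ugen //; apply: lcontract_bal. Qed.

Lemma lcontract_deg n t : TAdeg n.+1 t -> TAdeg n (lcontract (B := B) f t).
Proof.
move: t; apply: TAdegS_ind => [|s t|x t ht].
- by rewrite (lin0 lcontract_linear); apply: TAdeg0.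
- by rewrite (linD lcontract_linear); apply: TAdegD.
- by rewrite lcontract_in1M; apply: (TAdegM (m := 0)) (TAdeg_in0 _) ht.
Qed.

End Left.

Hypothesis fl : forall h x, f (lact B h x) = h * f x.

Lemma rcontract_linear : linear (rcontract (B := B) f).
Proof. exact: lift_linear (rcontract_bal f_lin fl). Qed.

Lemma rcontract_Min1 t x : rcontract f (t * in1 x) = t * in0 (f x).
Proof.
move: t; apply: (@TA_word_lineq _ (fun t => rcontract f (t * in1 x))
   (fun t => t * in0 (f x))).
- exact: (linear_comp rcontract_linear (mulr_linear _)).
- exact: (mulr_linear (in0 (f x))).
move=> [xs h]; rewrite !TAwordM /wmul /= /rcontract lift_ugen /=.
  by rewrite rev_cat /= revK ract1 fl.
exact: rcontract_bal.
Qed.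

End Contraction.

End TensorAlgebraFacts.

(** * Sweedler sums and the antipode *)

Section LinearClosure.
Variables (k : fieldType) (U W : lmodType k).

Lemma lin_add (f g : U -> W) :
  linear f -> linear g -> linear (fun x => f x + g x).
Proof. by move=> lf lg c x y; rewrite lf lg scalerDr addrACA. Qed.

Lemma lin_opp (f : U -> W) : linear f -> linear (fun x => - f x).
Proof. by move=> lf c x y; rewrite lf opprD scalerN. Qed.

Lemma lin_mull (R : algType k) (f : U -> R) (a : R) :
  linear f -> linear (fun x => a * f x).
Proof. by move=> lf c x y; rewrite lf mulrDr scalerAr. Qed.

Lemma lin_mulr (R : algType k) (f : U -> R) (a : R) :
  linear f -> linear (fun x => f x * a).
Proof. by move=> lf c x y; rewrite lf mulrDl scalerAl. Qed.

Lemma lin_mulkl (f : U -> k^o) (a : k) :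
  linear f -> linear (fun x => a * f x : k^o).
Proof. by move=> lf c x y; rewrite lf mulrDr /GRing.scale /= mulrCA. Qed.

Lemma lin_mulkr (f : U -> k^o) (a : k) :
  linear f -> linear (fun x => f x * a : k^o).
Proof. by move=> lf c x y; rewrite lf mulrDl /GRing.scale /= mulrA. Qed.

Lemma lin_scaler (f : U -> W) (a : k) :
  linear f -> linear (fun x => a *: f x).
Proof. by move=> lf c x y; rewrite lf scalerDr !scalerA mulrC. Qed.

Lemma lin_scalel (f : U -> k^o) (w : W) :
  linear f -> linear (fun x => f x *: w).
Proof. by move=> lf c x y; rewrite lf scalerDl scalerA. Qed.

Lemma lin_sumr (I : Type) (r : seq I) (f : I -> U -> W) :
  (forall i, linear (f i)) -> linear (fun x => \sum_(i <- r) f i x).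
Proof.
move=> lf c x y; rewrite scaler_sumr -big_split; apply: eq_bigr => i _.
exact: lf.
Qed.

Lemma lin_app (V : lmodType k) (g : {linear V -> W}) (f : U -> V) :
  linear f -> linear (fun x => g (f x)).
Proof. by move=> lf c x y; rewrite lf linearP. Qed.

Lemma lin_id : linear (fun x : U => x).
Proof. by []. Qed.

End LinearClosure.

Section LinearClosure2.
Variables (k : fieldType) (U : lmodType k).

Lemma lin_tensl (V W : lmodType k) (f : U -> V) (w : W) :
  linear f -> linear (fun x => tens (f x) w).
Proof. by move=> lf c x y; rewrite lf tensDl tensZl. Qed.

Lemma lin_tensr (V W : lmodType k) (f : U -> W) (v : V) :
  linear f -> linear (fun x => tens v (f x)).
Proof. by move=> lf c x y; rewrite lf tensDr tensZr. Qed.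

Variables (H : algType k) (hH : hopf H).

Lemma lin_sweedler (W : lmodType k) (f : H -> H -> W) (g : U -> H) :
  bilin2 f -> linear g -> linear (fun x => sweedler hH f (g x)).
Proof. by move=> bf lg; apply: (linear_comp (sweedler_linear hH bf) lg). Qed.

Lemma lin_hactl (V : lmodType k) (a : hmodule H V) (f : U -> H) v :
  linear f -> linear (fun x => hact a (f x) v).
Proof. by move=> lf; apply: (linear_comp ((hact_bilin a).1 v) lf). Qed.

Lemma lin_hactr (V : lmodType k) (a : hmodule H V) (f : U -> V) h :
  linear f -> linear (fun x => hact a h (f x)).
Proof. by move=> lf; apply: (linear_comp ((hact_bilin a).2 h) lf). Qed.

End LinearClosure2.

(** Sweedler manipulations leave linearity side goals; these tactics discharge them by following the
    syntax of the function. *)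
Ltac lin1 :=
  lazymatch goal with
  | |- bilin2 _ => split=> [?|?]
  | |- trilin _ => split=> [? ?|? ?|? ?]
  | _ => first
    [ assumption | apply: lin_id | apply: linear_fun0
    | apply: lin_mull | apply: lin_mulr | apply: lin_tensl | apply: lin_tensr
    | apply: lin_scaler | apply: lin_scalel | apply: lin_mulkl | apply: lin_mulkr
    | apply: lin_add | apply: lin_opp
    | apply: lin_hactl | apply: lin_hactr
    | apply: sweedler_par => ? ? | apply: lin_sweedler | apply: lin_app ]
  end.
Ltac lin := do ?lin1.

Section HopfFacts.
Variables (k : fieldType) (H : algType k) (hH : hopf H).
Local Notation sw := (sweedler hH).
Local Notation S := (antipode hH).
Local Notation eps := (counit hH).

Lemma sw_counitl (W : lmodType k) (F : H -> W) h :
  linear F -> sw (fun a b => eps a *: F b) h = F h.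
Proof.
move=> lF; rewrite -[in RHS](counitl hH h) -/(sweedler _ _ _) sweedler_comp //.
by apply: eq_sweedler => a b; rewrite (linZ lF).
Qed.

Lemma sw_counitr (W : lmodType k) (F : H -> W) h :
  linear F -> sw (fun a b => eps b *: F a) h = F h.
Proof.
move=> lF; rewrite -[in RHS](counitr hH h) -/(sweedler _ _ _) sweedler_comp //.
by apply: eq_sweedler => a b; rewrite (linZ lF).
Qed.

Lemma sw_antipodel h : sw (fun a b => S a * b) h = eps h *: 1.
Proof. exact: antipodel. Qed.

Lemma sw_antipoder h : sw (fun a b => a * S b) h = eps h *: 1.
Proof. exact: antipoder. Qed.

Lemma sw_scale (W : lmodType k) (f : H -> H -> W) c h :
  c *: sw f h = sw (fun a b => c *: f a b) h.
Proof. exact/sweedler_comp/lin_scaler. Qed.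

Lemma sw_sum (W : lmodType k) (I : Type) (r : seq I) (f : I -> H -> H -> W) h :
  sw (fun a b => \sum_(i <- r) f i a b) h = \sum_(i <- r) sw (f i) h.
Proof.
rewrite /sweedler /tlift /Defs.lift /lsum exchange_big; apply: eq_bigr => p _.
by rewrite scaler_sumr.
Qed.

Lemma antipode1 : S 1 = 1.
Proof.
have := sw_antipodel 1; rewrite sweedler1; first by rewrite mulr1 counit1 scale1r.
by lin.
Qed.

Lemma counit_antipode h : eps (S h) = eps h.
Proof.
have := congr1 eps (sw_antipodel h); rewrite linearZ /= counit1 /GRing.scale /= mulr1.
move=> <-; rewrite sweedler_comp; last by lin.
rewrite -[in LHS](sw_counitr (F := fun a => eps (S a) : k^o) h); last by lin.
by apply: eq_sweedler => a b; rewrite counitM mulrC.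
Qed.

(** Both sides are convolution inverses of the multiplication H (x) H -> H. Concretely, S(g_1 h_1)
    g_2 h_2 S(h_3) S(g_3) is evaluated with either bracketing. *)
Lemma antipodeM g h : S (g * h) = S h * S g.
Proof.
have inner b d : sw (fun b1 b2 => sw (fun d1 d2 => b1 * d1 * (S d2 * S b2)) d) b
    = (eps b * eps d) *: 1.
  transitivity (sw (fun b1 b2 => eps d *: (b1 * S b2)) b).
    apply: eq_sweedler => b1 b2; transitivity (b1 * (eps d *: 1) * S b2).
      rewrite -sw_antipoder (sweedler_comp (F := fun x => b1 * x * S b2) hH); last by lin.
      by apply: eq_sweedler => d1 d2; rewrite !mulrA.
    by rewrite -scalerAr mulr1 scalerAl.
  by rewrite -sw_scale sw_antipoder scalerA mulrC.
transitivity (sw (fun a b => sw (fun c d =>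
  sw (fun b1 b2 => sw (fun d1 d2 => S (a * c) * (b1 * d1 * (S d2 * S b2))) d) b) h) g).
  rewrite -[in LHS](sw_counitr (F := fun a => S (a * h)) g); last by lin.
  apply: eq_sweedler => a b.
  rewrite -[in LHS](sw_counitr (F := fun c => S (a * c)) h); last by lin.
  rewrite sw_scale; apply: eq_sweedler => c d.
  transitivity (S (a * c) * ((eps b * eps d) *: 1)).
    by rewrite -scalerAr mulr1 scalerA.
  rewrite -inner sweedler_comp; last by lin.
  by apply: eq_sweedler => b1 b2; rewrite sweedler_comp //; lin.
transitivity (sw (fun a b => sw (fun c d =>
  sw (fun a1 a2 => sw (fun c1 c2 => S (a1 * c1) * (a2 * c2 * (S d * S b))) c) a) h) g).
  transitivity (sw (fun a b => sw (fun b1 b2 => sw (fun c d =>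
    sw (fun d1 d2 => S (a * c) * (b1 * d1 * (S d2 * S b2))) d) h) b) g).
    by apply: eq_sweedler => a b; rewrite exchange_sweedler.
  rewrite -(sweedler_coassoc hH (f := fun a b1 b2 => sw (fun c d =>
    sw (fun d1 d2 => S (a * c) * (b1 * d1 * (S d2 * S b2))) d) h)); last by lin.
  apply: eq_sweedler => a b; rewrite [RHS]exchange_sweedler.
  apply: eq_sweedler => a1 a2.
  rewrite -(sweedler_coassoc hH (f := fun c d1 d2 =>
     S (a1 * c) * (a2 * d1 * (S d2 * S b)))) //; by lin.
transitivity (sw (fun a b => sw (fun c d => (eps a * eps c) *: (S d * S b)) h) g).
  apply: eq_sweedler => a b; apply: eq_sweedler => c d.
  rewrite -counitM -[in RHS](mul1r (S d * S b)) scalerAl -sw_antipodel.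
  rewrite sweedlerM; last by lin.
  rewrite (sweedler_comp (F := fun x => x * (S d * S b)) hH); last by lin.
  apply: eq_sweedler => a1 a2.
  rewrite (sweedler_comp (F := fun x => x * (S d * S b)) hH); last by lin.
  by apply: eq_sweedler => c1 c2; rewrite !mulrA.
rewrite -[in RHS](sw_counitl (F := fun b => S h * S b) g); last by lin.
apply: eq_sweedler => a b.
rewrite -[in RHS](sw_counitl (F := fun d => S d * S b) h); last by lin.
by rewrite sw_scale; apply: eq_sweedler => c d; rewrite scalerA.
Qed.

End HopfFacts.

(** * The trace form of a semisimple Hopf algebra *)

Section Involutive.
Variables (k : fieldType) (H : algType k) (hH : hopf H).
Local Notation sw := (sweedler hH).
Local Notation S := (antipode hH).
Local Notation eps := (counit hH).
Hypothesis SS : forall h, S (S h) = h.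

(** Apply S to S(h_1) h_2 = eps(h) 1 and use S^2 = id: the map S is also an antipode for the
    opposite multiplication. *)
Lemma sw_antipodel_op h : sw (fun a b => S b * a) h = eps h *: 1.
Proof.
transitivity (S (sw (fun a b => S a * b) h)).
  by rewrite sweedler_comp; last lin; apply: eq_sweedler => a b; rewrite antipodeM SS.
by rewrite sw_antipodel linearZ /= antipode1.
Qed.

Lemma sw_antipoder_op h : sw (fun a b => b * S a) h = eps h *: 1.
Proof.
transitivity (S (sw (fun a b => a * S b) h)).
  by rewrite sweedler_comp; last lin; apply: eq_sweedler => a b; rewrite antipodeM SS.
by rewrite sw_antipoder linearZ /= antipode1.
Qed.

Section Trace.
Variable Tr : {linear H -> k^o}.
Hypothesis Tr1 : Tr 1 = 1.
Hypothesis Trl : forall h, sw (fun a b => Tr b *: a) h = Tr h *: 1.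
Hypothesis Trr : forall h, sw (fun a b => Tr a *: b) h = Tr h *: 1.

(** Tr(a_1 b) a_2 = Tr(a_1 b_1) a_2 b_2 S(b_3), and the invariance of Tr applied to the element a
    b_1 absorbs the factor a_2 b_2. *)
Lemma trace_shiftl a b :
  sw (fun a1 a2 => Tr (a1 * b) *: a2) a = sw (fun b1 b2 => Tr (a * b1) *: S b2) b.
Proof.
transitivity (sw (fun b1 b2 => sw (fun a1 a2 => sw (fun b11 b12 =>
    Tr (a1 * b11) *: (a2 * b12 * S b2)) b1) a) b).
  transitivity (sw (fun b1 b2 => sw (fun a1 a2 => sw (fun b21 b22 =>
    Tr (a1 * b1) *: (a2 * b21 * S b22)) b2) a) b).
    rewrite [RHS]exchange_sweedler; apply: eq_sweedler => a1 a2.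
    rewrite -[in LHS](sw_counitr hH (F := fun b => Tr (a1 * b) *: a2) b); last by lin.
    apply: eq_sweedler => b1 b2.
    transitivity (Tr (a1 * b1) *: (a2 * (eps b2 *: 1))).
      by rewrite -scalerAr mulr1 !scalerA mulrC.
    rewrite -sw_antipoder (sweedler_comp (F := fun x => Tr (a1 * b1) *: (a2 * x)) hH); last by lin.
    by apply: eq_sweedler => b21 b22; rewrite mulrA.
  rewrite [LHS](_ : _ = sw (fun b1 b2 => sw (fun b21 b22 => sw (fun a1 a2 =>
    Tr (a1 * b1) *: (a2 * b21 * S b22)) a) b2) b); last first.
    by apply: eq_sweedler => b1 b2; rewrite exchange_sweedler.
  rewrite -(sweedler_coassoc hH (f := fun b1 b21 b22 => sw (fun a1 a2 =>
    Tr (a1 * b1) *: (a2 * b21 * S b22)) a)); last by lin.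
  by apply: eq_sweedler => b1 b2; rewrite exchange_sweedler.
apply: eq_sweedler => b1 b2.
transitivity ((Tr (a * b1) *: 1) * S b2); last by rewrite -scalerAl mul1r.
rewrite -Trr sweedlerM; last by lin.
rewrite (sweedler_comp (F := fun x => x * S b2) hH); last by lin.
apply: eq_sweedler => a1 a2.
rewrite (sweedler_comp (F := fun x => x * S b2) hH); last by lin.
by apply: eq_sweedler => c d; rewrite scalerAl.
Qed.

Lemma trace_shiftr h a :
  sw (fun h1 h2 => Tr (h2 * a) *: S h1) h = sw (fun a1 a2 => Tr (h * a2) *: a1) a.
Proof.
transitivity (sw (fun h1 h2 => sw (fun h21 h22 => sw (fun a1 a2 =>
    Tr (h22 * a2) *: (S h1 * h21 * a1)) a) h2) h).
  apply: eq_sweedler => h1 h2.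
  transitivity (S h1 * (Tr (h2 * a) *: 1)); first by rewrite -scalerAr mulr1.
  rewrite -Trl sweedlerM; last by lin.
  rewrite sweedler_comp; last by lin.
  apply: eq_sweedler => h21 h22; rewrite sweedler_comp; last by lin.
  by apply: eq_sweedler => a1 a2; rewrite -scalerAr mulrA.
rewrite -(sweedler_coassoc hH (f := fun h1 h21 h22 => sw (fun a1 a2 =>
    Tr (h22 * a2) *: (S h1 * h21 * a1)) a)); last by lin.
transitivity (sw (fun h1 h2 => eps h1 *: sw (fun a1 a2 => Tr (h2 * a2) *: a1) a) h);
  last by rewrite sw_counitl //; lin.
apply: eq_sweedler => h1 h2; rewrite exchange_sweedler (@sw_scale _ _ hH H).
apply: eq_sweedler => a1 a2.
transitivity (Tr (h2 * a2) *: ((eps h1 *: 1) * a1)).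
  rewrite -sw_antipodel (sweedler_comp (F := fun x => Tr (h2 * a2) *: (x * a1)) hH) //.
  by lin.
by rewrite -scalerAl mul1r !scalerA mulrC.
Qed.

(** Same scheme as [trace_shiftl], but the inserted factor is b_2 S(b_1), which collapses because
    S^2 = id. This is the source of the symmetry of the trace. *)
Lemma trace_shift_op a b :
  sw (fun a1 a2 => Tr (a2 * b) *: a1) a = sw (fun b1 b2 => Tr (a * b2) *: S b1) b.
Proof.
transitivity (sw (fun b1 b2 => sw (fun a1 a2 => sw (fun b21 b22 =>
    Tr (a2 * b22) *: (a1 * b21 * S b1)) b2) a) b); last first.
  apply: eq_sweedler => b1 b2.
  transitivity ((Tr (a * b2) *: 1) * S b1); last by rewrite -scalerAl mul1r.
  rewrite -Trl sweedlerM; last by lin.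
  rewrite (sweedler_comp (F := fun x => x * S b1) hH); last by lin.
  apply: eq_sweedler => a1 a2.
  rewrite (sweedler_comp (F := fun x => x * S b1) hH); last by lin.
  by apply: eq_sweedler => c d; rewrite scalerAl.
rewrite [RHS](_ : _ = sw (fun b1 b2 => sw (fun b21 b22 => sw (fun a1 a2 =>
    Tr (a2 * b22) *: (a1 * b21 * S b1)) a) b2) b); last first.
  by apply: eq_sweedler => b1 b2; rewrite exchange_sweedler.
rewrite -(sweedler_coassoc hH (f := fun b1 b21 b22 => sw (fun a1 a2 =>
    Tr (a2 * b22) *: (a1 * b21 * S b1)) a)); last by lin.
transitivity (sw (fun b1 b2 => eps b1 *: sw (fun a1 a2 => Tr (a2 * b2) *: a1) a) b).
  by rewrite sw_counitl //; lin.
apply: eq_sweedler => b1 b2; rewrite exchange_sweedler (@sw_scale _ _ hH H).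
apply: eq_sweedler => a1 a2.
transitivity (Tr (a2 * b2) *: (a1 * (eps b1 *: 1))).
  by rewrite -scalerAr mulr1 !scalerA mulrC.
rewrite -sw_antipoder_op (sweedler_comp (F := fun x => Tr (a2 * b2) *: (a1 * x)) hH).
  by apply: eq_sweedler => c d; rewrite mulrA.
by lin.
Qed.

Section Integral.
Variable L : H.
Hypothesis Ll : forall h, h * L = eps h *: L.
Hypothesis Lr : forall h, L * h = eps h *: L.
Hypothesis trace_ndeg : forall a, (forall b, Tr (a * b) = 0) -> a = 0.

Lemma trace_integral_neq0 : L != 0 -> Tr L != 0.
Proof.
apply: contra_neq => TL0; apply: trace_ndeg => b.
by rewrite Lr linearZ /= TL0 scaler0.
Qed.

(** By the shift lemmas, Tr(h L_2) L_1 and Tr(L_2 h) L_1 both equal Tr(L) S(h). Multiplying by g,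
    taking Tr and using Tr(L_1 g) L_2 = Tr(L) S(g) gives Tr(L) Tr(h S(g)) = Tr(L) Tr(S(g) h). Here S
    is onto and Tr(L) is nonzero. *)
Lemma trace_sym : L != 0 -> forall a b, Tr (a * b) = Tr (b * a).
Proof.
move=> /trace_integral_neq0 TL0.
suff sym g h : Tr (h * S g) = Tr (S g * h) by move=> a b; rewrite -[b]SS sym.
apply: (mulfI TL0).
have e1 : sw (fun a b => Tr (a * g) *: b) L = Tr L *: S g.
  rewrite trace_shiftl -[in RHS](sw_counitl hH (F := fun g => S g) g); last by lin.
  rewrite (@sw_scale _ _ hH H); apply: eq_sweedler => a b.
  by rewrite Lr linearZ /= !scalerA mulrC.
have e2 : sw (fun a b => Tr (h * b) *: a) L = Tr L *: S h.
  rewrite -trace_shiftr -[in RHS](sw_counitr hH (F := fun g => S g) h); last by lin.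
  rewrite (@sw_scale _ _ hH H); apply: eq_sweedler => a b.
  by rewrite Ll linearZ /= !scalerA mulrC.
have e3 : sw (fun a b => Tr (b * h) *: a) L = Tr L *: S h.
  rewrite trace_shift_op -[in RHS](sw_counitr hH (F := fun g => S g) h); last by lin.
  rewrite (@sw_scale _ _ hH H); apply: eq_sweedler => a b.
  by rewrite Lr linearZ /= !scalerA mulrC.
transitivity (Tr (h * (Tr L *: S g)) : k^o); first by rewrite -scalerAr linearZ.
transitivity (Tr ((Tr L *: S g) * h) : k^o); last by rewrite -scalerAl linearZ.
rewrite -e1 (sweedler_comp (F := fun x => Tr (h * x)) hH); last by lin.
rewrite (sweedler_comp (F := fun x => Tr (x * h)) hH); last by lin.
have := congr1 (fun x => Tr (x * g)) (etrans e2 (esym e3)).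
rewrite /= (sweedler_comp (F := fun x => Tr (x * g)) hH); last by lin.
rewrite (sweedler_comp (F := fun x => Tr (x * g)) hH); last by lin.
move=> E; transitivity (sw (fun a b => Tr (Tr (h * b) *: a * g)) L).
  apply: eq_sweedler => a b.
  by rewrite -scalerAr -scalerAl !linearZ /= /GRing.scale /= mulrC.
rewrite E; apply: eq_sweedler => a b.
by rewrite -scalerAl -scalerAl !linearZ /= /GRing.scale /= mulrC.
Qed.

End Integral.
End Trace.
End Involutive.

Section TraceForm.
Variables (k : fieldType) (H : falgType k) (hH : hopf H).
Local Notation sw := (sweedler hH).
Local Notation S := (antipode hH).
Local Notation eps := (counit hH).
Local Notation n := (\dim {:H}).
Local Notation e := (vbasis {:H}).

Lemma sum_coord_fullv (x : H) : x = \sum_(i < n) coord e i x *: e`_i.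
Proof. exact/coord_vbasis/memvf. Qed.

Lemma coord_inj (x y : H) : (forall i, coord e i x = coord e i y) -> x = y.
Proof.
by move=> xy; rewrite (sum_coord_fullv x) (sum_coord_fullv y);
  apply: eq_bigr => i _; rewrite xy.
Qed.

(** [is_trace] tests invariance against functionals; the coordinate functionals turn it into
    identities between elements of H. *)
Lemma trace_integral (Tr : {linear H -> k^o}) : is_trace hH Tr ->
  (forall h, sw (fun a b => Tr b *: a) h = Tr h *: 1) /\
  (forall h, sw (fun a b => Tr a *: b) h = Tr h *: 1).
Proof.
move=> [_ Trl Trr]; have lc i : linear (fun x : H => coord e i x : k^o).
  by move=> c x y; rewrite linearP.
split=> h; apply: coord_inj => i; rewrite (sweedler_comp hH _ _ (lc i)) linearZ /=.
- have [g gE] := linear_packed (lc i); have := Trl g h; rewrite gE [RHS]mulrC => <-.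
  by apply: (@eq_sweedler _ _ _ k^o) => a b; rewrite linearZ /= gE mulrC.
- have [g gE] := linear_packed (lc i); have := Trr g h; rewrite gE [RHS]mulrC => <-.
  by apply: (@eq_sweedler _ _ _ k^o) => a b; rewrite linearZ /= gE.
Qed.

(** The left ideal ker eps has a complement J. If 1 = x + y with x in ker eps and y in J, then h y -
    eps(h) y lies in both, hence vanishes. *)
Lemma semisimple_integral : semisimple_algebra H ->
  exists L : H, (forall h, h * L = eps h *: L) /\ eps L = 1.
Proof.
move=> ss; pose f : 'Hom(H, k^o) := linfun eps.
have fE h : f h = eps h by rewrite lfunE.
have [|J [lJ JK JI]] := ss (lker f).
  by move=> h x; rewrite !memv_ker !fE counitM => /eqP ->; rewrite mulr0.
have : (1 : H) \in (lker f + J)%VS by rewrite JK memvf.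
case/memv_addP => x /[!memv_ker] /[!fE] /eqP x0 [y Jy xy].
exists y; split; last by rewrite -(counit1 hH) xy linearD /= x0 add0r.
have y1 : eps y = 1 by rewrite -(counit1 hH) xy linearD /= x0 add0r.
move=> h; apply/eqP; rewrite -subr_eq0 -memv0 -JI memv_cap memv_ker fE.
rewrite linearB linearZ /= counitM y1 /GRing.scale /= !mulr1 subrr eqxx /=.
by rewrite memvB ?memvZ //; apply: lJ.
Qed.

Section Semisimple.
Hypothesis ss : semisimple_hopf hH.
Variable Tr : {linear H -> k^o}.
Hypothesis TrP : is_trace hH Tr.
Let SS : forall h, S (S h) = h. Proof. by case: ss. Qed.
Let Tr1 : Tr 1 = 1. Proof. by case: TrP. Qed.
Let Trl := (trace_integral TrP).1.
Let Trr := (trace_integral TrP).2.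

(** Write a = Tr(a_1 S(a_2)) a_3 and expand S(a_2) in a basis: each term is a linear image of Tr(a_1
    e_i) a_2, which [trace_shiftl] turns into a combination with coefficients Tr(a b) = 0. *)
Lemma trace_ndegl a : (forall b, Tr (a * b) = 0) -> a = 0.
Proof.
move=> a0; rewrite -(sw_counitl hH (F := fun x => x) a) //.
transitivity (sw (fun a1 c => sw (fun c1 c2 => Tr (a1 * S c1) *: c2) c) a).
  rewrite -(sweedler_coassoc hH (f := fun a1 c1 c2 => Tr (a1 * S c1) *: c2)); last by lin.
  apply: eq_sweedler => x y.
  rewrite -(sweedler_comp (F := fun z => Tr z *: y) hH (fun b c => b * S c)); last by lin.
  by rewrite sw_antipoder linearZ /= Tr1 /GRing.scale /= mulr1.
pose F i c := sw (fun c1 c2 => (coord e i (S c1) : k^o) *: c2) c.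
have lF i : linear (F i).
  apply: sweedler_linear; split=> [z|z] c x y; first by rewrite !linearP scalerDl scalerA.
  by rewrite scalerDr !scalerA mulrC.
transitivity (\sum_(i < n) F i (sw (fun a1 c => Tr (a1 * e`_i) *: c) a)); last first.
  apply: big1 => i _; rewrite trace_shiftl // [X in F i X](_ : _ = 0) ?(lin0 (lF i)) //.
  rewrite /sweedler /tlift /Defs.lift /lsum; apply: big1 => p _.
  by rewrite a0 scale0r scaler0.
transitivity (sw (fun a1 c => \sum_(i < n) Tr (a1 * e`_i) *: F i c) a); last first.
  rewrite sw_sum; apply: eq_bigr => i _.
  by rewrite sweedler_comp //; apply: eq_sweedler => x y; rewrite (linZ (lF i)).
apply: eq_sweedler => a1 c.
transitivity (sw (fun c1 c2 =>
    \sum_(i < n) Tr (a1 * e`_i) *: ((coord e i (S c1) : k^o) *: c2)) c).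
  apply: eq_sweedler => c1 c2.
  rewrite {1}(sum_coord_fullv (S c1)) mulr_sumr linear_sum scaler_suml.
  by apply: eq_bigr => i _; rewrite -scalerAr linearZ /= scalerA mulrC.
by rewrite sw_sum; apply: eq_bigr => i _; rewrite -sw_scale.
Qed.

Lemma traceC a b : Tr (a * b) = Tr (b * a).
Proof.
have [L [Ll L1]] := semisimple_integral ss.1.
have L0 : L != 0 by apply: contra_eq_neq L1 => ->; rewrite linear0 eq_sym oner_eq0.
have Sr h : S L * h = eps h *: S L.
  by rewrite -{1}(SS h) -antipodeM Ll linearZ /= counit_antipode.
(* S L is a right integral and L a left one; computing (S L) L in both ways shows that they agree,
   so L is two-sided. *)
have LS : S L = L.
  have := Sr L; rewrite L1 scale1r => <-.
  by rewrite Ll counit_antipode L1 scale1r.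
by apply: (trace_sym SS Trl Trr (L := L)) => // [h|]; [rewrite -{1}LS Sr LS | apply: trace_ndegl].
Qed.

Lemma trace_inj a b : (forall h, Tr (a * h) = Tr (b * h)) -> a = b.
Proof.
move=> ab; apply/eqP; rewrite -subr_eq0; apply/eqP/trace_ndegl => h.
by rewrite mulrBl linearB /= ab subrr.
Qed.

(** The map a |-> Tr(a -) is injective into coordinate vectors, hence onto by dimension. The
    existence of R psi and L psi rests on this. *)
Lemma trace_repr (psi : H -> k^o) : linear psi -> exists a, forall h, Tr (a * h) = psi h.
Proof.
move=> lpsi; have [p pE] := linear_packed lpsi.
pose f a : 'rV[k]_n := \row_i Tr (a * e`_i).
have lf : linear f.
  by move=> c x y; apply/rowP => i; rewrite !mxE mulrDl -scalerAl linearP.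
have [g gE] := linear_packed lf; pose G := linfun g.
have G0 : lker G == 0%VS.
  apply/lker0P => x y; rewrite !lfunE /= !gE => /rowP xy; apply: trace_inj => h.
  rewrite (sum_coord_fullv h) !mulr_sumr !linear_sum; apply: eq_bigr => i _.
  by rewrite -!scalerAr !linearZ; have := xy i; rewrite !mxE => ->.
have GT : limg G = fullv.
  apply/eqP; rewrite eqEdim subvf /= limg_dim_eq ?dimvf /=.
    by rewrite /dim /= mul1n.
  by rewrite (eqP G0) capv0.
have : (\row_i p e`_i) \in limg G by rewrite GT; exact: memvf.
case/memv_imgP => a _ /rowP aE; exists a => h.
rewrite (sum_coord_fullv h) -pE !mulr_sumr !linear_sum; apply: eq_bigr => i _.
by rewrite -!scalerAr !linearZ; have := aE i; rewrite lfunE /= gE !mxE => <-.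
Qed.

Lemma trace_dual_basis : exists f : 'I_n -> H,
  forall x, x = \sum_i Tr (f i * x) *: e`_i.
Proof.
have lc i : linear (fun x : H => coord e i x : k^o) by move=> c x y; rewrite linearP.
have /choice [f fE] i := trace_repr (lc i); exists f => x.
by rewrite {1}(sum_coord_fullv x); apply: eq_bigr => i _; rewrite fE.
Qed.

End Semisimple.
End TraceForm.

(** * The action of H on the tensor algebra *)

Section ScalarTensorAlgebra.
Variables (k : fieldType) (V : lmodType k).
Local Notation in1 := (TAin1 (scalar_bimodule V) : V -> TV V).

Lemma TV_in0 c : TAin0 (scalar_bimodule V) c = (c : k) *: (1 : TV V).
Proof.
by rewrite -TAin0_1 -(linZ (TAin0_linear _)) /GRing.scale /= mulr1.
Qed.

Lemma TV_in1_linear : linear in1.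
Proof. exact: TAin1_linear. Qed.

Lemma TV_spanind (P : TV V -> Prop) :
  (forall c x y, P x -> P y -> P (c *: x + y)) -> P 1 ->
  (forall x t, P t -> P (in1 x * t)) -> forall t, P t.
Proof.
move=> PL P1 PM; apply: TA_spanind => // h; rewrite TV_in0.
have P0 : P 0 by have := PL (-1) _ _ P1 P1; rewrite scaleN1r addNr.
by rewrite -[_ *: _]addr0; apply: PL.
Qed.

Lemma TV_lineq (W : lmodType k) (f g : TV V -> W) : linear f -> linear g ->
  f 1 = g 1 ->
  (forall x t, f t = g t -> f (in1 x * t) = g (in1 x * t)) -> f =1 g.
Proof.
move=> lf lg f0 f1; apply: TV_spanind => // c x y ex ey.
by rewrite lf lg ex ey.
Qed.

End ScalarTensorAlgebra.

Section DiagonalAction.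
Variables (k : fieldType) (H : algType k) (hH : hopf H).
Variables (V : lmodType k) (actV : hmodule H V).
Local Notation sw := (sweedler hH).
Local Notation eps := (counit hH).
Local Notation in1 := (TAin1 (scalar_bimodule V) : V -> TV V).
Local Notation "h |> v" := (hact actV h v) (at level 45, right associativity).

Fixpoint TVact_word (xs : seq V) (h : H) : TV V :=
  if xs is x :: xs' then sw (fun a b => in1 (a |> x) * TVact_word xs' b) h
  else (eps h : k) *: (1 : TV V).

Definition TVact (h : H) (t : TV V) : TV V :=
  Defs.lift (fun w : tword (k^o : algType k) V => (w.2 : k) *: TVact_word w.1 h) t.

Lemma TVact_word_linear xs : linear (TVact_word xs).
Proof.
elim: xs => [|x xs IH] /=; first by move=> c x y; rewrite linearP scalerDl scalerA.
apply: sweedler_linear; split=> [y|y].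
  apply: lin_mulr; apply: (linear_comp (@TV_in1_linear _ _)); by lin.
by lin.
Qed.

Lemma TVact_bal h : balanced (scalar_bimodule V)
  (fun w : tword (k^o : algType k) V => (w.2 : k) *: TVact_word w.1 h).
Proof.
apply: scalar_balanced => [xs|xs ys c] /=; first by apply: lin_scalel.
apply: lin_scaler; elim: xs h => [|x xs IH] h /=; apply: sweedler_par => a b.
  apply: lin_mulr; apply: (linear_comp (@TV_in1_linear _ _)); by lin.
exact: lin_mull.
Qed.

Lemma TVact_linear h : linear (TVact h).
Proof. exact: lift_linear (TVact_bal h). Qed.

Lemma TVact_linearl t : linear (TVact^~ t).
Proof.
apply: lift_linear_par => w; apply: lin_scaler; exact: TVact_word_linear.
Qed.

Lemma TVact_one h : TVact h 1 = (eps h : k) *: 1.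
Proof. by rewrite /TVact lift_ugen ?scale1r //; apply: TVact_bal. Qed.

Lemma TVact_in1M h x t :
  TVact h (in1 x * t) = sw (fun a b => in1 (a |> x) * TVact b t) h.
Proof.
move: t; apply: (@TA_word_lineq _ _ _ (scalar_bimodule V) _ (fun t => TVact h (in1 x * t))
    (fun t => sw (fun a b => in1 (a |> x) * TVact b t) h)).
- exact: (linear_comp (TVact_linear h) (mull_linear _)).
- by apply: sweedler_par => a b; apply: lin_mull; apply: TVact_linear.
have E g w : TVact g (TAword (scalar_bimodule V) w) = (w.2 : k) *: TVact_word w.1 g.
  by rewrite /TVact lift_ugen //; apply: TVact_bal.
move=> w; rewrite TAin1_word E /= sw_scale; apply: eq_sweedler => a b.
by rewrite E scalerAr.
Qed.

Lemma TVact_in1 h x : TVact h (in1 x) = in1 (h |> x).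
Proof.
rewrite -[in1 x]mulr1 TVact_in1M.
rewrite -[in RHS](sw_counitr hH (F := fun a => in1 (a |> x)) h); last first.
  by apply: (linear_comp (@TV_in1_linear _ _)); lin.
by apply: eq_sweedler => a b; rewrite TVact_one -scalerAr mulr1.
Qed.

Lemma TVactM h s t : TVact h (s * t) = sw (fun a b => TVact a s * TVact b t) h.
Proof.
move: s h; apply: TV_spanind => [c x y Hx Hy|h|x s IH] //.
- move=> h; rewrite mulrDl -scalerAl (TVact_linear h) Hx Hy.
  rewrite -[RHS](_ : sw (fun a b => TVact a (c *: x) * TVact b t + TVact a y * TVact b t) h = _).
    rewrite /sweedler /tlift /Defs.lift /lsum scaler_sumr -big_split.
    apply: eq_bigr => p _; rewrite scalerDr (linZ (TVact_linear _)) -!scalerAl.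
    by rewrite !scalerA mulrC.
  by apply: eq_sweedler => a b; rewrite (linD (TVact_linear _)) mulrDl.
- rewrite mul1r -[in LHS](sw_counitl hH (F := fun h => TVact h t) h); last exact: TVact_linearl.
  by apply: eq_sweedler => a b; rewrite TVact_one -scalerAl mul1r.
move=> h; rewrite -mulrA TVact_in1M.
transitivity (sw (fun a b => sw (fun b1 b2 => in1 (a |> x) * (TVact b1 s * TVact b2 t)) b) h).
  by apply: eq_sweedler => a b; rewrite IH sweedler_comp //; lin.
rewrite -(sweedler_coassoc hH (f := fun a b1 b2 => in1 (a |> x) * (TVact b1 s * TVact b2 t))).
  apply: eq_sweedler => a b; rewrite TVact_in1M.
  rewrite (sweedler_comp (F := fun u => u * TVact b t) hH); last by lin.
  by apply: eq_sweedler => a1 a2; rewrite mulrA.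
split=> [b c|a c|a b].
- by apply: lin_mulr; apply: (linear_comp (@TV_in1_linear _ _)); lin.
- by apply: lin_mull; apply: lin_mulr; apply: TVact_linearl.
- by apply: lin_mull; apply: lin_mull; apply: TVact_linearl.
Qed.

Lemma TVact_comp g h t : TVact (g * h) t = TVact g (TVact h t).
Proof.
move: t g h; apply: TV_spanind => [c x y Hx Hy g h|g h|x t IH g h].
- by rewrite !(TVact_linear _) Hx Hy.
- by rewrite !TVact_one (linZ (TVact_linear _)) TVact_one scalerA counitM mulrC.
rewrite !TVact_in1M sweedlerM; last first.
  split=> b; first by apply: lin_mulr; apply: (linear_comp (@TV_in1_linear _ _)); lin.
  by apply: lin_mull; apply: TVact_linearl.
rewrite (sweedler_comp hH _ _ (TVact_linear g)) exchange_sweedler.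
apply: eq_sweedler => c d; rewrite TVact_in1M.
by apply: eq_sweedler => a b; rewrite hactM IH.
Qed.

Lemma TVact1 t : TVact 1 t = t.
Proof.
move: t; apply: TV_lineq => [||| x t IH].
- exact: TVact_linear.
- by [].
- by rewrite TVact_one counit1 scale1r.
rewrite TVact_in1M sweedler1 ?hact1 ?IH //.
split=> b; first by apply: lin_mulr; apply: (linear_comp (@TV_in1_linear _ _)); lin.
by apply: lin_mull; apply: TVact_linearl.
Qed.

Lemma sweedler_ind (W : lmodType k) (P : W -> Prop) (f : H -> H -> W) h :
  P 0 -> (forall x y, P x -> P y -> P (x + y)) -> (forall c x, P x -> P (c *: x)) ->
  (forall a b, P (f a b)) -> P (sw f h).
Proof.
by move=> P0 PD PZ Pf; rewrite /sweedler /tlift /Defs.lift /lsum; apply: big_ind => // p _; apply: PZ.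
Qed.

Lemma TVact_deg n h t : TAdeg n t -> TAdeg n (TVact h t).
Proof.
elim: n h t => [|n IH] h t.
  move=> /TAdeg0P [c ->]; rewrite TV_in0 (linZ (TVact_linear _)) TVact_one scalerA.
  by rewrite -[1]TAin0_1; apply/TAdegZ/TAdeg_in0.
move: t; apply: TAdegS_ind => [|s t|x t ht].
- by rewrite (lin0 (TVact_linear h)); apply: TAdeg0.
- by rewrite (linD (TVact_linear h)); apply: TAdegD.
rewrite TVact_in1M; apply: sweedler_ind.
- exact: TAdeg0.
- exact: TAdegD.
- exact: TAdegZ.
by move=> a b; apply: (TAdegM (m := 1)) (TAdeg_in1 _ _) (IH _ _ ht).
Qed.

Local Notation B := (VH_bimodule hH actV).
Local Notation Psi := (@Psi k H hH V actV).

Lemma Psi_linear : linear Psi.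
Proof. exact: tlift_linear (Psi_bilin hH actV). Qed.

Lemma Psi_tens t h : Psi (tens t h) = Defs.lift (Psi_word hH actV h) t.
Proof. exact: tlift_tens (Psi_bilin hH actV). Qed.

Lemma Psi_word_TAword xs c h :
  Psi (tens (TAword (scalar_bimodule V) (xs, c)) h) =
  (c : k) *: ((\prod_(u <- xs) TAin1 B (tens u 1)) * TAin0 B h).
Proof. by rewrite Psi_tens lift_ugen //; apply: Psi_word_bal. Qed.

Lemma Psi_tensl h : linear (fun t => Psi (tens t h)).
Proof. by apply: (linear_comp Psi_linear); lin. Qed.

Lemma Psi_tensr t : linear (fun h => Psi (tens t h)).
Proof. by apply: (linear_comp Psi_linear); lin. Qed.

Lemma Psi_one h : Psi (tens 1 h) = TAin0 B h.
Proof. by rewrite (Psi_word_TAword [::] 1) big_nil mul1r scale1r. Qed.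

Lemma Psi_in1M v t h : Psi (tens (in1 v * t) h) = TAin1 B (tens v 1) * Psi (tens t h).
Proof.
move: t; apply: (@TA_word_lineq _ _ _ (scalar_bimodule V) _ (fun t => Psi (tens (in1 v * t) h))
    (fun t => TAin1 B (tens v 1) * Psi (tens t h))).
- by apply: (linear_comp Psi_linear); lin.
- by apply: lin_mull; apply: Psi_tensl.
move=> [xs c]; rewrite TAin1_word !Psi_word_TAword big_cons -scalerAr.
by rewrite mulrA.
Qed.

Lemma Psi_mulr t g h : Psi (tens t (g * h)) = Psi (tens t g) * TAin0 B h.
Proof.
move: t; apply: TV_lineq => [|||v t IH].
- exact: Psi_tensl.
- by apply: lin_mulr; apply: Psi_tensl.
- by rewrite !Psi_one TAin0M.
by rewrite !Psi_in1M IH mulrA.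
Qed.

Lemma Psi_mull s t h : Psi (tens (s * t) h) = Psi (tens s 1) * Psi (tens t h).
Proof.
move: s; apply: TV_lineq => [|||v s IH].
- by apply: (linear_comp Psi_linear); lin.
- by apply: lin_mulr; apply: Psi_tensl.
- by rewrite Psi_one TAin0_1 !mul1r.
by rewrite -mulrA !Psi_in1M IH mulrA.
Qed.

(** The commutation rule of the smash product, transported by Psi. With [Psi_mull] and [Psi_mulr] it
    expresses the multiplicativity of Psi without forming T(V) # H as an algebra. *)
Lemma in0_Psi h t g :
  TAin0 B h * Psi (tens t g) = sw (fun a b => Psi (tens (TVact a t) (b * g))) h.
Proof.
move: t h; apply: TV_spanind => [c x y Hx Hy h|h|v t IH h].
- rewrite tensDl tensZl (Psi_linear c) mulrDr -scalerAr Hx Hy.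
  have lR : linear (fun u => sw (fun a b => Psi (tens (TVact a u) (b * g))) h).
    by apply: sweedler_par => a b; apply: (linear_comp (Psi_tensl _) (TVact_linear _)).
  exact/esym/lR.
- rewrite Psi_one -TAin0M -(sw_counitl hH (F := fun b => TAin0 B (b * g)) h); last first.
    by apply: (linear_comp (TAin0_linear B)); lin.
  apply: eq_sweedler => a b; rewrite TVact_one tensZl (linZ Psi_linear).
  by rewrite Psi_one.
rewrite Psi_in1M mulrA TAin01 /= VHlact_tens.
have lT : linear (fun x => TAin1 B x * Psi (tens t g)).
  by apply: lin_mulr; apply: TAin1_linear.
rewrite (sweedler_comp hH _ _ lT).
transitivity (sw (fun a b => sw (fun b1 b2 =>
  TAin1 B (tens (a |> v) 1) * Psi (tens (TVact b1 t) (b2 * g))) b) h).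
  apply: eq_sweedler => a b; transitivity (TAin1 B (tens (a |> v) 1) * (TAin0 B b * Psi (tens t g))).
    by rewrite mulrA TAin10 /= VHract_tens mul1r mulr1.
  by rewrite IH sweedler_comp //; lin.
rewrite -(sweedler_coassoc hH (f := fun a b1 b2 =>
  TAin1 B (tens (a |> v) 1) * Psi (tens (TVact b1 t) (b2 * g)))); last first.
  split=> [b c|a c|a b].
  - by apply: lin_mulr; apply: (linear_comp (TAin1_linear B)); lin.
  - apply: lin_mull; apply: (linear_comp (Psi_tensl _)); exact: TVact_linearl.
  - by apply: lin_mull; apply: (linear_comp (Psi_tensr _)); lin.
apply: eq_sweedler => a b.
rewrite TVact_in1M (sweedler_comp (F := fun u => Psi (tens u (b * g))) hH); last exact: Psi_tensl.
by apply: eq_sweedler => a1 a2; rewrite Psi_in1M.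
Qed.

Lemma Psi_surj y : exists x, y = Psi x.
Proof.
move: y; apply: TA_spanind => [c x y [x' ->] [y' ->]|h|x t [y ->]].
- by exists (c *: x' + y'); rewrite Psi_linear.
- by exists (tens 1 h); rewrite Psi_one.
clear t; have im0 : exists z, 0 = Psi z by exists 0; rewrite (lin0 Psi_linear).
have imD u v : (exists z, u = Psi z) -> (exists z, v = Psi z) -> exists z, u + v = Psi z.
  by move=> [z ->] [z' ->]; exists (z + z'); rewrite (linD Psi_linear).
have imZ c u : (exists z, u = Psi z) -> exists z, c *: u = Psi z.
  by move=> [z ->]; exists (c *: z); rewrite (linZ Psi_linear).
move: x; apply: univ_ind => [|c [v g] x IH].
  by rewrite (lin0 (TAin1_linear B)) mul0r.
rewrite (TAin1_linear B) mulrDl -scalerAl; apply: (imD) => //; apply: (imZ).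
rewrite -/(tens v g); move: y {IH}; apply: univ_ind => [|d [t h] y IH].
  by rewrite (lin0 Psi_linear) mulr0.
rewrite (Psi_linear d) mulrDr -scalerAr; apply: (imD) => //; apply: (imZ).
(* v (x) g = (v (x) 1) g, and g is moved across Psi(t # h) by [in0_Psi]. *)
rewrite -/(tens t h) -[g]mul1r -VHract_tens -TAin10 -mulrA in0_Psi.
rewrite (sweedler_comp hH _ _ (mull_linear _)).
apply: (sweedler_ind (P := fun u => exists z, u = Psi z)) => // a b.
by exists (tens (in1 v * TVact a t) (b * h)); rewrite Psi_in1M.
Qed.

Lemma Psi_deg n t h : TAdeg n t -> TAdeg n (Psi (tens t h)).
Proof.
elim: n t => [|n IH] t.
  move=> /TAdeg0P [c ->]; rewrite TV_in0.
  have /= -> := linZ (Psi_tensl h) c 1; rewrite Psi_one.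
  exact/TAdegZ/TAdeg_in0.
move: t; apply: TAdegS_ind => [|s t|x t ht].
- by rewrite (lin0 (Psi_tensl h)); apply: TAdeg0.
- by rewrite (linD (Psi_tensl h)); apply: TAdegD.
by rewrite Psi_in1M; apply: (TAdegM (m := 1)) (TAdeg_in1 _ _) (IH _ ht).
Qed.

End DiagonalAction.

(** * Connected graded algebras and free modules *)

Lemma big_eq_uniq (I : eqType) (M : zmodType) (r : seq I) (i : I) (x : M) :
  uniq r -> i \in r -> \sum_(j <- r | i == j) x = x.
Proof.
move=> ur ir; rewrite -big_filter.
rewrite (eq_filter (a2 := pred1 i)) => [|j]; last by rewrite eq_sym.
by rewrite filter_pred1_uniq // big_seq1.
Qed.

Section GradedGroup.
Variables (M : zmodType) (G : int -> M -> Prop).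
Hypothesis grG : zgrading G.

Lemma zg0 n : G n 0. Proof. by case: grG. Qed.
Lemma zgB n x y : G n x -> G n y -> G n (x - y).
Proof. by case: grG => _ h _ _; apply: h. Qed.
Lemma zgN n x : G n x -> G n (- x).
Proof. by move=> h; rewrite -sub0r; apply: zgB => //; apply: zg0. Qed.
Lemma zgD n x y : G n x -> G n y -> G n (x + y).
Proof. by move=> hx hy; rewrite -[y]opprK; apply: zgB => //; apply: zgN. Qed.

Lemma zg_sum n (I : eqType) (r : seq I) (Q : pred I) (F : I -> M) :
  (forall i, i \in r -> Q i -> G n (F i)) -> G n (\sum_(i <- r | Q i) F i).
Proof.
move=> h; rewrite big_seq_cond; apply: big_ind; [exact: zg0|exact: zgD|].
by move=> i /andP[]; apply: h.
Qed.

(** [zgrading] states independence only for lists with distinct degrees; grouping the entries by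
    degree extends it to all lists. *)
Lemma zg_split (s : seq (int * M)) j : (forall q, q \in s -> G q.1 q.2) ->
  \sum_(q <- s) q.2 = 0 -> \sum_(q <- s | q.1 == j) q.2 = 0.
Proof.
move=> sG s0; case: grG => _ _ _ indep.
pose c i := \sum_(q <- s | q.1 == i) q.2.
pose s' := [seq (i, c i) | i <- undup (map fst s)].
have us' : map fst s' = undup (map fst s).
  by rewrite -map_comp -[RHS]map_id; apply: eq_map.
have [js|njs] := boolP (j \in map fst s); last first.
  rewrite big_seq_cond big_pred0 // => q; apply/andP => -[qs /eqP qj].
  by case/negP: njs; rewrite -qj; apply/mapP; exists q.
have := indep s'; rewrite us' => /(_ (undup_uniq _)) /= H.
apply: (H _ _ (j, c j)).
- by move=> q /mapP[i _ ->] /=; apply: zg_sum => r rs /eqP <-; apply: sG.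
- rewrite big_map -[RHS]s0 /= /c (exchange_big_dep predT) //= big_seq [RHS]big_seq.
  apply: eq_bigr => q qs; rewrite big_eq_uniq ?undup_uniq //.
  by rewrite mem_undup; apply: map_f.
by apply/mapP; exists j => //; rewrite mem_undup.
Qed.

(** A [zgrading] comes without projections. A decomposition of each element is chosen, and [key]
    shows that the value does not depend on the choice; the projections in [zg_comp] are a special
    case. *)
Lemma zg_extend (N : zmodType) (F : int -> M -> N) :
  (forall j x y, G j x -> G j y -> F j (x - y) = F j x - F j y) ->
  exists Phi : M -> N, (forall x y, Phi (x + y) = Phi x + Phi y) /\
    forall j x, G j x -> Phi x = F j x.
Proof.
move=> FB; have F0 j : F j 0 = 0.
  by have := FB j 0 0 (zg0 j) (zg0 j); rewrite !subrr.
have FN j x : G j x -> F j (- x) = - F j x.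
  by move=> Gx; rewrite -sub0r FB ?F0 ?sub0r //; apply: zg0.
have FD j x y : G j x -> G j y -> F j (x + y) = F j x + F j y.
  by move=> Gx Gy; rewrite -{1}[y]opprK FB ?FN ?opprK //; apply: zgN.
have key (s : seq (int * M)) : (forall q, q \in s -> G q.1 q.2) ->
    \sum_(q <- s) q.2 = 0 -> \sum_(q <- s) F q.1 q.2 = 0.
  move=> sG s0; transitivity (\sum_(j <- undup (map fst s)) \sum_(q <- s | q.1 == j) F q.1 q.2).
    rewrite (exchange_big_dep predT) //= big_seq [RHS]big_seq; apply: eq_bigr => q qs.
    rewrite big_eq_uniq ?undup_uniq //.
    by rewrite mem_undup; apply: map_f.
  apply: big1 => j _; transitivity (F j (\sum_(q <- s | q.1 == j) q.2)); last first.
    by rewrite zg_split.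
  rewrite (eq_bigr (fun q => F j q.2)) => [|q /eqP -> //].
  rewrite big_seq_cond [in RHS]big_seq_cond.
  pose K (u : N) (x : M) := G j x /\ u = F j x.
  suff [] : K (\sum_(q <- s | (q \in s) && (q.1 == j)) F j q.2)
    (\sum_(q <- s | (q \in s) && (q.1 == j)) q.2) by [].
  apply: big_rec2 => [|q u x /andP[qs /eqP qj] [Gu ->]]; first by split; rewrite ?F0 //; apply: zg0.
  have Gq : G j q.2 by rewrite -qj; apply: sG.
  by split; [apply: zgD | rewrite FD].
have /choice [dec decP] x : exists s : seq (int * M),
    (forall q, q \in s -> G q.1 q.2) /\ x = \sum_(q <- s) q.2.
  by case: grG => _ _ /(_ x) [s [_ h e]] _; exists s.
exists (fun x => \sum_(q <- dec x) F q.1 q.2).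
pose neg (s : seq (int * M)) := [seq (q.1, - q.2) | q <- s].
have negG s : (forall q, q \in s -> G q.1 q.2) -> forall q, q \in neg s -> G q.1 q.2.
  by move=> sG q /mapP[r rs ->] /=; apply/zgN/sG.
have negS s : \sum_(q <- neg s) q.2 = - \sum_(q <- s) q.2.
  by rewrite big_map sumrN.
have negF s : (forall q, q \in s -> G q.1 q.2) ->
    \sum_(q <- neg s) F q.1 q.2 = - \sum_(q <- s) F q.1 q.2.
  move=> sG; rewrite big_map -sumrN big_seq [RHS]big_seq; apply: eq_bigr => q qs.
  by rewrite /= FN //; apply: sG.
have catG (s t : seq (int * M)) : (forall q, q \in s -> G q.1 q.2) ->
    (forall q, q \in t -> G q.1 q.2) -> forall q, q \in s ++ t -> G q.1 q.2.
  by move=> sG tG q; rewrite mem_cat => /orP[/sG|/tG].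
split=> [x y|j x Gx].
  have [[[Gx ex] [Gy ey]] [Gz ez]] := (decP x, decP y, decP (x + y)).
  have := key _ (catG _ _ (negG _ Gz) (catG _ _ Gx Gy)).
  rewrite !big_cat /= negS negF // -ez -ex -ey addNr => /(_ erefl)/eqP.
  by rewrite addrC subr_eq0 => /eqP ->.
have [Gd ed] := decP x; have := key ((j, - x) :: dec x).
rewrite !big_cons /= -ed addNr FN // => h; apply/eqP; rewrite -subr_eq0 addrC; apply/eqP/h => //.
by move=> q; rewrite inE => /orP[/eqP -> /=|/Gd //]; apply: zgN.
Qed.

Lemma zg_comp : exists c : int -> M -> M,
  [/\ forall n x y, c n (x + y) = c n x + c n y, forall n x, G n x -> c n x = x,
      forall n j x, G j x -> j != n -> c n x = 0 & forall n x, G n (c n x)].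
Proof.
have /choice [c cP] n : exists c : M -> M, (forall x y, c (x + y) = c x + c y) /\
    forall j x, G j x -> c x = if j == n then x else 0.
  apply: (zg_extend (F := fun j x => if j == n then x else 0)) => j x y _ _.
  by case: eqP; rewrite ?subr0.
exists c; split=> [n|n x Gx|n j x Gx jn|n x].
- exact: (cP n).1.
- by rewrite ((cP n).2 _ _ Gx) eqxx.
- by rewrite ((cP n).2 _ _ Gx) (negPf jn).
have c0 : c n 0 = 0 by rewrite ((cP n).2 n 0 (zg0 n)) if_same.
case: grG => _ _ /(_ x) [s [_ h ->]] _; rewrite (big_morph _ (cP n).1 c0).
by apply: zg_sum => q /h Gq _; rewrite ((cP n).2 _ _ Gq); case: eqP Gq => [->|_ _] //; apply: zg0.
Qed.

Lemma zg_ind (P : M -> Prop) : P 0 -> (forall x y, P x -> P y -> P (x + y)) ->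
  (forall j x, G j x -> P x) -> forall x, P x.
Proof.
move=> P0 PD PG x; case: grG => _ _ /(_ x) [s [_ h ->]] _.
by rewrite big_seq; apply: big_ind => // q /h; apply: PG.
Qed.

End GradedGroup.

Section ConnectedGraded.
Variables (k : fieldType) (A : algType k) (g : nat -> A -> Prop).
Hypothesis conn : connected_graded g.
Local Notation eps := (augmentation g).

Let grA : zgrading (zdeg g). Proof. by case: conn => -[]. Qed.

Lemma cg_unit c : g 0%N (c%:A : A).
Proof. by case: conn => _ /(_ c%:A) [_]; apply; exists c. Qed.

Lemma cg_scale n c a : g n a -> g n (c *: a).
Proof.
move=> ga; case: conn => -[_ _ gM] _; rewrite -[a]mul1r scalerAl.
by have := gM 0 n%:Z _ _ (cg_unit c) ga; rewrite add0r.
Qed.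

Lemma cg_mul i j a b : g i a -> g j b -> g (i + j)%N (a * b).
Proof. by move=> ga gb; case: conn => -[_ _ gM] _; apply: (gM i%:Z j%:Z). Qed.

Lemma cg_ind (P : A -> Prop) : (forall x y, P x -> P y -> P (x + y)) ->
  P 1 -> (forall c x, P x -> P (c *: x)) -> (forall n a, g n.+1 a -> P a) -> forall a, P a.
Proof.
move=> PD P1 PZ Pp; have P0 : P 0 by rewrite -(scale0r 1); apply: PZ.
apply: (zg_ind grA) => // -[[|n]|n] a /=; [|exact: Pp|by move=> ->].
by case: conn => _ /(_ a) [h _] /h [c ->]; apply: PZ.
Qed.

(** [augmentation] is defined by choice; it is identified here with the coefficient of the
    degree-zero component. The last clause compares it with any other system of projections, since
    those are chosen anew in each proof. *)
Lemma augmentationP : exists e : {linear A -> k^o}, [/\ forall a, eps a = e a,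
  e 1 = 1, forall n a, g n.+1 a -> e a = 0 &
  forall c : int -> A -> A, (forall n x y, c n (x + y) = c n x + c n y) ->
    (forall n x, zdeg g n x -> c n x = x) ->
    (forall n j x, zdeg g j x -> j != n -> c n x = 0) -> forall a, e (c 0 a) = e a].
Proof.
have [c [cD c1 c0 cG]] := zg_comp grA.
have c00 n : c n 0 = 0 by apply: c1; apply: (zg0 grA).
have /choice [e eE] a : exists d : k, c 0 a = d%:A.
  by have := cG 0 a => /=; case: conn => _ /(_ (c 0 a)) [h _] /h.
have Ainj : injective (fun d : k => d%:A : A).
  move=> x y /eqP; rewrite -subr_eq0 -scalerBl scaler_eq0 oner_eq0 orbF subr_eq0.
  by move/eqP.
have e1 : e 1 = 1 by apply: Ainj; rewrite /= -eE c1 ?scale1r //; case: conn => -[].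
have ep n a : g n.+1 a -> e a = 0.
  by move=> ga; apply: Ainj; rewrite /= -eE (c0 _ n.+1%:Z) ?scale0r.
have eD x y : e (x + y) = e x + e y by apply: Ainj; rewrite /= scalerDl -!eE cD.
have eZ d x : e (d *: x) = d * e x.
  move: x d; apply: cg_ind => [x y ex ey d|d|d' x ex d|n a ga d].
  - by rewrite scalerDr !eD ex ey mulrDr.
  - by rewrite e1 mulr1; apply: Ainj; rewrite /= -eE c1 //; exact: (cg_unit d).
  - by rewrite scalerA !ex mulrA.
  - by rewrite (ep _ _ ga) mulr0 (ep n) //; apply: cg_scale.
have le : linear (e : A -> k^o) by move=> d x y; rewrite eD eZ.
have [e' e'E] := linear_packed le.
have aug_eq a : eps a = e a.
  pose E := [set d : k | exists s : seq A,
    (forall x, x \in s -> exists n, g n.+1 x) /\ a = d%:A + \sum_(x <- s) x]%classic.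
  have Ee d : E d -> d = e a.
    move=> [s [sP ->]]; rewrite eD eZ e1 mulr1.
    have -> : e (\sum_(x <- s) x) = \sum_(x <- s) e x.
      by rewrite -e'E linear_sum; apply: eq_bigr => x _; rewrite e'E.
    rewrite big_seq big1 ?addr0 // => x /sP[n gx]; exact: ep gx.
  have [d Ed] : exists d, E d.
    move: (a) @E {Ee}; apply: cg_ind => [x y|E|d x|n x gx E].
    - move=> /= [d [s [sP ->]]] [d' [s' [sP' ->]]]; exists (d + d'), (s ++ s'); split.
        by move=> z; rewrite mem_cat => /orP[/sP|/sP'].
      by rewrite big_cat scalerDl addrACA.
    - by exists 1, [::]; rewrite big_nil addr0 scale1r.
    - move=> /= [d' [s [sP ->]]]; exists (d * d'), [seq d *: z | z <- s]; split.
        by move=> z /mapP[y /sP[n gy] ->]; exists n; apply: cg_scale.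
      by rewrite big_map -scaler_sumr scalerDr scalerA.
    - exists 0, [:: x]; rewrite big_seq1 scale0r add0r; split=> // y.
      by rewrite inE => /eqP ->; exists n.
  rewrite /augmentation; apply: Ee; exact: (xgetI 0 Ed).
exists e'; split=> [a||n a ga|c' c'D c'1 c'0 a]; rewrite ?e'E //.
  exact: ep ga.
have c'00 : c' 0 0 = 0 by apply: c'1; apply: (zg0 grA).
move: a; apply: (zg_ind grA) => [|x y ex ey|j x gx].
- by rewrite c'00.
- by rewrite c'D !eD ex ey.
have [j0|j0] := eqVneq j 0; first by rewrite c'1 // -j0.
rewrite (c'0 _ _ _ gx j0); case: j gx j0 => [[|n]|n] //= gx _; last by rewrite gx.
by rewrite (ep _ _ gx); apply: Ainj; rewrite /= -eE c00 scale0r.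
Qed.

Lemma augmentationM a b : eps (a * b) = eps a * eps b.
Proof.
have [e [eE e1 ep _]] := augmentationP; rewrite !eE.
move: a; apply: cg_ind => [x y ex ey||d x ex|n x gx].
- by rewrite mulrDl !linearD /= ex ey mulrDl.
- by rewrite e1 !mul1r.
- by rewrite -scalerAl !linearZ /= ex /GRing.scale /= mulrA.
rewrite (ep _ _ gx) mul0r; move: b; apply: cg_ind => [y z ey ez||d y ey|j y gy].
- by rewrite mulrDr linearD /= ey ez addr0.
- by rewrite mulr1 (ep _ _ gx).
- by rewrite -scalerAr linearZ /= ey scaler0.
- by apply: (ep (n + j.+1)%N); rewrite -addSn; apply: cg_mul.
Qed.

Lemma augmentation_linear : linear (eps : A -> k^o).
Proof. by have [e [eE _ _ _]] := augmentationP; move=> c x y; rewrite !eE linearP. Qed.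

Lemma augmentation1 : eps 1 = 1.
Proof. by have [e [eE e1 _ _]] := augmentationP; rewrite eE. Qed.

Lemma augmentation_pos n a : g n.+1 a -> eps a = 0.
Proof. by have [e [eE _ ep _]] := augmentationP; rewrite eE; apply: ep. Qed.

End ConnectedGraded.

Section ProjectiveRelation.
Variables (B : pzRingType) (P Y : lmodType B) (Q : P -> Y -> Prop).
Hypothesis Q0 : Q 0 0.
Hypothesis QL : forall b p y p' y', Q p y -> Q p' y' -> Q (b *: p + p') (b *: y + y').

Definition relation_pred : {pred (P * Y)%type} := fun z => `[< Q z.1 z.2 >].

Lemma relation_pred_closed : GRing.submod_closed relation_pred.
Proof.
split=> [|b x y]; rewrite !unfold_in; first exact/asboolP.
by move=> /asboolP hx /asboolP hy; apply/asboolP/QL.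
Qed.

HB.instance Definition _ :=
  GRing.isSubmodClosed.Build B (P * Y)%type relation_pred relation_pred_closed.

Record relation_mod := RelationMod { rel_pair :> P * Y; _ : rel_pair \in relation_pred }.
HB.instance Definition _ := [isSub for rel_pair].
HB.instance Definition _ := [Choice of relation_mod by <:].
HB.instance Definition _ := [SubChoice_isSubLmodule of relation_mod by <:].

(** Q is a submodule of P x Y that projects onto P; a section of this projection, followed by the
    second projection, is f. Stated for relations, it lifts along maps restricted to a subset of Y,
    such as a Koszul term inside its ambient module. *)
Lemma projective_relation : projective P -> (forall p, exists y, Q p y) ->
  exists f : {linear P -> Y}, forall p, Q p (f p).
Proof.
move=> projP tot.
pose f1 (z : relation_mod) : P := (val z).1.
have lf1 : linear f1 by move=> b x y; rewrite /f1 linearP.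
have [f fE] := linear_packed lf1.
have [|h hE] := projP _ _ f (idfun : {linear P -> P}).
  move=> p; have [y Qpy] := tot p.
  have pyQ : (p, y) \in relation_pred by rewrite unfold_in; apply/asboolP.
  by exists (RelationMod pyQ); rewrite fE.
pose h2 (p : P) : Y := (val (h p)).2.
have lh2 : linear h2 by move=> b x y; rewrite /h2 !linearP.
have [h' h'E] := linear_packed lh2; exists h' => p; rewrite h'E /h2.
have := valP (h p); rewrite unfold_in => /asboolP; have := hE p; rewrite fE /f1 /=.
by move=> ->.
Qed.

End ProjectiveRelation.

Section Subspace.
Variables (k : fieldType) (U : vectType k) (Q : U -> Prop).
Hypothesis Q0 : Q 0.
Hypothesis QL : forall c x y, Q x -> Q y -> Q (c *: x + y).

(** A subspace of maximal dimension inside Q exhausts it, since any further vector of Q would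
    enlarge it. *)
Lemma subspace_vspace : exists X : {vspace U}, forall u, u \in X <-> Q u.
Proof.
pose good n := `[< exists X : {vspace U}, \dim X = n /\ forall u, u \in X -> Q u >].
have ex_good : exists n, good n.
  exists 0%N; apply/asboolP; exists 0%VS; split; first exact: dimv0.
  by move=> u; rewrite memv0 => /eqP ->.
have bnd n : good n -> (n <= \dim {:U})%N.
  by move/asboolP => [X [<- _]]; apply/dimvS/subvf.
case: (ex_maxnP ex_good bnd) => n /asboolP[X [dX XQ]] maxn; exists X => u; split; first exact: XQ.
move=> Qu; apply/contraT => uX.
have : good (\dim (X + <[u]>)).
  apply/asboolP; exists (X + <[u]>)%VS; split=> // v /memv_addP[x Xx [y /vlineP[c ->] ->]].
  by rewrite addrC; apply: QL => //; apply: XQ.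
move/maxn; rewrite -dX => dle; case/negP: uX.
have /eqP -> : X == (X + <[u]>)%VS by rewrite eqEdim addvSl.
exact: subvP (addvSr _ _) _ (memv_line u).
Qed.

End Subspace.

(** * Finite-dimensionality of the homogeneous parts of T(V) *)

Section TVFinite.
Variables (k : fieldType) (V : vectType k).
Local Notation N := (\dim {:V}).
Local Notation e := (vbasis {:V}).
Local Notation in1 := (TAin1 (scalar_bimodule V) : V -> TV V).
Implicit Types (psi : V -> k^o) (t : TV V).

Lemma TVlc_linear psi : linear psi -> linear (lcontract (B := scalar_bimodule V) psi).
Proof.
move=> lpsi; apply: lcontract_linear => // x h.
by rewrite /= (linZ lpsi) /GRing.scale /= mulrC.
Qed.

Lemma TVlc_in1M psi v t : linear psi ->
  lcontract (B := scalar_bimodule V) psi (in1 v * t) = (psi v : k) *: t.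
Proof.
move=> lpsi; rewrite lcontract_in1M //; last first.
  by move=> x h; rewrite /= (linZ lpsi) /GRing.scale /= mulrC.
by rewrite TV_in0 -scalerAl mul1r.
Qed.

Lemma TVlc_one psi : linear psi -> lcontract (B := scalar_bimodule V) psi (1 : TV V) = 0.
Proof.
move=> lpsi; rewrite -TAin0_1 lcontract_in0 //.
by move=> x h; rewrite /= (linZ lpsi) /GRing.scale /= mulrC.
Qed.

Lemma coordV_linear (i : 'I_N) : linear (fun v : V => coord e i v : k^o).
Proof. by move=> c x y; rewrite linearP. Qed.

Definition dcontract (i : 'I_N) : TV V -> TV V :=
  lcontract (B := scalar_bimodule V) (fun v : V => coord e i v : k^o).

Lemma dcontract_linear i : linear (dcontract i).
Proof. exact/TVlc_linear/coordV_linear. Qed.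

Lemma TVexpand n t : TAdeg n.+1 t -> t = \sum_(i < N) in1 e`_i * dcontract i t.
Proof.
move: t; apply: (TAdegS_lineq (B := scalar_bimodule V) (f := fun t => t)) => //.
  by apply: lin_sumr => i; apply: lin_mull; apply: dcontract_linear.
move=> v t _; rewrite {1}(coord_vbasis (memvf v)) (lin_sum (@TV_in1_linear _ _)) mulr_suml.
apply: eq_bigr => i _; rewrite (linZ (@TV_in1_linear _ _)) /dcontract TVlc_in1M.
  by rewrite -scalerAl -scalerAr.
exact: coordV_linear.
Qed.

Lemma TVlc_expand psi t : linear psi ->
  lcontract (B := scalar_bimodule V) psi t = \sum_(i < N) (psi e`_i : k) *: dcontract i t.
Proof.
move=> lpsi; move: t; apply: TV_lineq.
- exact: TVlc_linear.
- by apply: lin_sumr => i; apply: lin_scaler; apply: dcontract_linear.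
- rewrite TVlc_one // big1 // => i _.
  by rewrite /dcontract TVlc_one ?scaler0 //; apply: coordV_linear.
move=> v t _; rewrite TVlc_in1M // {1}(coord_vbasis (memvf v)) (lin_sum lpsi) scaler_suml.
apply: eq_bigr => i _; rewrite (linZ lpsi) /dcontract TVlc_in1M; last exact: coordV_linear.
by rewrite scalerA mulrC.
Qed.

Lemma dcontract_deg n i t : TAdeg n.+1 t -> TAdeg n (dcontract i t).
Proof.
apply: lcontract_deg; first exact: coordV_linear.
by move=> x h; rewrite /= linearZ /= mulrC.
Qed.

Lemma TVdeg_coords n : exists (I : finType) (b : I -> TV V) (beta : I -> {linear TV V -> k^o}),
  forall t, TAdeg n t -> t = \sum_i (beta i t : k) *: b i.
Proof.
elim: n => [|n [I [b [beta IH]]]].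
  have lp : linear (fun t : TV V => TAproj0 t : k^o) by apply: TAproj0_linear.
  have [p pE] := linear_packed lp.
  exists 'I_1, (fun _ => 1), (fun _ => p) => t /TAdeg0P[c ->].
  by rewrite big_ord1 pE TAproj0_in0 TV_in0.
have lb (j : 'I_N * I) : linear (fun t => beta j.2 (dcontract j.1 t)).
  by apply: lin_app; apply: dcontract_linear.
have /choice [beta' beta'E] j := linear_packed (lb j).
exists ('I_N * I)%type, (fun j : 'I_N * I => in1 e`_j.1 * b j.2).
exists beta' => t dt; rewrite {1}(TVexpand dt).
under [RHS]eq_bigr do rewrite beta'E.
rewrite -(pair_bigA _ (fun (i : 'I_N) j =>
  ((beta j (dcontract i t) : k) *: (in1 e`_i * b j)))) /=.
apply: eq_bigr => i _; rewrite {1}[dcontract i t](IH _ (dcontract_deg i dt)) mulr_sumr.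
by apply: eq_bigr => j _; rewrite scalerAr.
Qed.

(** T(V) has no [vectType] structure, so W is embedded into a coordinate space k^I, where a basis
    can be chosen. Applied to the spaces K_n, it allows maps out of A (x) K_n to be defined on
    generators. *)
Lemma TV_subspace_basis n (W : TV V -> Prop) :
  (forall t, W t -> TAdeg n t) -> W 0 ->
  (forall c s t, W s -> W t -> W (c *: s + t)) ->
  exists r (b : 'I_r -> TV V) (beta : 'I_r -> {linear TV V -> k^o}),
    (forall j, W (b j)) /\ forall t, W t -> t = \sum_j (beta j t : k) *: b j.
Proof.
move=> Wn W0 WL; have [I [b [beta bP]]] := TVdeg_coords n.
pose ka t : {ffun I -> k^o} := [ffun i => beta i t].
have lka : linear ka by move=> c x y; apply/ffunP => i; rewrite !ffunE linearP.
pose ex (u : {ffun I -> k^o}) : TV V := \sum_i (u i : k) *: b i.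
have lex : linear ex.
  move=> c x y; rewrite /ex scaler_sumr -big_split; apply: eq_bigr => i _.
  by rewrite !ffunE scalerDl scalerA.
have exK t : W t -> ex (ka t) = t.
  by move=> Wt; rewrite [RHS](bP _ (Wn _ Wt)); apply: eq_bigr => i _; rewrite ffunE.
have QL c x y : (exists2 t, W t & x = ka t) -> (exists2 t, W t & y = ka t) ->
    exists2 t, W t & c *: x + y = ka t.
  by move=> [s Ws ->] [t Wt ->]; exists (c *: s + t); rewrite ?lka //; apply: WL.
have [X XP] := subspace_vspace (ex_intro2 _ _ 0 W0 (esym (lin0 lka))) QL.
have lc (j : 'I_(\dim X)) : linear (fun t => coord (vbasis X) j (ka t) : k^o).
  by move=> c x y; rewrite lka linearP.
exists (\dim X), (fun j => ex (vbasis X)`_j).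
exists (fun j => sval (cid (linear_packed (lc j)))); split=> [j|t Wt].
  have /XP[t Wt ->] : (vbasis X)`_j \in X by rewrite vbasis_mem // mem_nth // size_tuple.
  by rewrite exK.
rewrite -{1}(exK _ Wt) [ka t](coord_vbasis (v := ka t) (U := X)); last by apply/XP; exists t.
rewrite (lin_sum lex); apply: eq_bigr => j _.
by rewrite (linZ lex); case: cid => f /= ->.
Qed.

End TVFinite.

(** * The Koszul complex and its comparison with resolutions *)

Section KoszulModule.
Variables (k : fieldType) (V : lmodType k) (A : algType k).

(* A (x) T(V) with A acting on the left factor only; it contains all the terms of the Koszul complex. *)
Definition kmod : Type := tensor A (TV V).
HB.instance Definition _ := GRing.Zmodule.copy kmod (tensor A (TV V)).

Definition kmod_scale (a : A) (x : kmod) : kmod :=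
  tlift (fun b (t : TV V) => tens (a * b) t) x.

Let bK a : bilin2 (fun b (t : TV V) => tens (a * b) t : tensor A (TV V)).
Proof. by lin. Qed.

Lemma kmod_scale_lin a :
  linear (fun x : tensor A (TV V) => (kmod_scale a x : tensor A (TV V))).
Proof. exact: (tlift_linear (bK a)). Qed.

Lemma kmod_scale_tens a b t : kmod_scale a (tens b t) = tens (a * b) t.
Proof. exact: (tlift_tens b t (bK a)). Qed.

Lemma kmod_scale_linl (x : kmod) :
  linear (fun a : A => (kmod_scale a x : tensor A (TV V))).
Proof. by apply: tlift_linear_par => b t; lin. Qed.

Lemma kmod_scaleA a b x : kmod_scale a (kmod_scale b x) = kmod_scale (a * b) x.
Proof.
move: x; apply: (tens_eq (Z := tensor A (TV V)) (f := fun x => kmod_scale a (kmod_scale b x))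
  (g := kmod_scale (a * b))) => [||c t].
- exact: (linear_comp (kmod_scale_lin a) (kmod_scale_lin b)).
- exact: kmod_scale_lin.
by rewrite !kmod_scale_tens mulrA.
Qed.

Lemma kmod_scale1 : left_id 1 kmod_scale.
Proof.
apply: (tens_eq (Z := tensor A (TV V)) (g := fun x => x)) => [||c t] //.
  exact: kmod_scale_lin.
by rewrite kmod_scale_tens mul1r.
Qed.

Lemma kmod_scaleDr : right_distributive kmod_scale +%R.
Proof. by move=> a x y; apply: (linD (kmod_scale_lin a)). Qed.

Lemma kmod_scaleDl x : {morph kmod_scale^~ x : a b / a + b}.
Proof. exact: (linD (kmod_scale_linl x)). Qed.

HB.instance Definition _ := GRing.Zmodule_isLmodule.Build A kmod
  kmod_scaleA kmod_scale1 kmod_scaleDr kmod_scaleDl.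

Definition kgen (t : TV V) : kmod := tens 1 t.

Lemma kmodZ_tens (a b : A) t : a *: (tens b t : kmod) = tens (a * b) t.
Proof. exact: kmod_scale_tens. Qed.

Lemma kmodE a t : (tens a t : kmod) = a *: kgen t.
Proof. by rewrite kmodZ_tens mulr1. Qed.

Lemma kmod_scalek (c : k) (x : tensor A (TV V)) : (c *: x : kmod) = (c%:A : A) *: (x : kmod).
Proof.
move: x; apply: (tens_eq (Z := tensor A (TV V)) (f := fun x => c *: x)
  (g := kmod_scale c%:A)) => [||a t].
- exact: scale_linear.
- exact: kmod_scale_lin.
by rewrite kmod_scale_tens -tensZl -scalerAl mul1r.
Qed.

Lemma kgen_linear : linear (kgen : TV V -> tensor A (TV V)).
Proof. by rewrite /kgen; lin. Qed.

Lemma kmod_ind (P : kmod -> Prop) : P 0 -> (forall x y, P x -> P y -> P (x + y)) ->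
  (forall a t, P (a *: kgen t)) -> forall x, P x.
Proof.
move=> P0 PD PG; apply: univ_ind => // c [a t] x Px; apply: PD => //.
by rewrite -/(tens a t) -tensZl kmodE.
Qed.

Section FreeMap.
Variables (Y : lmodType A) (r : nat) (beta : 'I_r -> {linear TV V -> k^o}) (y : 'I_r -> Y).

(** The map is a (x) t |-> sum of [beta j t] a y_j on all of A (x) T(V). It has the prescribed
    values on the subspace whose coordinates are the [beta j]. *)
Lemma free_map : exists f : {linear kmod -> Y},
  forall t, f (kgen t) = \sum_j (((beta j t : k)%:A : A) *: y j).
Proof.
pose co j (x : tensor A (TV V)) : A := tlift (fun a (t : TV V) => (beta j t : k) *: a) x.
have bco j : bilin2 (fun (a : A) (t : TV V) => (beta j t : k) *: a).
  by split=> [t|a] c u v; rewrite ?scalerDr ?linearP ?scalerDl !scalerA // mulrC.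
have coZ j a (x : kmod) : co j (a *: x) = a * co j x.
  move: x; apply: (tens_eq (Z := A) (f := fun x => co j (kmod_scale a x))
     (g := fun x => a * co j x)) => [||b t].
  - exact: (linear_comp (tlift_linear (bco j)) (kmod_scale_lin a)).
  - exact: (linear_comp (mull_linear a) (tlift_linear (bco j))).
  by rewrite kmod_scale_tens /co !tlift_tens // scalerAr.
have coD j (x z : kmod) : co j (x + z) = co j x + co j z by apply: (linD (tlift_linear (bco j))).
have lf : linear (fun x : kmod => \sum_j co j x *: y j).
  move=> a x z; rewrite scaler_sumr -big_split; apply: eq_bigr => j _.
  by rewrite coD coZ scalerDl scalerA.
have [f fE] := linear_packed lf; exists f => t; rewrite fE; apply: eq_bigr => j _.
by rewrite /co tlift_tens.
Qed.

End FreeMap.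

End KoszulModule.

Section KoszulComplex.
Variables (k : fieldType) (V : vectType k) (m : nat) (Rel : TV V -> Prop).
Variables (A : algType k) (g : nat -> A -> Prop) (p : TV V -> A).
Hypothesis conn : connected_graded g.
Hypotheses (p_lin : linear p) (pM : forall s t, p (s * t) = p s * p t) (p1 : p 1 = 1).
Hypothesis p_deg : forall n t, TAdeg n t -> g n (p t).
Hypothesis m2 : (2 <= m)%N.
Hypothesis Rel_deg : forall r, Rel r -> TAdeg m r.
Local Notation kmod := (kmod V A).
Local Notation rho := (rho m).
Local Notation kspace := (koszul_space m Rel).
Local Notation in1 := (TAin1 (scalar_bimodule V) : V -> TV V).

(** rho increases alternately by 1 and by m - 1, both positive as m >= 2. Minimality of the Koszul
    complex comes from this. *)
Lemma rhoS_gt0 i : (0 < rho i.+1 - rho i)%N.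
Proof.
rewrite subn_gt0 /Defs.rho /= uphalf_half; case: (odd i) => /=.
  by rewrite add1n mulnS -addn1 -addn1 -addnA addnC leq_add2r.
by rewrite add0n ltnS.
Qed.

Lemma rhoS i : rho i.+1 = ((rho i.+1 - rho i) + rho i)%N.
Proof. by rewrite subnK // ltnW // -subn_gt0; apply: rhoS_gt0. Qed.

Lemma kspan0 (U : lmodType k) (P : U -> Prop) : kspan P 0.
Proof. by exists [::]; split=> //; rewrite big_nil. Qed.

Lemma kspanL (U : lmodType k) (P : U -> Prop) c x y :
  kspan P x -> kspan P y -> kspan P (c *: x + y).
Proof.
move=> [s [sP ->]] [s' [sP' ->]]; exists ([seq (c * q.1, q.2) | q <- s] ++ s'); split.
  by move=> q; rewrite mem_cat => /orP[/mapP[r /sP Pr ->]|/sP'].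
rewrite big_cat big_map scaler_sumr; congr (_ + _); apply: eq_bigr => q _.
by rewrite scalerA.
Qed.

Lemma kspan_ind (U : lmodType k) (P : U -> Prop) (Q : U -> Prop) : Q 0 ->
  (forall c x y, Q x -> Q y -> Q (c *: x + y)) -> (forall x, P x -> Q x) ->
  forall x, kspan P x -> Q x.
Proof.
move=> Q0 QL QP x [s [sP ->]]; rewrite big_seq; apply: big_ind => //.
  by move=> y z Qy Qz; rewrite -[y]scale1r; apply: QL.
by move=> q /sP Pq; rewrite -[_ *: _]addr0; apply: QL => //; apply: QP.
Qed.

Lemma kspan_gen (U : lmodType k) (P : U -> Prop) x : P x -> kspan P x.
Proof.
move=> Px; exists [:: (1, x)]; rewrite big_seq1 scale1r; split=> // q.
by rewrite inE => /eqP ->.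
Qed.

Lemma kspace0 n : kspace n 0.
Proof. by split; [apply: TAdeg0 | move=> *; apply: kspan0]. Qed.

Lemma kspaceL n c s t : kspace n s -> kspace n t -> kspace n (c *: s + t).
Proof.
move=> [ds hs] [dt ht]; split; first by apply: TAdegD => //; apply: TAdegZ.
by move=> a b e; apply: kspanL; [apply: hs | apply: ht].
Qed.

Lemma dcontractM a i (x y : TV V) : TAdeg a.+1 x ->
  dcontract i (x * y) = dcontract i x * y.
Proof.
move: x; apply: (TAdegS_lineq (B := scalar_bimodule V) (f := fun x => dcontract i (x * y))
  (g := fun x => dcontract i x * y)).
- exact: (linear_comp (dcontract_linear i) (mulr_linear y)).
- exact: (linear_comp (mulr_linear y) (dcontract_linear i)).
move=> v t _; rewrite -mulrA /dcontract !TVlc_in1M ?scalerAl //; exact: coordV_linear.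
Qed.

Lemma rel_space_contract a b i t : rel_space Rel a.+1 b t ->
  rel_space Rel a b (dcontract i t).
Proof.
apply: (kspan_ind (Q := fun t => rel_space Rel a b (dcontract i t))).
- by rewrite (lin0 (dcontract_linear i)); apply: kspan0.
- by move=> c x y hx hy; rewrite (dcontract_linear i); apply: kspanL.
move=> _ [x [r [y [dx Rr dy ->]]]]; apply: kspan_gen; exists (dcontract i x), r, y.
split=> //; first exact: dcontract_deg.
by rewrite -mulrA (dcontractM _ _ dx) mulrA.
Qed.

Lemma kspace_contract n i t : kspace n.+1 t -> kspace n (dcontract i t).
Proof.
move=> [dt ht]; split; first exact: dcontract_deg.
by move=> a b e; apply: rel_space_contract; apply: ht; rewrite !addSn e.
Qed.

(** K_(r+n) lies in V^(x)r (x) K_n, because contracting the first letter keeps the relations that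
    stand to its right. Hence the Koszul differential maps terms to terms. *)
Lemma kspace_split r n t : kspace (r + n) t ->
  exists s : seq (TV V * TV V), [/\ forall q, q \in s -> TAdeg r q.1,
    forall q, q \in s -> kspace n q.2 & t = \sum_(q <- s) q.1 * q.2].
Proof.
elim: r t => [|r IH] t ht.
  exists [:: (1, t)]; rewrite big_seq1 mul1r; split=> // q; rewrite inE => /eqP -> //=.
  exact: (TAdeg_in0 _ 1).
have /choice [s sP] i := IH _ (kspace_contract i ht).
exists (flatten [seq [seq (in1 (vbasis {:V})`_i * q.1, q.2) | q <- s i] | i : 'I_(\dim {:V}) <- enum 'I_(\dim {:V})]).
split.
- move=> q /flattenP[_ /mapP[i _ ->] /mapP[u us ->]] /=.
  by apply: (TAdegM (m := 1)) (TAdeg_in1 _ _) _; case: (sP i) => + _ _; apply.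
- move=> q /flattenP[_ /mapP[i _ ->] /mapP[u us ->]] /=.
  by case: (sP i) => _ + _; apply.
rewrite (TVexpand ht.1) big_flatten big_map big_enum; apply: eq_bigr => i _.
case: (sP i) => _ _ ->; rewrite big_map mulr_sumr.
by apply: eq_bigr => q _; rewrite mulrA.
Qed.

Lemma split_word_linear r : linear (@split_word k V r).
Proof. exact: lift_linear (split_word_bal V r). Qed.

Lemma split_wordM r (x t : TV V) : TAdeg r x -> split_word r (x * t) = tens x t.
Proof.
move=> [s [/allP hs ->]]; rewrite mulr_suml (lin_sum (split_word_linear r)).
have lt : linear (fun x : TV V => tens x t) by lin.
rewrite (lin_sum lt) big_seq [RHS]big_seq; apply: eq_bigr => -[xs c] /hs /eqP /= sz.
move: t {lt}; apply: (@TA_word_lineq _ _ _ (scalar_bimodule V) _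
  (fun t => split_word r (TAword (scalar_bimodule V) (xs, c) * t))
  (fun t => tens (TAword (scalar_bimodule V) (xs, c) : TV V) (t : TV V))).
- exact: (linear_comp (split_word_linear r) (mull_linear _)).
- by lin.
have E w : split_word r (TAword (scalar_bimodule V) w) =
  tens (TAword (scalar_bimodule V) (take r w.1, 1) : TV V)
                      (TAword (scalar_bimodule V) (drop r w.1, w.2) : TV V).
  by rewrite /split_word lift_ugen //; apply: split_word_bal.
have Ec (ys : seq V) (b : k^o) : TAword (scalar_bimodule V) (ys, b) =
    (b : k) *: (TAword (scalar_bimodule V) (ys, 1) : TV V).
  have [h _ _ _] := TAword_balanced (scalar_bimodule V).
  by rewrite -(linZ (h ys)) /GRing.scale /= mulr1.
have Ey (y : V) (ys : seq V) (b : k^o) : TAword (scalar_bimodule V) ((c : k) *: y :: ys, b) =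
    (c : k) *: (TAword (scalar_bimodule V) (y :: ys, b) : TV V).
  have [_ h _ _] := TAword_balanced (scalar_bimodule V).
  exact: (linZ (h [::] ys b)).
move=> [[|y ys] b]; rewrite TAwordM E /wmul /=.
  rewrite take_oversize ?drop_oversize ?sz // (Ec _ (c * b)) (Ec _ c) (Ec _ b).
  by rewrite tensZl !tensZr scalerA.
by rewrite take_size_cat // drop_size_cat // Ey tensZr (Ec xs c) tensZl.
Qed.

Let bkm (a : A) : bilin2 (fun t1 t2 : TV V => tens (a * p t1) t2 : tensor A (TV V)).
Proof. by split=> [u|u]; lin; exact: p_lin. Qed.

Lemma koszul_map_linear r : linear (@koszul_map k V A p r).
Proof.
apply: tlift_linear; split=> [t|a].
  by apply: tlift_linear_par => u v; lin.
exact: (linear_comp (tlift_linear (bkm a)) (split_word_linear r)).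
Qed.

Lemma koszul_mapM r a x t : TAdeg r x ->
  koszul_map p r (tens a (x * t)) = tens (a * p x) t.
Proof.
move=> dx; rewrite /koszul_map tlift_tens; last first.
  split=> [u|b]; first by apply: tlift_linear_par => v w; lin.
  exact: (linear_comp (tlift_linear (bkm b)) (split_word_linear r)).
by rewrite (split_wordM _ dx) tlift_tens.
Qed.

Lemma koszul_map_scale r a (x : kmod) :
  (koszul_map p r (a *: x) : kmod) = a *: (koszul_map p r x : kmod).
Proof.
move: x; apply: (tens_eq (Z := tensor A (TV V)) (f := fun x => koszul_map p r (kmod_scale a x))
     (g := fun x => kmod_scale a (koszul_map p r x))) => [||b t].
- exact: (linear_comp (koszul_map_linear r) (kmod_scale_lin a)).
- exact: (linear_comp (kmod_scale_lin a) (koszul_map_linear r)).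
have bk : bilin2 (fun a (t : TV V) =>
    tlift (fun t1 t2 => tens (a * p t1) t2 : tensor A (TV V)) (split_word r t)).
  split=> [u|e]; first by apply: tlift_linear_par => v w; lin.
  exact: (linear_comp (tlift_linear (bkm e)) (split_word_linear r)).
rewrite kmod_scale_tens /koszul_map !tlift_tens //.
rewrite [RHS](lift_comp _ (F := kmod_scale a)) //; last exact: kmod_scale_lin.
by apply: eq_bigr => q _; rewrite kmod_scale_tens mulrA.
Qed.

End KoszulComplex.

(** Chain maps are built one degree at a time; G holds the invariant that makes the next step
    possible and S the commutation with the differentials. *)
Lemma dependent_choice (X : nat -> Type) (G : forall i, X i -> Prop)
    (S : forall i, X i -> X i.+1 -> Prop) :
  (exists x, G 0%N x) -> (forall i x, G i x -> exists y, G i.+1 y /\ S i x y) ->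
  exists f : forall i, X i, (forall i, G i (f i)) /\ forall i, S i (f i) (f i.+1).
Proof.
move=> ex0 exS; pose Y i := {x : X i | G i x}.
pose step i (x : Y i) : Y i.+1 :=
  let c := cid (exS i (sval x) (svalP x)) in exist _ (sval c) (svalP c).1.
pose F := fix F i : Y i := if i is j.+1 then step j (F j) else
  exist _ (sval (cid ex0)) (svalP (cid ex0)).
exists (fun i => sval (F i)); split=> i; first exact: (svalP (F i)).
exact: (svalP (cid (exS i (sval (F i)) (svalP (F i))))).2.
Qed.

Section MapToExact.
Variables (k : fieldType) (B : pzRingType) (chi : B -> k) (R : proj_resolution (triv_act chi)).
Variables (Y : lmodType B) (E : nat -> Y -> Prop) (D : nat -> Y -> Y) (aug : Y -> k).
Hypotheses (E0 : forall i, E i 0)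
  (EL : forall i b x y, E i x -> E i y -> E i (b *: x + y)).
Hypotheses (D0 : forall i, D i 0 = 0)
  (DL : forall i b x y, E i.+1 x -> E i.+1 y -> D i (b *: x + y) = b *: D i x + D i y).
Hypotheses (augD : forall x y, aug (x + y) = aug x + aug y)
  (augZ : forall b x, aug (b *: x) = chi b * aug x).
Hypothesis aug_surj : exists2 y, E 0%N y & aug y = 1.
Hypothesis aug_scale : forall c y, E 0%N y -> exists2 z, E 0%N z & aug z = c * aug y.
Hypothesis exact0 : forall x, E 0%N x -> aug x = 0 -> exists2 y, E 1%N y & D 0 y = x.
Hypothesis exactS : forall i x, E i.+1 x -> D i x = 0 -> exists2 y, E i.+2 y & D i.+1 y = x.

(** The comparison theorem for a target whose terms are submodules E i of one module Y, with
    differentials linear only there. The Koszul complex fits this form both over A and over A #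
    H. *)
Lemma map_to_exact : exists f : forall i, {linear pr_mod R i -> Y},
  [/\ forall i x, E i (f i x), forall x, aug (f 0%N x) = pr_aug x &
      forall i x, D i (f i.+1 x) = f i (pr_d R i x)].
Proof.
(* The composite with the differential of the resolution must land in cycles, so that exactness of
   the target applies at the next stage. *)
pose cyc i : Y -> Prop := if i is j.+1 then fun y => D j y = 0 else fun y => aug y = 0.
pose G i (f : {linear pr_mod R i -> Y}) := [/\ forall x, E i (f x),
  forall x, cyc i (f (pr_d R i x)) &
  match i return {linear pr_mod R i -> Y} -> Prop with
  | 0%N => fun f => forall x, aug (f x) = pr_aug x | _ => fun=> True end f].
have [||f [fG fS]] := dependent_choice (G := G)
  (S := fun i (f : {linear pr_mod R i -> Y}) (h : {linear pr_mod R i.+1 -> Y}) =>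
    forall x, D i (h x) = f (pr_d R i x)).
- have [||x|f fP] := @projective_relation B (pr_mod R 0) Y
    (fun x y => E 0%N y /\ aug y = pr_aug x) _ _ (@pr_proj _ _ _ R 0) _.
  + have a0 : aug 0 = 0 by apply: (addrI (aug 0)); rewrite -augD !addr0.
    have p0 : pr_aug (0 : pr_mod R 0) = 0 :> k.
      by apply: (addrI (pr_aug (0 : pr_mod R 0))); rewrite -pr_augD !addr0.
    by split; rewrite ?a0 ?p0.
  + move=> b x y x' y' [Ey ay] [Ey' ay']; split; first exact: EL.
    by rewrite augD augZ pr_augD pr_augZ ay ay'.
  + have [y Ey ay] := aug_surj; have [z Ez az] := aug_scale (pr_aug x) Ey.
    by exists z; rewrite az ay mulr1.
  exists f; split=> [x|x|x] /=; [by have [] := fP x| |by have [] := fP x].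
  by rewrite (fP _).2; apply/pr_exact0; exists x.
- move=> i f [fE fc _].
  have [||x|h hP] := @projective_relation B (pr_mod R i.+1) Y
    (fun x y => E i.+1 y /\ D i y = f (pr_d R i x)) _ _ (@pr_proj _ _ _ R i.+1) _.
  + by rewrite D0 !linear0.
  + move=> b x y x' y' [Ey ay] [Ey' ay']; split; first exact: EL.
    by rewrite DL // ay ay' !linearP.
  + have [y Ey Dy] : exists2 y, E i.+1 y & D i y = f (pr_d R i x).
      move: i f fE fc x; case=> [|j] f fE fc x; first exact: exact0 (fE _) (fc x).
      exact: exactS (fE _) (fc x).
    by exists y.
  exists h; split=> [|x]; last by have [] := hP x.
  split=> [x|x|//]; first by have [] := hP x.
  rewrite /cyc (hP _).2 [X in f X](_ : _ = 0) ?linear0 //.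
  by apply/pr_exact; exists x.
by exists f; split=> // [i x|x]; [have [] := fG i | have [] := fG 0%N].
Qed.

End MapToExact.

Section KoszulComplex2.
Variables (k : fieldType) (V : vectType k) (m : nat) (Rel : TV V -> Prop).
Variables (A : algType k) (g : nat -> A -> Prop) (p : TV V -> A).
Hypothesis conn : connected_graded g.
Hypotheses (p_lin : linear p) (p_deg : forall n t, TAdeg n t -> g n (p t)).
Hypothesis m2 : (2 <= m)%N.
Local Notation kmod := (kmod V A).
Local Notation kgen := (@kgen k V A).
Local Notation rho := (rho m).
Local Notation kspace := (koszul_space m Rel).
Local Notation kterm := (koszul_term m Rel).
Local Notation kd := (koszul_d m p : nat -> kmod -> kmod).

Lemma kterm_gen i a t : kspace (rho i) t -> kterm i (a *: kgen t).
Proof. by move=> ht; apply: kspan_gen; exists a, t; rewrite -kmodE. Qed.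

Lemma kterm_gen1 i t : kspace (rho i) t -> kterm i (kgen t).
Proof. by move=> ht; rewrite -[kgen t]scale1r; apply: kterm_gen. Qed.

Lemma kterm_ind i (P : kmod -> Prop) : P 0 -> (forall x y, P x -> P y -> P (x + y)) ->
  (forall a t, kspace (rho i) t -> P (a *: kgen t)) -> forall x, kterm i x -> P x.
Proof.
move=> P0 PD PG x [s [sP ->]]; rewrite big_seq; apply: big_ind => // q /sP[a [t [ht ->]]].
by rewrite -tensZl kmodE; apply: PG.
Qed.

Lemma kterm0 i : kterm i (0 : kmod). Proof. exact: kspan0. Qed.

Lemma ktermD i (x y : kmod) : kterm i x -> kterm i y -> kterm i (x + y).
Proof. by move=> hx hy; have := kspanL 1 hx hy; rewrite scale1r. Qed.

Lemma ktermL i a (x y : kmod) : kterm i x -> kterm i y -> kterm i (a *: x + y).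
Proof.
move=> hx hy; apply: ktermD => //; move: x hx; apply: kterm_ind => [|x z hx hz|b t ht].
- by rewrite scaler0; apply: kterm0.
- by rewrite scalerDr; apply: ktermD.
- by rewrite scalerA; apply: kterm_gen.
Qed.

Lemma kterm_lineq i (Y : lmodType A) (f h : kmod -> Y) : linear f -> linear h ->
  (forall t, kspace (rho i) t -> f (kgen t) = h (kgen t)) ->
  forall x, kterm i x -> f x = h x.
Proof.
move=> lf lh fh; apply: kterm_ind => [|x y ex ey|a t ht].
- by rewrite !lin0.
- by rewrite !linD // ex ey.
- by rewrite !linZ // fh.
Qed.

Lemma kd_linear i : linear (kd i).
Proof.
move=> a x y; rewrite -(koszul_map_scale p_lin _ a x).
exact: (linD (koszul_map_linear p_lin _)).
Qed.

Lemma kd_gen i t : kspace (rho i.+1) t -> exists s : seq (A * TV V),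
  [/\ forall q, q \in s -> g (rho i.+1 - rho i)%N q.1,
      forall q, q \in s -> kspace (rho i) q.2 &
      kd i (kgen t) = \sum_(q <- s) q.1 *: kgen q.2].
Proof.
rewrite {1}(rhoS m2) => ht; have [s [s1 s2 st]] := kspace_split ht.
exists [seq (p q.1, q.2) | q <- s]; split.
- by move=> q /mapP[u /s1 du ->]; apply: p_deg.
- by move=> q /mapP[u /s2 du ->].
rewrite big_map st.
have lk : linear (fun t => koszul_d m p i (kgen t) : tensor A (TV V)).
  exact: (linear_comp (koszul_map_linear p_lin _) (@kgen_linear _ _ _)).
rewrite [LHS](lin_sum lk) big_seq [RHS]big_seq; apply: eq_bigr => q /s1 dq.
by rewrite -kmodE -[p q.1]mul1r -(koszul_mapM p_lin 1 q.2 dq).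
Qed.

Lemma kd_kterm i x : kterm i.+1 x -> kterm i (kd i x).
Proof.
move: x; apply: kterm_ind => [|x y hx hy|a t ht].
- by rewrite (lin0 (kd_linear i)); apply: kterm0.
- by rewrite (linD (kd_linear i)); apply: ktermD.
rewrite (linZ (kd_linear i)) -[_ *: _]addr0; apply: ktermL; last exact: kterm0.
have [s [_ s2 ->]] := kd_gen ht.
by rewrite big_seq; apply: big_ind => [|x y|q /s2 hq]; [apply: kterm0|apply: ktermD|apply: kterm_gen].
Qed.

(* Minimality: the differentials of the Koszul complex land in A_+ K. *)
Lemma kd_minimal i (Y : lmodType A) (f : kmod -> Y) (P : Y -> Prop) :
  linear f -> P 0 -> (forall x y, P x -> P y -> P (x + y)) ->
  (forall n a y, g n.+1 a -> P (a *: y)) ->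
  forall x, kterm i.+1 x -> P (f (kd i x)).
Proof.
move=> lf P0 PD PG; apply: kterm_ind => [|x y hx hy|a t ht].
- by rewrite (lin0 (kd_linear i)) (lin0 lf).
- by rewrite (linD (kd_linear i)) (linD lf); apply: PD.
have [s [s1 _ st]] := kd_gen ht.
rewrite (linZ (kd_linear i)) st (linZ lf) (lin_sum lf) scaler_sumr big_seq.
apply: big_ind => // q /s1; have := rhoS_gt0 m2 i; case: (_ - _)%N => // n _ gq.
rewrite (linZ lf) scalerA; move: (kgen _) => y.
move: {q} q.1 gq => q; move: a n q; apply: (cg_ind conn) => [b c hb hc n q gq|n q gq|c b hb n q gq|j b gb n q gq].
- by rewrite mulrDl scalerDl; apply: PD; [apply: hb gq|apply: hc gq].
- by rewrite mul1r; apply: PG gq.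
- by rewrite -scalerAl scalerAr; apply: hb (cg_scale conn c gq).
- by apply: (PG (j.+1 + n)%N); rewrite -addnS; apply: cg_mul.
Qed.

End KoszulComplex2.

Section KoszulComparison.
Variables (k : fieldType) (V : vectType k) (m : nat) (Rel : TV V -> Prop).
Variables (A : algType k) (g : nat -> A -> Prop) (p : TV V -> A).
Hypothesis conn : connected_graded g.
Hypotheses (p_lin : linear p) (p_deg : forall n t, TAdeg n t -> g n (p t)).
Hypothesis m2 : (2 <= m)%N.
Hypothesis exK : koszul_exact m Rel g p.
Local Notation kmod := (kmod V A).
Local Notation kgen := (@kgen k V A).
Local Notation rho := (rho m).
Local Notation kspace := (koszul_space m Rel).
Local Notation kterm := (koszul_term m Rel).
Local Notation kd := (koszul_d m p : nat -> kmod -> kmod).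
Local Notation eps := (augmentation g).
Local Notation kaug := (koszul_aug g : kmod -> k).

Lemma eps_scale (c : k) a : eps (c *: a) = c * eps a.
Proof. exact: (linZ (augmentation_linear conn)). Qed.

Lemma eps_unit (c : k) : eps c%:A = c.
Proof. by rewrite eps_scale augmentation1 // mulr1. Qed.

Let baug : bilin2 (fun a (t : TV V) => eps a * TAproj0 t : k^o).
Proof.
have le := augmentation_linear conn.
split=> [t|a] c x y; first by rewrite le mulrDl /GRing.scale /= mulrA.
by rewrite TAproj0_linear mulrDr /GRing.scale /= mulrCA.
Qed.

Lemma kaug_linear : linear (koszul_aug g : tensor A (TV V) -> k^o).
Proof. exact: tlift_linear baug. Qed.

Lemma kaugD (x y : kmod) : kaug (x + y) = kaug x + kaug y.
Proof. exact: (linD kaug_linear). Qed.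

Lemma kaug_tens a t : kaug (tens a t) = eps a * TAproj0 t.
Proof. exact: (tlift_tens a t baug). Qed.

Lemma kaug_gen t : kaug (kgen t) = TAproj0 t.
Proof. by rewrite kaug_tens augmentation1 // mul1r. Qed.

Lemma kaugZ a (x : kmod) : kaug (a *: x) = eps a * kaug x.
Proof.
move: x; apply: (tens_eq (Z := k^o) (f := fun x => kaug (kmod_scale a x))
  (g := fun x => eps a * kaug x)) => [||b t].
- exact: (linear_comp kaug_linear (kmod_scale_lin a)).
- exact/lin_mulkl/kaug_linear.
by rewrite kmod_scale_tens !kaug_tens augmentationM // mulrA.
Qed.

(** The reduction k (x)_A (A (x) T(V)) = T(V). By minimality it kills the boundaries of the Koszul
    complex, so it detects generators. *)
Definition kred (x : kmod) : TV V := tlift (fun a (t : TV V) => (eps a : k) *: t) x.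

Let bred : bilin2 (fun a (t : TV V) => (eps a : k) *: t).
Proof.
have le := augmentation_linear conn.
split=> [t|a] c x y; first by rewrite le scalerDl scalerA.
by rewrite scalerDr !scalerA mulrC.
Qed.

Lemma kred_linear : linear (kred : tensor A (TV V) -> TV V).
Proof. exact: tlift_linear bred. Qed.

Lemma kredD (x y : kmod) : kred (x + y) = kred x + kred y.
Proof. exact: (linD kred_linear). Qed.

Lemma kred0 : kred 0 = 0.
Proof. exact: (lin0 kred_linear). Qed.

Lemma kred_tens a t : kred (tens a t) = (eps a : k) *: t.
Proof. exact: (tlift_tens a t bred). Qed.

Lemma kred_gen t : kred (kgen t) = t.
Proof. by rewrite kred_tens augmentation1 // scale1r. Qed.

Lemma kredZ a (x : kmod) : kred (a *: x) = (eps a : k) *: kred x.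
Proof.
move: x; apply: (tens_eq (Z := TV V) (f := fun x => kred (kmod_scale a x))
  (g := fun x => (eps a : k) *: kred x)) => [||b t].
- exact: (linear_comp kred_linear (kmod_scale_lin a)).
- exact: (lin_scaler _ kred_linear).
by rewrite kmod_scale_tens !kred_tens augmentationM // scalerA.
Qed.

Lemma kred_kd i (f : kmod -> kmod) x : linear f -> kterm i.+1 x -> kred (f (kd i x)) = 0.
Proof.
move=> lf; apply: (kd_minimal conn p_lin p_deg m2 (P := fun y => kred y = 0)) => //.
- exact: kred0.
- by move=> y z hy hz; rewrite kredD hy hz addr0.
- by move=> n a y ga; rewrite kredZ (augmentation_pos conn ga) scale0r.
Qed.

Lemma kd_kd i x : kterm i.+2 x -> kd i (kd i.+1 x) = 0.
Proof.
move=> hx; have [_ ex] := exK.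
have [_ H] := ex i (kd i.+1 x) (kd_kterm p_lin p_deg m2 hx).
by apply: H; exists x.
Qed.

Lemma kaug_kd x : kterm 1 x -> kaug (kd 0 x) = 0.
Proof.
move=> hx; have [ex _] := exK.
have [_ H] := ex (kd 0 x) (kd_kterm p_lin p_deg m2 hx).
by apply: H; exists x.
Qed.

Lemma kexact0 (x : kmod) : kterm 0 x -> kaug x = 0 -> exists2 y : kmod, kterm 1 y & kd 0 y = x.
Proof.
move=> hx x0; have [ex _] := exK; have [H _] := ex x hx.
by have [y [hy ->]] := H x0; exists y.
Qed.

Lemma kexactS i (x : kmod) : kterm i.+1 x -> kd i x = 0 ->
  exists2 y : kmod, kterm i.+2 y & kd i.+1 y = x.
Proof.
move=> hx x0; have [_ ex] := exK; have [H _] := ex i x hx.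
by have [y [hy ->]] := H x0; exists y.
Qed.

(** The substitute for projectivity of A (x) K_rho(i): values are chosen on a basis of K_rho(i) and
    extended to an A-linear map on the ambient module. *)
Lemma free_relation i (Y : lmodType A) (Q : TV V -> Y -> Prop) : Q 0 0 ->
  (forall (c : k) s t y z, Q s y -> Q t z -> Q (c *: s + t) ((c%:A : A) *: y + z)) ->
  (forall t, kspace (rho i) t -> exists y, Q t y) ->
  exists f : {linear kmod -> Y}, forall t, kspace (rho i) t -> Q t (f (kgen t)).
Proof.
move=> Q0 QL tot.
have [|||r [b [beta [bW bP]]]] := @TV_subspace_basis k V (rho i) (kspace (rho i)).
- by move=> t [].
- exact: kspace0.
- exact: kspaceL.
have /choice [y yP] j := tot _ (bW j).
have [f fP] := free_map beta y; exists f => t ht; rewrite fP {1}(bP _ ht).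
apply: (big_rec2 (fun s z => Q s z)) => // j s z _; exact: QL.
Qed.

(* A chain endomorphism of the Koszul complex that is zero on homology is homotopic
   to zero, hence vanishes modulo A_+. *)
Lemma koszul_endo_minimal (v : nat -> kmod -> kmod) :
  (forall i, linear (v i)) -> (forall i x, kterm i x -> kterm i (v i x)) ->
  (forall x, kterm 0 x -> kaug (v 0%N x) = 0) ->
  (forall i x, kterm i.+1 x -> kd i (v i.+1 x) = v i (kd i x)) ->
  forall i t, kspace (rho i) t -> kred (v i (kgen t)) = 0.
Proof.
move=> lv vK v0 vd i; have lkd := kd_linear m p_lin.
(* A homotopy satisfies d s + s d = v; on boundaries this reads d s = v, and that much is enough to
   continue the induction. *)
suff [H _] : (forall t, kspace (rho i) t -> kred (v i (kgen t)) = 0) /\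
  exists s : kmod -> kmod, [/\ linear s, forall x, kterm i x -> kterm i.+1 (s x) &
    forall y, kterm i.+1 y -> kd i (s (kd i y)) = v i (kd i y)] by [].
have KE j (s : {linear kmod -> kmod}) : (forall t, kspace (rho j) t -> kterm j.+1 (s (kgen t))) ->
    forall x, kterm j x -> kterm j.+1 (s x).
  move=> sg; apply: kterm_ind => [|x y hx hy|a t ht].
  - by rewrite linear0; apply: kterm0.
  - by rewrite linearD; apply: ktermD.
  - by rewrite linearZ /= -[_ *: _]addr0; apply: ktermL; [apply: sg|apply: kterm0].
elim: i => [|i [_ [s [ls sK sd]]]].
  have [|c u t y z [hy ey] [hz ez]|t ht|s sP] := @free_relation 0 kmod
    (fun t y => kterm 1 y /\ kd 0 y = v 0%N (kgen t)).
  - by rewrite (lin0 (@kgen_linear _ _ _)) (lin0 (lkd 0%N)) (lin0 (lv 0%N)); split=> //; apply: kterm0.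
  - split; first exact: ktermL.
    rewrite (lkd 0%N) ey ez (@kgen_linear k V A c u t) kmod_scalek.
    exact/esym/lv.
  - by have [||y hy <-] := @kexact0 (v 0%N (kgen t)); [apply/vK/kterm_gen1|apply/v0/kterm_gen1|exists y].
  have sd : forall x, kterm 0 x -> kd 0 (s x) = v 0%N x.
    apply: kterm_lineq => //; first by move=> a x y; rewrite linearP; exact: lkd.
    by move=> t /sP[].
  split=> [t ht|].
    rewrite -sd; last exact: kterm_gen1.
    by apply: (kred_kd (f := id)) => //; have [] := sP t ht.
  exists s; split=> [||y hy].
  - exact: linearP.
  - by apply: KE => t /sP[].
  - exact/sd/(kd_kterm p_lin p_deg m2 hy).
(* F takes values in cycles, since d v = v d and d s = v on boundaries. Its lift is the next stage
   of the homotopy. *)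
pose F x := v i.+1 x - s (kd i x).
have lF : linear F.
  move=> a x y; rewrite /F lv (lkd i) ls opprD scalerBr addrACA; congr (_ + _).
have kgL (c : k) t u : kgen (c *: t + u) = (c%:A : A) *: kgen t + kgen u.
  by rewrite (@kgen_linear k V A c t u) kmod_scalek.
have [|c u t y z [hy ey] [hz ez]|t ht|s' sP] := @free_relation i.+1 kmod
    (fun t y => kterm i.+2 y /\ kd i.+1 y = F (kgen t)).
- by rewrite (lin0 (@kgen_linear _ _ _)) (lin0 (lkd _)) (lin0 lF); split=> //; apply: kterm0.
- by split; [exact: ktermL|rewrite (lkd _) ey ez kgL lF].
- have hx : kterm i.+1 (kgen t) by apply: kterm_gen1.
  have [||y hy <-] := @kexactS i (F (kgen t)); last by exists y.
    rewrite /F -scaleN1r addrC; apply: ktermL; last exact: vK.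
    exact/sK/(kd_kterm p_lin p_deg m2 hx).
  by rewrite (linB (lkd i)) vd // sd // subrr.
have sd' : forall x, kterm i.+1 x -> kd i.+1 (s' x) = F x.
  apply: kterm_lineq => //; first by move=> a x y; rewrite linearP; exact: lkd.
  by move=> t /sP[].
split=> [t ht|].
  have hx : kterm i.+1 (kgen t) by apply: kterm_gen1.
  have -> : v i.+1 (kgen t) = kd i.+1 (s' (kgen t)) + s (kd i (kgen t)).
    by rewrite sd' // /F subrK.
  rewrite kredD (kred_kd ls) // addr0; apply: (kred_kd (f := id)) => //.
  by apply: KE hx => u /sP[].
exists s'; split=> [||y hy].
- exact: linearP.
- by apply: KE => t /sP[].
- by rewrite sd'; [rewrite /F kd_kd // (lin0 ls) subr0|exact: (kd_kterm p_lin p_deg m2 hy)].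
Qed.

(** The form in which comparison maps are used: going from the Koszul complex to a resolution and
    back fixes every generator modulo A_+. *)
Lemma koszul_endo_id (u : nat -> kmod -> kmod) :
  (forall i, linear (u i)) -> (forall i x, kterm i x -> kterm i (u i x)) ->
  (forall x, kterm 0 x -> kaug (u 0%N x) = kaug x) ->
  (forall i x, kterm i.+1 x -> kd i (u i.+1 x) = u i (kd i x)) ->
  forall i t, kspace (rho i) t -> kred (u i (kgen t)) = t.
Proof.
move=> lu uK u0 ud i t ht; apply/eqP; rewrite -subr_eq0 -{2}(kred_gen t).
rewrite -(linB kred_linear); apply/eqP.
apply: (koszul_endo_minimal (v := fun i x => u i x - x)) ht => [j|j x hx|x hx|j x hx].
- by move=> a x y; rewrite lu scalerBr opprD addrACA.
- by rewrite -scaleN1r addrC; apply: ktermL => //; apply: uK.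
- by rewrite (linB kaug_linear) /= u0 // subrr.
- by rewrite (linB (kd_linear m p_lin j)) ud.
Qed.

Section MapFromKoszul.
Variables (P : nat -> lmodType A) (d : forall i, P i.+1 -> P i) (aug : P 0%N -> k).
Variable E : forall i, P i -> Prop.
Hypothesis d_lin : forall i, linear (d (i := i)).
Hypotheses (augD : forall x y, aug (x + y) = aug x + aug y)
  (augZ : forall a x, aug (a *: x) = eps a * aug x).
Hypotheses (E0 : forall i, E (0 : P i))
  (EL : forall i (c : k) (x y : P i), E x -> E y -> E ((c%:A : A) *: x + y)).
Hypothesis aug1 : exists2 y, E y & aug y = 1.
Hypothesis lift0 : forall (s : seq (A * P 0%N)),
  (forall q, q \in s -> g (rho 1 - rho 0)%N q.1 /\ E q.2) ->
  aug (\sum_(q <- s) q.1 *: q.2) = 0 -> exists2 y, E y & d y = \sum_(q <- s) q.1 *: q.2.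
Hypothesis liftS : forall i (s : seq (A * P i.+1)),
  (forall q, q \in s -> g (rho i.+2 - rho i.+1)%N q.1 /\ E q.2) ->
  d (\sum_(q <- s) q.1 *: q.2) = 0 -> exists2 y, E y & d y = \sum_(q <- s) q.1 *: q.2.

(** The lifting hypotheses concern only sums of a x with a of the degree of the Koszul differential
    and x in E. Thus E may record the internal degree, for a graded comparison, or be trivial. *)
Lemma map_from_koszul : exists f : forall i, {linear kmod -> P i},
  [/\ forall i t, kspace (rho i) t -> E (f i (kgen t)),
      forall x, kterm 0 x -> aug (f 0%N x) = kaug x &
      forall i x, kterm i.+1 x -> d (f i.+1 x) = f i (kd i x)].
Proof.
pose cyc i : P i -> Prop := match i return P i -> Prop with
  | 0%N => fun y => aug y = 0 | j.+1 => fun y => d y = 0 end.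
pose G i (f : {linear kmod -> P i}) := [/\ forall t, kspace (rho i) t -> E (f (kgen t)),
  forall x, kterm i.+1 x -> cyc i (f (kd i x)) &
  match i return {linear kmod -> P i} -> Prop with
  | 0%N => fun f => forall x, kterm 0 x -> aug (f x) = kaug x | _ => fun=> True end f].
have kgL (c : k) t u : kgen (c *: t + u) = (c%:A : A) *: kgen t + kgen u.
  by rewrite (@kgen_linear k V A c t u) kmod_scalek.
have kg0 : kgen 0 = 0 by rewrite (lin0 (@kgen_linear _ _ _)).
have augL a x y : aug (a *: x + y) = eps a * aug x + aug y by rewrite augD augZ.
have aug0 : aug 0 = 0 by apply: (addrI (aug 0)); rewrite -augD !addr0.
have [||f [fG fS]] := dependent_choice (G := G)
  (S := fun i (f : {linear kmod -> P i}) (h : {linear kmod -> P i.+1}) =>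
    forall x, kterm i.+1 x -> d (h x) = f (kd i x)).
- have [|c s t y z [Ey ay] [Ez az]|t ht|f fP] := @free_relation 0 (P 0%N)
    (fun t y => E y /\ aug y = TAproj0 t).
  + by rewrite aug0 (lin0 (TAproj0_linear (B := scalar_bimodule V))).
  + split; first exact: EL.
    by rewrite augL eps_unit ay az TAproj0_linear.
  + have [y Ey ay] := aug1; exists ((TAproj0 t : k)%:A *: y + 0); split; first exact: EL.
    by rewrite augL aug0 addr0 eps_unit ay mulr1.
  have fa x : kterm 0 x -> aug (f x) = kaug x.
    move: x; apply: kterm_ind => [|x y hx hy|a t ht].
    + by rewrite linear0 aug0 (lin0 kaug_linear).
    + by rewrite linearD augD hx hy kaugD.
    + by rewrite linearZ augZ (fP _ ht).2 kaugZ kaug_gen.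
  exists f; split=> //= [t /fP[]|x hx] //.
  by rewrite fa ?kaug_kd //; apply: (kd_kterm p_lin p_deg m2).
- move=> i f [fE fc _].
  have tot t : kspace (rho i.+1) t -> exists y, E y /\ d y = f (kd i (kgen t)).
    move=> ht; have hx := kterm_gen1 A ht.
    have [s [s1 s2 es]] := kd_gen p_lin p_deg m2 ht.
    have := fc _ hx; rewrite es linear_sum /=.
    have -> : \sum_(q <- s) f (q.1 *: kgen q.2) =
      \sum_(q <- [seq (q.1, f (kgen q.2)) | q <- s]) q.1 *: q.2.
      by rewrite big_map; apply: eq_bigr => q _; rewrite linearZ.
    have hs q : q \in [seq (q.1, f (kgen q.2)) | q <- s] ->
        g (rho i.+1 - rho i)%N q.1 /\ E q.2.
      by move=> /mapP[u us ->] /=; split; [apply: s1|apply/fE/s2].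
    move: (map _ _) hs => s'; clear es s1 s2 fE fc hx ht t s f.
    case: i s' => [|j] s' hs c0.
      by have [y Ey dy] := lift0 hs c0; exists y.
    by have [y Ey dy] := liftS hs c0; exists y.
  have [|c s t y z [Ey ay] [Ez az]|h hP] := @free_relation i.+1 (P i.+1)
    (fun t y => E y /\ d y = f (kd i (kgen t))) _ _ tot.
  + by rewrite kg0 (lin0 (d_lin (i:=i))) (lin0 (kd_linear m p_lin i)) linear0.
  + split; first exact: EL.
    by rewrite d_lin ay az kgL (kd_linear m p_lin i) linearP.
  have hd x : kterm i.+1 x -> d (h x) = f (kd i x).
    move: x; apply: kterm_lineq => [a y z|a y z|t /hP[]] //; first by rewrite linearP d_lin.
    by rewrite (kd_linear m p_lin i) linearP.
  exists h; split=> //; split=> // [t /hP[]|x hx] //.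
  rewrite /cyc hd; last exact: (kd_kterm p_lin p_deg m2).
  by rewrite kd_kd // linear0.
by exists f; split=> // [i t ht|x hx]; [have [h _ _] := fG i; apply: h | have [_ _ h] := fG 0%N; apply: h].
Qed.

End MapFromKoszul.

End KoszulComparison.

Section GradedPart.
Variables (k : fieldType) (A : algType k) (g : nat -> A -> Prop).
Hypothesis conn : connected_graded g.
Variables (P : lmodType A) (G : int -> P -> Prop).
Hypothesis grP : graded_module (zdeg g) G.
Variable c : int -> A -> A.
Hypotheses (cD : forall n x y, c n (x + y) = c n x + c n y)
  (c_id : forall n x, zdeg g n x -> c n x = x)
  (c_0 : forall n j x, zdeg g j x -> j != n -> c n x = 0)
  (c_deg : forall n x, zdeg g n (c n x)).

Let grA : zgrading (zdeg g). Proof. by case: conn => -[]. Qed.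
Let c0 n : c n 0 = 0. Proof. by apply: c_id; apply: (zg0 grA). Qed.

Lemma comp_mul i n a b : zdeg g i a -> c (i + n) (a * b) = a * c n b.
Proof.
move=> ga; move: b; apply: (zg_ind grA) => [|x y hx hy|j b gb].
- by rewrite mulr0 !c0 mulr0.
- by rewrite mulrDr !cD hx hy mulrDr.
have gab : zdeg g (i + j) (a * b) by case: conn => -[_ _ gM] _; apply: gM.
have [jn|jn] := eqVneq j n; first by rewrite -jn !c_id.
by rewrite (c_0 gb jn) mulr0 (c_0 gab) // (inj_eq (addrI i)).
Qed.

(** A homomorphism need not be a finite sum of homogeneous ones, but its component of degree n is
    determined on homogeneous elements and is again A-linear. Ext is computed with homogeneous maps,
    so cocycles and primitives are replaced by such components. *)
Lemma graded_part (n : int) (th : {linear P -> A^o}) :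
  exists th' : {linear P -> A^o}, of_degree G (zdeg g) n th' /\
    forall j x, G j x -> th' x = c (j + n) (th x).
Proof.
have [grG GM] := grP.
have cB m x y : c m (x - y) = c m x - c m y.
  by rewrite -[in RHS](subrK y x) [in RHS]cD addrK.
have [th' [thD thE]] := zg_extend grG (N := A) (F := fun j x => c (j + n) (th x))
  (fun j x y _ _ => etrans (congr1 _ (linearB th x y)) (cB _ _ _)).
have th0 : th' 0 = 0 by rewrite (thE 0 0) ?linear0 ?c0 //; apply: zg0 grG _.
have thZ a x : th' (a *: x) = a * th' x.
  move: a x; apply: (zg_ind grA) => [x|a b ha hb x|i a ga].
  - by rewrite scale0r mul0r.
  - by rewrite scalerDl thD ha hb mulrDl.
  apply: (zg_ind grG) => [|x y hx hy|j x gx].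
  - by rewrite scaler0 th0 mulr0.
  - by rewrite scalerDr !thD hx hy mulrDr.
  by rewrite (thE _ _ gx) (thE _ _ (GM _ _ _ _ ga gx)) linearZ -addrA /= comp_mul.
have lth : linear (th' : P -> A^o) by move=> a x y; rewrite thD thZ.
have [f fE] := linear_packed lth; exists f; split=> [j x gx|j x gx]; rewrite fE (thE _ _ gx) //.
Qed.

End GradedPart.

Section GorensteinKoszul.
Variables (k : fieldType) (V : vectType k) (m : nat) (Rel : TV V -> Prop).
Variables (A : algType k) (g : nat -> A -> Prop) (p : TV V -> A).
Hypothesis conn : connected_graded g.
Hypotheses (p_lin : linear p) (p_deg : forall n t, TAdeg n t -> g n (p t)).
Hypothesis m2 : (2 <= m)%N.
Hypothesis exK : koszul_exact m Rel g p.
Local Notation kmod := (kmod V A).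
Local Notation kgen := (@kgen k V A).
Local Notation rho := (rho m).
Local Notation kspace := (koszul_space m Rel).
Local Notation kterm := (koszul_term m Rel).
Local Notation kd := (koszul_d m p : nat -> kmod -> kmod).
Local Notation eps := (augmentation g).
Local Notation kaug := (koszul_aug g : kmod -> k).
Local Notation kred := (kred g).

Let grA : zgrading (zdeg g). Proof. by case: conn => -[]. Qed.

Lemma rho0 : rho 0 = 0%N. Proof. by rewrite /Defs.rho /= muln0. Qed.

Lemma map_to_koszul (R : proj_resolution (triv_act eps)) :
  exists f : forall i, {linear pr_mod R i -> kmod},
  [/\ forall i x, kterm i (f i x), forall x, kaug (f 0%N x) = pr_aug x &
      forall i x, kd i (f i.+1 x) = f i (pr_d R i x)].
Proof.
apply: map_to_exact.
- exact: kterm0.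
- exact: ktermL.
- by move=> i; apply: lin0 (kd_linear m p_lin i).
- by move=> i b x y _ _; apply: kd_linear.
- exact: kaugD conn.
- exact: kaugZ conn.
- exists (kgen 1).
    apply: kterm_gen1; rewrite rho0; split; first exact: (TAdeg_in0 _ 1).
    (* As m > 0, no a and b satisfy a + m + b = 0, so K_0 is all of the degree-zero part. *)
    by move=> a b; have := m2; case: (m) => // n _; rewrite addnS addSn.
  by rewrite kaug_gen // -TAin0_1 TAproj0_in0.
- move=> c y hy; exists (c%:A *: y + 0); first by apply: ktermL => //; apply: kterm0.
  by rewrite addr0 kaugZ // eps_unit.
- exact: kexact0 exK.
- exact: kexactS exK.
Qed.

Section Resolution.
Variable R : proj_resolution (triv_act eps).

Lemma resolution_dd i x : pr_d R i (pr_d R i.+1 x) = 0.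
Proof. by apply/pr_exact; exists x. Qed.

Lemma koszul_resolution_id (f : forall i, {linear kmod -> pr_mod R i})
  (h : forall i, {linear pr_mod R i -> kmod}) :
  (forall x, kterm 0 x -> pr_aug (f 0%N x) = kaug x) ->
  (forall i x, kterm i.+1 x -> pr_d R i (f i.+1 x) = f i (kd i x)) ->
  (forall i x, kterm i (h i x)) -> (forall x, kaug (h 0%N x) = pr_aug x) ->
  (forall i x, kd i (h i.+1 x) = h i (pr_d R i x)) ->
  forall i t, kspace (rho i) t -> kred (h i (f i (kgen t))) = t.
Proof.
move=> fa fd hK ha hd; apply: (koszul_endo_id conn p_lin p_deg m2 exK (u := fun i x => h i (f i x))).
- by move=> i a x y; rewrite !linearP.
- by move=> i x _.
- by move=> x hx; rewrite ha fa.
- by move=> i x hx; rewrite hd fd.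
Qed.

Lemma koszul_comparison : exists (f : forall i, {linear kmod -> pr_mod R i})
  (h : forall i, {linear pr_mod R i -> kmod}),
  forall i t, kspace (rho i) t -> kred (h i (f i (kgen t))) = t.
Proof.
have [h [hK ha hd]] := map_to_koszul R.
have [f [_ fa fd]] : exists f : forall i, {linear kmod -> pr_mod R i},
  [/\ forall i t, kspace (rho i) t -> True,
      forall x, kterm 0 x -> pr_aug (f 0%N x) = kaug x &
      forall i x, kterm i.+1 x -> pr_d R i (f i.+1 x) = f i (kd i x)].
  apply: (map_from_koszul conn p_lin p_deg m2 exK (d := pr_d R) (aug := @pr_aug _ _ _ R)
    (E := fun _ _ => True)) => //.
  - by move=> i a x y; rewrite linearP.
  - exact: pr_augD.
  - exact: pr_augZ.
  - by have [y ey] := pr_aug_surj R 1; exists y.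
  - move=> s _ s0; have [H _] := pr_exact0 (p := R) (\sum_(q <- s) q.1 *: q.2).
    by have [y ->] := H s0; exists y.
  - move=> i s _ s0; have [H _] := pr_exact (p := R) (i := i) (\sum_(q <- s) q.1 *: q.2).
    by have [y ->] := H s0; exists y.
by exists f, h; apply: koszul_resolution_id.
Qed.

End Resolution.
End GorensteinKoszul.

(** * The Gorenstein condition and the superpotential *)

Section GorensteinTop.
Variables (k : fieldType) (V : vectType k) (m : nat) (Rel : TV V -> Prop).
Variables (A : algType k) (g : nat -> A -> Prop) (p : TV V -> A).
Hypothesis conn : connected_graded g.
Hypotheses (p_lin : linear p) (p_deg : forall n t, TAdeg n t -> g n (p t)).
Hypothesis m2 : (2 <= m)%N.
Hypothesis exK : koszul_exact m Rel g p.
Local Notation kmod := (kmod V A).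
Local Notation kgen := (@kgen k V A).
Local Notation rho := (rho m).
Local Notation kspace := (koszul_space m Rel).
Local Notation kterm := (koszul_term m Rel).
Local Notation kd := (koszul_d m p : nat -> kmod -> kmod).
Local Notation eps := (augmentation g).
Local Notation kaug := (koszul_aug g : kmod -> k).
Local Notation kred := (kred g).

Let grA : zgrading (zdeg g). Proof. by case: conn => -[]. Qed.

(** The hypothesis is an argument of the type, so that the A-module structure on k, which depends on
    it, can be attached as an instance. *)
Definition trivial_module of connected_graded g : Type := k.
HB.instance Definition _ h := GRing.Zmodule.copy (trivial_module h) k.

Definition trivial_scale h (a : A) (x : trivial_module h) : trivial_module h :=
  (eps a * (x : k) : k).

Lemma trivial_scaleA h a b (x : trivial_module h) :
  trivial_scale a (trivial_scale b x) = trivial_scale (a * b) x.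
Proof. by rewrite /trivial_scale augmentationM // mulrA. Qed.
Lemma trivial_scale1 h : left_id 1 (@trivial_scale h).
Proof. by move=> x; rewrite /trivial_scale augmentation1 // mul1r. Qed.
Lemma trivial_scaleDr h : right_distributive (@trivial_scale h) +%R.
Proof. by move=> a x y; rewrite /trivial_scale [_ * _]mulrDr. Qed.
Lemma trivial_scaleDl h (x : trivial_module h) :
  {morph (@trivial_scale h)^~ x : a b / a + b}.
Proof.
by move=> a b; rewrite /trivial_scale (linD (augmentation_linear conn)) [_ * _]mulrDl.
Qed.

HB.instance Definition _ h := GRing.Zmodule_isLmodule.Build A (trivial_module h)
  (@trivial_scaleA h) (@trivial_scale1 h) (@trivial_scaleDr h) (@trivial_scaleDl h).

(** The identity of K_rho(d+1) factors, modulo A_+, through the term of degree d + 1 of a resolution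
    of k of length d, which is zero. *)
Lemma kspace_vanish d : gl_dim A d -> forall t, kspace (rho d.+1) t -> t = 0.
Proof.
move=> [/(_ (trivial_module conn)) [R0 R0d] _] t ht.
pose R : proj_resolution (triv_act eps) := R0.
have Rd i : (d < i)%N -> forall x : pr_mod R i, x = 0 by exact: R0d.
have [f [h H]] := koszul_comparison conn p_lin p_deg m2 exK R.
by rewrite -(H _ _ ht) (Rd _ (ltnSn d) (f d.+1 (kgen t))) linear0 kred0.
Qed.

(** The map is a (x) t |-> phi(t) a. *)
Lemma kfun_exists (phi : {linear TV V -> k^o}) :
  exists F : {linear kmod -> A^o}, (forall t, F (kgen t) = (phi t : k)%:A) /\
    forall x, eps (F x) = phi (kred x).
Proof.
have [F FE] := @free_map k V A (A^o : lmodType A) 1 (fun _ => phi) (fun _ => 1).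
have Fg t : F (kgen t) = (phi t : k)%:A by rewrite FE big_ord1 /GRing.scale /= mulr1.
exists F; split=> //; apply: kmod_ind => [|x y hx hy|a t].
- by rewrite kred0 // !linear0 (lin0 (augmentation_linear conn)).
- by rewrite kredD // !linearD -hx -hy; apply: (linD (augmentation_linear conn)).
- rewrite linearZ Fg kredZ // kred_gen // linearZ /=.
  by rewrite {1}/GRing.scale /= augmentationM // eps_unit.
Qed.

Section GradedResolution.
Variable R : proj_resolution (triv_act eps).
Variable G : forall i, int -> pr_mod R i -> Prop.
Hypothesis grR : graded_resolution (zdeg g) (@triv_deg k) G.

Let grG i : zgrading (@G i). Proof. by case: grR => /(_ i) []. Qed.
Let GM i j n a x : zdeg g j a -> @G i n x -> G (j + n) (a *: x).
Proof. by case: grR => /(_ i) [_ h] _ _; apply: h. Qed.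
Let Gd i j x : @G i.+1 j x -> G j (pr_d R i x).
Proof. by case: grR => _ h _ /h; rewrite addr0. Qed.
Let Gaug j x : @G 0%N j x -> j != 0 -> pr_aug x = 0.
Proof. by case: grR => _ _ h /h + /eqP j0; apply; rewrite addr0. Qed.

Lemma graded_lift0 n x : @G 0%N n x -> pr_aug x = 0 -> exists2 y, @G 1%N n y & pr_d R 0 y = x.
Proof.
move=> gx x0; have [H _] := pr_exact0 (p := R) x; have [y ey] := H x0.
have [c [cD c1 c0 cG]] := zg_comp (grG 1); have [c' [c'D c'1 c'0 c'G]] := zg_comp (grG 0).
exists (c n y) => //; rewrite -[RHS](c'1 _ _ gx) ey.
have c00 : c n 0 = 0 by apply: c1; apply: zg0.
have c'00 : c' n 0 = 0 by apply: c'1; apply: zg0.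
move: (y); apply: (zg_ind (grG 1)) => [|u v hu hv|j u gu].
- by rewrite c00 linear0 c'00.
- by rewrite cD !linearD c'D hu hv.
have [jn|jn] := eqVneq j n; first by rewrite c1 ?c'1 -?jn //; apply: Gd.
by rewrite (c0 _ _ _ gu jn) linear0 (c'0 _ _ _ (Gd gu) jn).
Qed.

Lemma graded_liftS i n x : @G i.+1 n x -> pr_d R i x = 0 ->
  exists2 y, @G i.+2 n y & pr_d R i.+1 y = x.
Proof.
move=> gx x0; have [H _] := pr_exact (p := R) x; have [y ey] := H x0.
have [c [cD c1 c0 cG]] := zg_comp (grG i.+2); have [c' [c'D c'1 c'0 c'G]] := zg_comp (grG i.+1).
exists (c n y) => //; rewrite -[RHS](c'1 _ _ gx) ey.
have c00 : c n 0 = 0 by apply: c1; apply: zg0.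
have c'00 : c' n 0 = 0 by apply: c'1; apply: zg0.
move: (y); apply: (zg_ind (grG i.+2)) => [|u v hu hv|j u gu].
- by rewrite c00 linear0 c'00.
- by rewrite cD !linearD c'D hu hv.
have [jn|jn] := eqVneq j n; first by rewrite c1 ?c'1 -?jn //; apply: Gd.
by rewrite (c0 _ _ _ gu jn) linear0 (c'0 _ _ _ (Gd gu) jn).
Qed.

Lemma graded_aug1 : exists2 y, @G 0%N 0 y & pr_aug y = 1.
Proof.
have [y ey] := pr_aug_surj R 1; have [c [cD c1 c0 cG]] := zg_comp (grG 0).
exists (c 0 y) => //; rewrite -ey.
have a0 : pr_aug (0 : pr_mod R 0) = 0 :> k.
  by apply: (addrI (pr_aug (0 : pr_mod R 0))); rewrite -pr_augD !addr0.
move: (y); apply: (zg_ind (grG 0)) => [|u v hu hv|j u gu].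
- by rewrite c1 //; apply: zg0.
- by rewrite cD !pr_augD hu hv.
have [j0|j0] := eqVneq j 0; first by rewrite c1 // -j0.
by rewrite (c0 _ _ _ gu j0) a0 (Gaug gu j0).
Qed.

Lemma koszul_comparison_graded : exists (f : forall i, {linear kmod -> pr_mod R i})
  (h : forall i, {linear pr_mod R i -> kmod}),
  [/\ forall i t, kspace (rho i) t -> G (rho i)%:Z (f i (kgen t)),
      forall i x, kterm i.+1 x -> pr_d R i (f i.+1 x) = f i (kd i x),
      (forall i x, kterm i (h i x)) /\ (forall x, kaug (h 0%N x) = pr_aug x) /\
      (forall x, kterm 0 x -> pr_aug (f 0%N x) = kaug x),
      forall i x, kd i (h i.+1 x) = h i (pr_d R i x) &
      forall i t, kspace (rho i) t -> kred (h i (f i (kgen t))) = t].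
Proof.
have [h [hK ha hd]] := map_to_koszul conn p_lin m2 exK R.
have sumG i j (s : seq (A * pr_mod R i)) : (forall q, q \in s ->
    g (rho j.+1 - rho j)%N q.1 /\ G (rho j)%:Z q.2) ->
    G (rho j.+1)%:Z (\sum_(q <- s) q.1 *: q.2).
  move=> hs; apply: zg_sum => // q /hs[gq Gq] _; rewrite (rhoS m2) PoszD.
  exact: GM.
have [f [fG fa fd]] : exists f : forall i, {linear kmod -> pr_mod R i},
  [/\ forall i t, kspace (rho i) t -> G (rho i)%:Z (f i (kgen t)),
      forall x, kterm 0 x -> pr_aug (f 0%N x) = kaug x &
      forall i x, kterm i.+1 x -> pr_d R i (f i.+1 x) = f i (kd i x)].
  apply: (map_from_koszul conn p_lin p_deg m2 exK (d := pr_d R) (aug := @pr_aug _ _ _ R)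
    (E := fun i x => G (rho i)%:Z x)) => //.
  - by move=> i a x y; rewrite linearP.
  - exact: pr_augD.
  - exact: pr_augZ.
  - by move=> i; apply: zg0.
  - move=> i c x y gx gy; apply: zgD => //; rewrite -[(rho i)%:Z]add0r; apply: GM => //.
    exact: (cg_unit conn c).
  - by rewrite rho0; apply: graded_aug1.
  - by move=> s hs; apply: graded_lift0; apply: sumG.
  - by move=> i s hs; apply: graded_liftS; apply: sumG.
exists f, h; split=> //.
by apply: koszul_resolution_id.
Qed.

Variables (f : forall i, {linear kmod -> pr_mod R i}).
Hypotheses (fG : forall i t, kspace (rho i) t -> G (rho i)%:Z (f i (kgen t)))
  (fd : forall i x, kterm i.+1 x -> pr_d R i (f i.+1 x) = f i (kd i x)).

(** A coboundary psi d satisfies psi d f = psi f d, and d lands in A_+ times the Koszul term. *)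
Lemma coboundary_eval i n (th : pr_mod R i -> A) t : kspace (rho i) t ->
  ext_coboundary (zdeg g) G n th -> eps (th (f i (kgen t))) = 0.
Proof.
have e0 : eps 0 = 0 by apply: (lin0 (augmentation_linear conn)).
case: i th => [|i] th ht; first by move=> ->.
move=> [psi [_ ->]]; rewrite fd; last exact: kterm_gen1.
apply: (kd_minimal conn p_lin p_deg m2 (Y := (A^o : lmodType A)) (f := fun x => psi (f i x))
  (P := fun a => eps a = 0)) => //.
- by move=> a x y; rewrite !linearP.
- by move=> x y hx hy; rewrite [eps _](linD (augmentation_linear conn)) hx hy addr0.
- by move=> n' a y ga; rewrite {1}/GRing.scale /= augmentationM // (augmentation_pos conn ga) mul0r.
- exact: (kterm_gen1 A ht).
Qed.

Variables (h : forall i, {linear pr_mod R i -> kmod}).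
Hypotheses (hK : forall i x, kterm i (h i x))
  (hd : forall i x, kd i (h i.+1 x) = h i (pr_d R i x))
  (hf : forall i t, kspace (rho i) t -> kred (h i (f i (kgen t))) = t).

(** The cocycle is a homogeneous component of F h. Its degree is -rho(i) because f(t) has degree
    rho(i) and the augmentation sees only degree zero. *)
Lemma functional_cocycle i (phi : {linear TV V -> k^o}) (F : {linear kmod -> A^o}) :
  (forall x, eps (F x) = phi (kred x)) -> (forall x, kterm i.+1 x -> F (kd i x) = 0) ->
  exists th : {linear pr_mod R i -> A^o},
    [/\ of_degree (@G i) (zdeg g) (- (rho i)%:Z) th, ext_cocycle th &
        forall t, kspace (rho i) t -> eps (th (f i (kgen t))) = phi t].
Proof.
move=> FE Fd; have [c [cD c1 c0 cG]] := zg_comp grA.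
have lth : linear (fun x => F (h i x)) by move=> a x y; rewrite !linearP.
have [th0 th0E] := linear_packed lth.
have grP : graded_module (zdeg g) (@G i) by split=> // *; apply: GM.
have [th [thG thE]] := graded_part conn grP cD c1 c0 cG (- (rho i)%:Z) th0.
exists th; split=> // [y|t ht].
  move: y; apply: (zg_ind (grG i.+1)) => [|x y hx hy|j x gx].
  - by rewrite !linear0.
  - by rewrite !linearD hx hy addr0.
  by rewrite (thE _ _ (Gd gx)) th0E -hd Fd // c1 //; apply: zg0.
rewrite (thE _ _ (fG ht)) subrr th0E -[RHS](congr1 phi (hf ht)) -FE.
by have [e [eE _ _ ec]] := augmentationP conn; rewrite !eE; apply: ec.
Qed.

(** Unless (i, rho(i)) = (d, l), the cocycle attached to phi is a coboundary, and [coboundary_eval]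
    forces its values phi(t) to be zero. *)
Lemma functional_vanish d l i (phi : {linear TV V -> k^o}) (F : {linear kmod -> A^o}) :
  (forall i n, ~ (i = d /\ n = - (l%:Z)) -> ext_zero (zdeg g) G i n) ->
  (forall x, eps (F x) = phi (kred x)) -> (forall x, kterm i.+1 x -> F (kd i x) = 0) ->
  ~ (i = d /\ rho i = l) -> forall t, kspace (rho i) t -> phi t = 0.
Proof.
move=> E0 FE Fd il t ht; have [th [thG thc <-] //] := functional_cocycle FE Fd.
apply: coboundary_eval (ht) _; apply: E0 thG thc => -[id rl]; apply: il; split=> //.
by move/oppr_inj: rl => [].
Qed.

Lemma functional_line d l (e : {linear pr_mod R d -> A^o}) (phi : {linear TV V -> k^o})
  (F : {linear kmod -> A^o}) : rho d = l ->
  (forall th : {linear pr_mod R d -> A^o}, of_degree (@G d) (zdeg g) (- (l%:Z)) th ->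
    ext_cocycle th -> exists c, zdeg g 0 c /\
     ext_coboundary (zdeg g) G (- (l%:Z)) (fun x => th x - e x * c)) ->
  (forall x, eps (F x) = phi (kred x)) -> (forall x, kterm d.+1 x -> F (kd d x) = 0) ->
  exists c, forall t, kspace (rho d) t -> phi t = eps (e (f d (kgen t))) * c.
Proof.
move=> rl E1 FE Fd; have [th [thG thc the]] := functional_cocycle FE Fd.
rewrite rl in thG; have [c [_ cob]] := E1 _ thG thc.
exists (eps c) => t ht; rewrite -the //; apply/eqP; rewrite -subr_eq0 -augmentationM //.
rewrite -(linB (augmentation_linear conn)); apply/eqP.
exact: coboundary_eval ht cob.
Qed.

Hypotheses (ha : forall x, kaug (h 0%N x) = pr_aug x)
  (fa : forall x, kterm 0 x -> pr_aug (f 0%N x) = kaug x).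

(** The homotopy between f h and the identity of the resolution, recorded only on boundaries, as in
    [koszul_endo_minimal]. *)
Lemma resolution_homotopy i : exists s : {linear pr_mod R i -> pr_mod R i.+1},
  forall y, pr_d R i (s (pr_d R i y)) = f i (h i (pr_d R i y)) - pr_d R i y.
Proof.
elim: i => [|i [s sd]].
  have [||x|s sP] := @projective_relation A (pr_mod R 0) (pr_mod R 1)
    (fun x y => pr_d R 0 y = f 0%N (h 0%N x) - x) _ _ (@pr_proj _ _ _ R 0) _.
  - by rewrite !linear0 addr0.
  - by move=> a x y x' y' ey ey'; rewrite !linearP ey ey' scalerDr addrACA.
  - have [H _] := pr_exact0 (p := R) (f 0%N (h 0%N x) - x).
    have [|y ->] := H; last by exists y.
    rewrite pr_augD fa // ha; have := pr_augD (p := R) x (- x); rewrite subrr => <-.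
    by apply: (addrI (pr_aug (0 : pr_mod R 0))); rewrite -pr_augD !addr0.
  by exists s => y; rewrite sP.
have [||x|s' sP] := @projective_relation A (pr_mod R i.+1) (pr_mod R i.+2)
    (fun x y => pr_d R i.+1 y = f i.+1 (h i.+1 x) - x - s (pr_d R i x)) _ _
    (@pr_proj _ _ _ R i.+1) _.
- by rewrite !linear0 !addr0.
- move=> a x y x' y' ey ey'; rewrite !linearP ey ey' !scalerDr addrACA.
  by congr (_ + _); rewrite addrACA.
- have [H _] := pr_exact (p := R) (f i.+1 (h i.+1 x) - x - s (pr_d R i x)).
  have [|y ->] := H; last by exists y.
  by rewrite !linearB /= sd fd // hd subrr.
exists s' => y; rewrite sP resolution_dd linear0 subr0 //.
Qed.

(** If K_rho(d) were zero, then h would vanish in degree d, the homotopy would express the identity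
    through s and d modulo boundaries, and every d-cocycle would be a coboundary. For d = 0 the
    element 1 already lies in K_0. *)
Lemma top_nonzero d l (e : {linear pr_mod R d -> A^o}) :
  of_degree (@G d) (zdeg g) (- (l%:Z)) e -> ext_cocycle e ->
  ~ ext_coboundary (zdeg g) G (- (l%:Z)) e ->
  exists2 t, kspace (rho d) t & t != 0.
Proof.
move=> eG ec ne; apply: contrapT => no.
have K0 t : kspace (rho d) t -> t = 0.
  by move=> ht; apply: contrapT => /eqP t0; apply: no; exists t.
case: d e eG ec ne {no} K0 => [|j] e eG ec ne K0.
  have := K0 1; rewrite rho0 => /(_ _) H; have := oner_neq0 (TV V); rewrite H ?eqxx //.
  split; first exact: (TAdeg_in0 _ 1).
  by move=> a b; have := m2; case: (m) => // n _; rewrite addnS addSn.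
have h0 x : h j.+1 x = 0.
  move: (hK x); move: (h j.+1 x); apply: kterm_ind => // [x' y -> ->|a t /K0 ->].
    by rewrite addr0.
  by rewrite (lin0 (@kgen_linear _ _ _)) scaler0.
have [s sd] := resolution_homotopy j.
(* f h x - x - s d x is a boundary, hence killed by e, and h x = 0. *)
have es x : e x = - e (s (pr_d R j x)).
  have [H _] := pr_exact (p := R) (f j.+1 (h j.+1 x) - x - s (pr_d R j x)).
  have [|y ey] := H; first by rewrite !linearB /= sd fd // hd subrr.
  have := congr1 e ey; rewrite ec h0 linear0 sub0r linearB linearN /=.
  by move/eqP; rewrite subr_eq0 => /eqP <-; rewrite opprK.
(* The primitive -e s need not be homogeneous; its component of degree -l still has coboundary e. *)
apply: ne; have [c [cD c1 c0 cG]] := zg_comp grA.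
have lth : linear (fun x => - e (s x) : A^o) by move=> a x y; rewrite !linearP.
have [th0 th0E] := linear_packed lth.
have grP : graded_module (zdeg g) (@G j) by split=> // *; apply: GM.
have [th [thG thE]] := graded_part conn grP cD c1 c0 cG (- (l%:Z)) th0.
exists th; split=> //; apply: (zg_ind (grG j.+1)) => [|x y hx hy|n x gx].
- by rewrite !linear0.
- by rewrite !linearD hx hy.
by rewrite (thE _ _ (Gd gx)) th0E -es c1 //; apply: eG.
Qed.

End GradedResolution.
End GorensteinTop.

Lemma linear_of (k : fieldType) (U W : lmodType k) (f : {linear U -> W}) : linear f.
Proof. exact: linearP. Qed.

(** * Rotation, contractions and relations of a twisted superpotential *)

Section Superpotential.
Variables (k : fieldType) (V : vectType k).
Local Notation in1 := (TAin1 (scalar_bimodule V) : V -> TV V).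
Local Notation lc := (lcontract (B := scalar_bimodule V)).
Local Notation rc := (rcontract (B := scalar_bimodule V)).
Local Notation e := (vbasis {:V}).

Lemma TVword_rcons (xs : seq V) x (c : k^o) :
  TAword (scalar_bimodule V) (xs ++ [:: x], c) =
  (TAword (scalar_bimodule V) (xs, c) : TV V) * in1 x.
Proof.
rewrite !TAwordE big_cat big_seq1 /= -!mulrA; congr (_ * _).
by rewrite !TV_in0 -scalerAl mul1r -scalerAr mulr1.
Qed.

Lemma theta_linear : linear (@theta k V).
Proof. exact: lift_linear (@theta_bal k V). Qed.

Lemma on_last_linear (s : V -> V) : linear s -> linear (@on_last k V s).
Proof. by move=> ls; apply: lift_linear (on_last_bal ls). Qed.

Lemma rotate_in1M (s : V -> V) x t : linear s ->
  on_last s (theta (in1 x * t)) = t * in1 (s x).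
Proof.
move=> ls; move: t; apply: (@TA_word_lineq _ _ _ (scalar_bimodule V) _
  (fun t => on_last s (theta (in1 x * t))) (fun t => t * in1 (s x))).
- apply: (linear_comp (on_last_linear ls)); apply: (linear_comp theta_linear).
  exact: mull_linear.
- exact: (mulr_linear (in1 (s x))).
move=> [xs c]; rewrite TAin1_word /= /theta lift_ugen /=; last exact: theta_bal.
rewrite rot1_cons /on_last lift_ugen /=; last exact: on_last_bal.
by rewrite rev_rcons rev_cons revK -cats1 TVword_rcons.
Qed.

Lemma TVrc_linear (psi : V -> k^o) : linear psi -> linear (rc psi).
Proof.
by move=> lpsi; apply: rcontract_linear => // h x; rewrite /= (linZ lpsi).
Qed.

Lemma TVrc_Min1 (psi : V -> k^o) t x : linear psi ->
  rc psi (t * in1 x) = (psi x : k) *: (t : TV V).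
Proof.
move=> lpsi; rewrite rcontract_Min1 //; last first.
  by move=> h y; rewrite /= (linZ lpsi).
by rewrite TV_in0 -scalerAr mulr1.
Qed.

(** The rotation sends the first letter, twisted by s, to the last place. On an element that it
    fixes, left and right contractions are therefore exchanged. *)
Lemma rc_rotate n (psi : V -> k^o) (s : V -> V) t : linear psi -> linear s -> TAdeg n.+1 t ->
  rc psi (on_last s (theta t)) = lc (fun v => psi (s v)) t.
Proof.
move=> lpsi ls; have lps : linear (fun v => psi (s v)) := linear_comp lpsi ls.
apply: (TAdegS_lineq (B := scalar_bimodule V) (f := fun t => rc psi (on_last s (theta t)))).
- apply: (linear_comp (TVrc_linear lpsi)); apply: (linear_comp (on_last_linear ls)).
  exact: theta_linear.
- exact: TVlc_linear.
by move=> x t' _; rewrite rotate_in1M // TVrc_Min1 // TVlc_in1M.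
Qed.

Lemma rc_in1M n (psi : V -> k^o) x t : linear psi -> TAdeg n.+1 t ->
  rc psi (in1 x * t) = in1 x * (rc psi t : TV V).
Proof.
move=> lpsi; have lr := TVrc_linear lpsi.
apply: (TAdegSr_lineq (B := scalar_bimodule V) (f := fun t => rc psi (in1 x * t))
   (g := fun t => in1 x * (rc psi t : TV V))).
- exact: (linear_comp lr (mull_linear _)).
- exact: (linear_comp (mull_linear (in1 x)) lr).
by move=> v t' _; rewrite mulrA !TVrc_Min1 // scalerAr.
Qed.

Lemma rc_lc n (psi f : V -> k^o) t : linear psi -> linear f -> TAdeg n.+2 t ->
  rc psi (lc f t) = lc f (rc psi t).
Proof.
move=> lpsi lf; have lr := TVrc_linear lpsi; have ll := TVlc_linear lf.
apply: (TAdegS_lineq (B := scalar_bimodule V) (f := fun t => rc psi (lc f t))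
   (g := fun t => lc f (rc psi t))).
- exact: (linear_comp lr ll).
- exact: (linear_comp ll lr).
by move=> v t' dt'; rewrite TVlc_in1M // (linZ lr) (rc_in1M _ _ dt') // TVlc_in1M.
Qed.

Lemma lc_deg n (f : {linear V -> k^o}) t : TAdeg n.+1 t -> TAdeg n (lc f t).
Proof.
apply: lcontract_deg; first exact: linear_of.
by move=> x h; rewrite /= linearZ /= mulrC.
Qed.

Lemma rc_partial n (psi : V -> k^o) (fs : seq {linear V -> k^o}) (t : TV V) : linear psi ->
  TAdeg (size fs + n.+1) t ->
  rc psi (foldl (fun s (f : {linear V -> k^o}) => lc f s) t fs) =
  foldl (fun s (f : {linear V -> k^o}) => lc f s) (rc psi t) fs.
Proof.
move=> lpsi; elim: fs t => //= f fs IH t dt.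
rewrite IH; last by apply: lc_deg; rewrite -addSn.
by rewrite (rc_lc (n := size fs + n) lpsi (linear_of f)) // -addnS.
Qed.

Lemma partial_expand n j (t : TV V) : TAdeg (n + j) t ->
  exists s : seq (TV V * TV V), [/\ forall q, q \in s -> TAdeg n q.1,
    forall q, q \in s -> partial n t q.2 & t = \sum_(q <- s) q.1 * q.2].
Proof.
elim: n t => [|n IH] t dt.
  exists [:: (1, t)]; rewrite big_seq1 mul1r; split=> // q; rewrite inE => /eqP -> /=.
    exact: (TAdeg_in0 _ 1).
  by exists [tuple].
have /choice [s sP] (i : 'I_(\dim {:V})) := IH _ (dcontract_deg i dt).
exists (flatten [seq [seq (in1 e`_i * q.1, q.2) | q <- s i] | i : 'I_(\dim {:V}) <- enum 'I_(\dim {:V})]).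
split.
- move=> q /flattenP[_ /mapP[i _ ->] /mapP[u us ->]] /=.
  by apply: (TAdegM (m := 1)) (TAdeg_in1 _ _) _; case: (sP i) => + _ _; apply.
- move=> q /flattenP[_ /mapP[i _ ->] /mapP[u us ->]] /=.
  case: (sP i) => _ /(_ _ us) + _ => -[psi ->].
  have [f fE] := linear_packed (coordV_linear (V := V) i).
  exists [tuple of f :: psi] => /=; congr foldl.
  by rewrite /dcontract; congr (lcontract _ t); apply/funext => v; rewrite fE.
rewrite {1}(TVexpand dt) big_flatten big_map big_enum; apply: eq_bigr => i _.
case: (sP i) => _ _ ->; rewrite big_map mulr_sumr.
by apply: eq_bigr => q _; rewrite mulrA.
Qed.

Section Twisted.
Variables (sigma : 'End(V)) (l m : nat) (w : TV V).
Hypothesis wS : superpotential l sigma w.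
Local Notation Rel := (partial (l - m) w).
Local Notation tau t := (on_last sigma (theta t)).

Let sl : linear sigma. Proof. exact: linearP. Qed.

(** Induction on b. For b = 0 this is the expansion of w by its (l - m)-fold contractions. The
    twisted rotation fixes w and moves a letter from the front to the end, which shifts the
    relations one place to the left. *)
Lemma superpotential_rel a b : (a + m + b = l)%N -> rel_space Rel a b w.
Proof.
have [dw wE] := wS.
elim: b a => [|b IH] a abl.
  have la : (l - m = a)%N by rewrite -abl addn0 addnK.
  have [|s [s1 s2 ws]] := @partial_expand (l - m) m w.
    by rewrite la -[X in TAdeg X](_ : l = _) // -abl addn0.
  exists [seq (1, q.1 * q.2) | q <- s]; split.
    move=> q /mapP[u us ->]; exists u.1, u.2, 1; rewrite mulr1; split=> //.
    - by rewrite -la; apply: s1.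
    - exact: s2.
    - exact: (TAdeg_in0 _ 1).
  by rewrite big_map {1}ws; apply: eq_bigr => q _; rewrite scale1r.
have lt : linear (fun t => tau t) := linear_comp (on_last_linear sl) theta_linear.
suff key : forall t, rel_space Rel a.+1 b t -> rel_space Rel a b.+1 (tau t).
  by have := key w; rewrite wE; apply; apply: IH; rewrite -abl !addSn addnS.
apply: (kspan_ind (Q := fun t => rel_space Rel a b.+1 (tau t))).
- by rewrite (lin0 lt); apply: kspan0.
- by move=> c x y hx hy; rewrite lt; apply: kspanL.
move=> _ [x [r [y [dx Rr dy ->]]]].
move: x dx; apply: (TAdegS_ind (B := scalar_bimodule V)) => [|s t hs ht|v x dx].
- by rewrite !mul0r (lin0 lt); apply: kspan0.
- by rewrite !mulrDl (linD lt); have := kspanL 1 hs ht; rewrite scale1r.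
rewrite -!mulrA rotate_in1M // !mulrA; apply: kspan_gen.
exists x, r, (y * in1 (sigma v)); rewrite mulrA; split=> //.
by rewrite -addn1; apply: TAdegM dy (TAdeg_in1 _ _).
Qed.

Lemma superpotential_kspace : koszul_space m Rel l w.
Proof. by split; [case: wS | move=> a b; apply: superpotential_rel]. Qed.

End Twisted.
End Superpotential.

Section GorensteinSuperpotential.
Variables (k : fieldType) (V : vectType k) (m d l : nat).
Variables (A : algType k) (g : nat -> A -> Prop) (p : TV V -> A).
Hypothesis conn : connected_graded g.
Hypothesis p_lin : linear p.
Hypothesis p_deg : forall n t, TAdeg n t -> g n (p t).
Variables (Rel : TV V -> Prop).
Hypothesis m2 : (2 <= m)%N.
Hypothesis exK : koszul_exact m Rel g p.
Hypothesis gl : gl_dim A d.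
Hypothesis gor : gorenstein (zdeg g) (augmentation g) d l.
Local Notation kmod := (kmod V A).
Local Notation kgen := (@kgen k V A).
Local Notation rho := (rho m).
Local Notation kspace := (koszul_space m Rel).
Local Notation kterm := (koszul_term m Rel).
Local Notation kd := (koszul_d m p : nat -> kmod -> kmod).
Local Notation eps := (augmentation g).

Lemma TV_separate n t : TAdeg n t -> t != 0 -> exists phi : {linear TV V -> k^o}, phi t != 0.
Proof.
move=> dt; apply: contra_neqP => no; have [I [b [beta bP]]] := TVdeg_coords V n.
rewrite (bP _ dt) big1 // => i _; have [->|bi] := eqVneq (beta i t : k) 0; first by rewrite scale0r.
by case: no; exists (beta i).
Qed.

(** K_rho(d+1) = 0 makes every functional on K_rho(d) a cocycle. As K_rho(d) is nonzero, (d, rho(d))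
    must be where Ext survives, so rho(d) = l; Ext is one-dimensional there, so all functionals on
    K_l are proportional and K_l is a line. The last clause records the vanishing of Ext^i for i <>
    d. *)
Lemma koszul_top : [/\ rho d = l, exists2 t, kspace l t & t != 0,
  forall s t, kspace l s -> kspace l t -> s != 0 -> exists c : k, t = c *: s &
  forall i (phi : {linear TV V -> k^o}) (F : {linear kmod -> A^o}),
    (forall t, F (kgen t) = (phi t : k)%:A) -> (forall x, eps (F x) = phi (kred g x)) ->
    (forall x, kterm i.+1 x -> F (kd i x) = 0) -> i <> d ->
    forall t, kspace (rho i) t -> phi t = 0].
Proof.
have [R [G [grR E0 [e [eG ec ne E1]]]]] := gor.
have [f [h [fG fd [hK [ha fa]] hd hf]]] := koszul_comparison_graded conn p_lin p_deg m2 exK grR.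
have top0 x : kterm d.+1 x -> x = 0.
  move: x; apply: (kterm_ind (m := m)) => // [x y -> ->|a t]; first by rewrite addr0.
  move/(kspace_vanish conn p_lin p_deg m2 exK gl) => ->.
  by rewrite (lin0 (@kgen_linear _ _ _)) scaler0.
have Fd (F : {linear kmod -> A^o}) x : kterm d.+1 x -> F (kd d x) = 0.
  by move/top0 => ->; rewrite (lin0 (kd_linear m p_lin d)) linear0.
have [t0 ht0 t0n] := top_nonzero conn m2 grR fd hK hd ha fa eG ec ne.
have rl : rho d = l.
  apply: contrapT => nrl; have [phi] := TV_separate ht0.1 t0n; case/eqP.
  have [F [_ FE]] := kfun_exists conn phi.
  apply: (functional_vanish conn p_lin p_deg m2 grR fG fd hK hd hf E0 FE (Fd F)) => //.
  by case.
split=> //.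
- by exists t0; rewrite -?rl.
- move=> s t hs ht s0; have [phi phis] := TV_separate hs.1 s0.
  (* On K_l both phi and a functional psi separating the difference from 0 are multiples of the
     functional given by the class e, so psi cannot separate. *)
  exists ((phi t : k) / phi s); apply/eqP; rewrite -subr_eq0; apply: contrapT => /negP.
  have hd' : TAdeg l (t - ((phi t : k) / phi s) *: s).
    by rewrite addrC -scaleNr; apply: TAdegD; [apply: TAdegZ; case: hs|case: ht].
  move/(TV_separate hd') => [psi]; case/eqP.
  have [F [_ FE]] := kfun_exists conn phi; have [F' [_ FE']] := kfun_exists conn psi.
  have [c cP] := functional_line conn p_lin p_deg m2 grR fG fd hK hd hf rl E1 FE (Fd F).
  have [c' cP'] := functional_line conn p_lin p_deg m2 grR fG fd hK hd hf rl E1 FE' (Fd F').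
  rewrite linearB linearZ /= !cP' -?rl in phis *; rewrite ?rl //.
  rewrite !cP ?rl // in phis *; move: (eps _) (eps _) phis => a b phis.
  rewrite /GRing.scale /=; move: phis; rewrite mulf_eq0 negb_or => /andP[a0 c0].
  by apply/eqP; rewrite subr_eq0; apply/eqP; field; rewrite a0 c0.
move=> i phi F FE1 FE Fi id; apply: (functional_vanish conn p_lin p_deg m2 grR fG fd hK hd hf E0 FE Fi).
by case.
Qed.

End GorensteinSuperpotential.

(** * The superpotential spans K_l and is nondegenerate *)

Section Nondegenerate.
Variables (k : fieldType) (V : vectType k) (m d l : nat).
Variables (A : algType k) (g : nat -> A -> Prop) (p : TV V -> A).
Hypothesis conn : connected_graded g.
Hypothesis p_lin : linear p.
Hypothesis p_deg : forall n t, TAdeg n t -> g n (p t).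
Variables (sigma : 'End(V)) (w : TV V).
Hypothesis sigma_GL : lker sigma == 0%VS.
Hypothesis m_le_l : (m <= l)%N.
Hypothesis wS : superpotential l sigma w.
Local Notation Rel := (partial (l - m) w).
Hypothesis m2 : (2 <= m)%N.
Hypothesis exK : koszul_exact m Rel g p.
Hypothesis gl : gl_dim A d.
Hypothesis gor : gorenstein (zdeg g) (augmentation g) d l.
Local Notation kmod := (kmod V A).
Local Notation kgen := (@kgen k V A).
Local Notation rho := (rho m).
Local Notation kspace := (koszul_space m Rel).
Local Notation kterm := (koszul_term m Rel).
Local Notation kd := (koszul_d m p : nat -> kmod -> kmod).
Local Notation lc := (lcontract (B := scalar_bimodule V)).
Local Notation rc := (rcontract (B := scalar_bimodule V)).

(** If w were zero, all relations would be zero; since m <= l, so would K_l, contrary to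
    [koszul_top]. *)
Lemma superpotential_neq0 : w != 0.
Proof.
have [_ [t ht t0] _ _] := koszul_top conn p_lin p_deg m2 exK gl gor.
apply: contra_neq t0 => w0; case: ht => _ /(_ 0%N (l - m)%N).
rewrite add0n subnKC // => /(_ erefl).
apply: (kspan_ind (Q := fun t => t = 0)) => // [c x y -> ->|_ [x [r [y [_ [psi ->] _ ->]]]]].
  by rewrite scaler0 addr0.
suff -> : foldl (fun s (f : {linear V -> k^o}) => lc f s) w psi = 0 by rewrite mulr0 mul0r.
rewrite w0; elim: (tval psi) => //= f fs IH.
by rewrite (lin0 (TVlc_linear (linear_of f))).
Qed.

Lemma superpotential_line t : kspace l t -> exists c : k, t = c *: w.
Proof.
have [_ _ H _] := koszul_top conn p_lin p_deg m2 exK gl gor => ht.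
by apply: H ht superpotential_neq0; apply: superpotential_kspace wS.
Qed.

Lemma superpotential_ndeg (psi : V -> k^o) : linear psi -> lc psi w = 0 -> forall v, psi v = 0.
Proof.
move=> lpsi w0.
have [rl _ _ H] := koszul_top conn p_lin p_deg m2 exK gl gor.
(* By rotation, [rc psi' w] = [lc psi w] = 0. Right contractions commute with the left contractions
   that define the relations, so psi' annihilates these on the right. *)
pose psi' v := psi ((sigma^-1)%VF v).
have lpsi' : linear psi' := linear_comp lpsi (linearP (sigma^-1)%VF).
have psiE v : psi' (sigma v) = psi v by rewrite /psi' lker0_lfunK.
have lsig : linear sigma by exact: linearP.
have [dw wE] := wS.
have l1 : (0 < l)%N by apply: leq_trans m_le_l; apply: ltnW.
have rcw : rc psi' w = 0.
  have dw' : TAdeg l.-1.+1 w by rewrite prednK.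
  rewrite -wE (rc_rotate lpsi' lsig dw').
  rewrite (_ : (fun v => psi' (sigma v)) = psi) //.
  by apply/funext => v; apply: psiE.
have rcRel r : Rel r -> rc psi' r = 0.
  move=> [fs ->]; rewrite (rc_partial (n := m.-1)) // ?rcw.
    by elim: (tval fs) => //= f fs' IH; rewrite (lin0 (TVlc_linear (linear_of f))).
  by rewrite size_tuple prednK ?subnK //; apply: ltnW.
have rcK t : kspace m t -> rc psi' t = 0.
  move=> [_ /(_ 0%N 0%N)]; rewrite add0n addn0 => /(_ erefl).
  have lr := TVrc_linear lpsi'.
  apply: (kspan_ind (Q := fun t => rc psi' t = 0)) => [|c x y hx hy|_ [x [r [y [dx Rr dy ->]]]]].
  - exact: (lin0 lr).
  - by rewrite lr hx hy scaler0 addr0.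
  have [[a ->] [b ->]] := (TAdeg0P dx, TAdeg0P dy).
  by rewrite !TV_in0 -scalerAr -!scalerAl mul1r mulr1 !(linZ lr) rcRel // !scaler0.
have lphi : linear (fun t : TV V => psi' (TAproj1 t)).
  exact: linear_comp lpsi' (TAproj1_linear (B := scalar_bimodule V)).
have [phi phiE] := linear_packed lphi.
have [F [Fg FE]] := kfun_exists conn phi.
(* The differential out of K_m moves the first m - 1 letters into A, and F evaluates psi' on the
   remaining one. *)
have Fkm t : TAdeg m t -> F (koszul_map p m.-1 (kgen t)) = p (rc psi' t).
  have lFl : linear (fun x : tensor A (TV V) => F (x : kmod) : A).
    by move=> c x y; rewrite linearD kmod_scalek linearZ /= {1}/GRing.scale /= mulr_algl.
  rewrite -{1}(prednK (ltnW m2)).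
  apply: (TAdegSr_lineq (B := scalar_bimodule V) (f := fun t => F (koszul_map p m.-1 (kgen t)))
    (g := fun t => p (rc psi' t))).
  - apply: (linear_comp lFl); apply: (linear_comp (koszul_map_linear p_lin _)).
    exact: (@kgen_linear k V A).
  - exact: (linear_comp p_lin (TVrc_linear lpsi')).
  move=> v x dx; rewrite (koszul_mapM p_lin 1 _ dx) mul1r kmodE linearZ Fg phiE TAproj1_in1.
  transitivity (p x * ((psi' v : k)%:A : A)); first by [].
  by rewrite TVrc_Min1 // (linZ p_lin) mulr_algr.
have Fd x : kterm 2 x -> F (kd 1 x) = 0.
  move: x; apply: kterm_ind => [|x y hx hy|a t ht].
  - by rewrite (lin0 (kd_linear m p_lin 1)) linear0.
  - by rewrite (linD (kd_linear m p_lin 1)) linearD hx hy addr0.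
  have r2 : rho 2 = m by rewrite /Defs.rho /= muln1.
  have r1 : rho 1 = 1%N by rewrite /Defs.rho /= muln0.
  rewrite r2 in ht; rewrite (linZ (kd_linear m p_lin 1)) linearZ /= /koszul_d r2 r1 subn1.
  by rewrite Fkm ?rcK ?(lin0 p_lin) ?scaler0 //; case: ht.
have r1 : rho 1 = 1%N by rewrite /Defs.rho /= muln0.
have psi0 v : psi' v = 0.
  rewrite -[v](TAproj1_in1 (scalar_bimodule V)) -phiE; apply: (H 1%N phi F Fg FE Fd).
    (* d = 1 would force l = rho(1) = 1, whereas l >= m >= 2. *)
    by move=> d1; move: rl; rewrite -d1 r1 => l1'; move: m_le_l; rewrite -l1' leqNgt m2.
  rewrite r1; split; first exact: TAdeg_in1.
  by move=> a b e; move: m2; rewrite ltnNge -e addnAC leq_addl.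
by move=> v; rewrite -psiE.
Qed.

End Nondegenerate.

(** * The homological determinant *)

Section HopfKoszulModule.
Variables (k : fieldType) (H A : algType k) (hH : hopf H) (act : module_algebra hH A).
Variables (V : lmodType k) (actV : hmodule H V).
Local Notation sw := (sweedler hH).
Local Notation T := (tensor A (TV V)).
Local Notation "h |> a" := (hact act h a) (at level 45, right associativity).
Local Notation tact := (TVact hH actV).

(* A (x) T(V) again, but as a module over A # H: an element of H acts diagonally on both factors. *)
Definition hkmod of module_algebra hH A & hmodule H V : Type := T.
Local Notation HK := (hkmod act actV).
HB.instance Definition _ := GRing.Zmodule.copy HK T.

Let F (a : A) (h : H) (b : A) (t : TV V) : T :=
  sw (fun h1 h2 => tens (a * (h1 |> b)) (tact h2 t)) h.

Let lt (U : lmodType k) (f : U -> H) t : linear f -> linear (fun x => tact (f x) t).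
Proof. exact: (linear_comp (TVact_linearl hH actV t)). Qed.
Let ltr (U : lmodType k) (f : U -> TV V) h : linear f -> linear (fun x => tact h (f x)).
Proof. exact: (linear_comp (TVact_linear hH actV h)). Qed.

Let bF a h : bilin2 (F a h).
Proof.
split=> [t|b]; apply: sweedler_par => x y; first by lin.
by apply: lin_tensr; apply: ltr; lin.
Qed.

Let Fh a b t : linear (fun h => F a h b t).
Proof.
apply: sweedler_linear; split=> [y|x]; first by lin.
by apply: lin_tensr; apply: lt; lin.
Qed.

Let bG x : bilin2 (fun a h => tlift (F a h) x).
Proof.
split=> [h|a].
- by apply: (tlift_linear_par (f := fun a => F a h)) => b t; apply: sweedler_par => ? ?; lin.
- by apply: (tlift_linear_par (f := fun h => F a h)) => b t; apply: Fh.
Qed.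

Definition hkmod_scale (s : smash act) (x : HK) : HK := tlift (fun a h => tlift (F a h) x) s.

Lemma hkmod_scale_tens a h b t : hkmod_scale (smash_tens act a h) (tens b t) =
  sw (fun h1 h2 => tens (a * (h1 |> b)) (tact h2 t)) h :> T.
Proof. by rewrite /hkmod_scale (tlift_tens _ _ (bG _)) (tlift_tens _ _ (bF _ _)). Qed.

Lemma hkmod_scale_linl x : linear (fun s : smash act => hkmod_scale s x : T).
Proof. exact: (tlift_linear (bG x)). Qed.

Lemma hkmod_scale_linr s : linear (hkmod_scale s : T -> T).
Proof.
apply: (lift_linear_par (f := fun y q => tlift (F q.1 q.2) y)) => q.
exact: (tlift_linear (bF q.1 q.2)).
Qed.

Lemma hkmod_scaleA s s' x : hkmod_scale s (hkmod_scale s' x) = hkmod_scale (s * s') x.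
Proof.
move: s; apply: (tens_eq (Z := T) (f := fun s => hkmod_scale s (hkmod_scale s' x))
                (g := fun s => hkmod_scale (smash_mul s s') x)) => [||a h].
- exact: hkmod_scale_linl.
- exact: (linear_comp (hkmod_scale_linl x) (smash_mul_linl s')).
move: s'; apply: (tens_eq (Z := T) (f := fun s => hkmod_scale (smash_tens act a h) (hkmod_scale s x))
    (g := fun s => hkmod_scale (smash_mul (smash_tens act a h) s) x)) => [||b g].
- exact: (linear_comp (hkmod_scale_linr _) (hkmod_scale_linl x)).
- exact: (linear_comp (hkmod_scale_linl x) (smash_mul_linr _)).
move: x; apply: (tens_eq (Z := T)
    (f := fun x => hkmod_scale (smash_tens act a h) (hkmod_scale (smash_tens act b g) x))
    (g := fun x => hkmod_scale (smash_mul (smash_tens act a h) (smash_tens act b g)) x)) => [||c t].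
- exact: (linear_comp (hkmod_scale_linr _) (hkmod_scale_linr _)).
- exact: hkmod_scale_linr.
rewrite -/(smash_tens act a h) -/(smash_tens act b g) smash_mul_tens hkmod_scale_tens (sweedler_comp hH _ _ (hkmod_scale_linr _)).
rewrite (sweedler_comp (F := fun s => hkmod_scale s (tens c t) : T) hH _ _ (hkmod_scale_linl _)).
pose K h1 h2 h3 g1 g2 : T :=
  tens (a * (h1 |> b) * (h2 |> g1 |> c)) (tact h3 (tact g2 t)).
transitivity (sw (fun g1 g2 => sw (fun h1 h2 =>
    sw (fun h11 h12 => K h11 h12 h2 g1 g2) h1) h) g).
  apply: eq_sweedler => g1 g2; rewrite hkmod_scale_tens; apply: eq_sweedler => h1 h2.
  rewrite ma_mul (sweedler_comp (F := fun s => tens (a * s) (tact h2 (tact g2 t)) : T) hH).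
    by apply: eq_sweedler => h11 h12; rewrite /K !mulrA.
  by lin.
have Klin g1 g2 : trilin (fun h1 h2 h3 => K h1 h2 h3 g1 g2).
  by rewrite /K; split=> ? ?; [lin|lin|apply: lin_tensr; apply: lt; lin].
under eq_sweedler do rewrite (sweedler_coassoc hH _ (Klin _ _)).
rewrite exchange_sweedler; apply: eq_sweedler => h1 h2.
rewrite hkmod_scale_tens sweedlerM; last first.
  by split=> ?; [lin|apply: lin_tensr; apply: lt; lin].
rewrite [LHS]exchange_sweedler; apply: eq_sweedler => h21 h22.
by apply: eq_sweedler => g1 g2; rewrite /K hactM TVact_comp.
Qed.

Lemma hkmod_scale_in0 a b t : hkmod_scale (smash_tens act a 1) (tens b t) = tens (a * b) t :> T.
Proof.
rewrite hkmod_scale_tens sweedler1 ?hact1 ?TVact1 //.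
by split=> ?; [lin|apply: lin_tensr; apply: lt; lin].
Qed.

Lemma hkmod_scale1 : left_id 1 hkmod_scale.
Proof.
apply: (tens_eq (Z := T) (f := fun x => hkmod_scale 1 x) (g := fun x => x)) => [||a t] //.
  exact: hkmod_scale_linr.
by rewrite hkmod_scale_in0 mul1r.
Qed.

Lemma hkmod_scaleDr : right_distributive hkmod_scale +%R.
Proof. by move=> s x y; apply: (linD (hkmod_scale_linr s)). Qed.

Lemma hkmod_scaleDl x : {morph hkmod_scale^~ x : a b / a + b}.
Proof. exact: (linD (hkmod_scale_linl x)). Qed.

HB.instance Definition _ := GRing.Zmodule_isLmodule.Build (smash act) HK
  hkmod_scaleA hkmod_scale1 hkmod_scaleDr hkmod_scaleDl.

Lemma hkmod_restrict a (x : T) : smash_tens act a 1 *: (x : HK) = a *: (x : kmod V A) :> T.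
Proof.
move: x; apply: (tens_eq (Z := T) (f := hkmod_scale (smash_tens act a 1))
  (g := kmod_scale a)) => [||b t].
- exact: hkmod_scale_linr.
- exact: kmod_scale_lin.
by rewrite hkmod_scale_in0 kmod_scale_tens.
Qed.

(** Restriction of scalars along A -> A # H. *)
Definition restr (P : lmodType (smash act)) : Type := P.
HB.instance Definition _ P := GRing.Zmodule.copy (restr P) P.

Lemma smash_in0M a b : smash_tens act a 1 * smash_tens act b 1 = smash_tens act (a * b) 1.
Proof.
rewrite -[LHS]/(smash_mul _ _) smash_mul_tens sweedler1 ?hact1 ?mulr1 //.
by split=> ?; apply: lin_tensl || apply: lin_tensr; lin.
Qed.

Lemma smash_in0_linear h : linear (fun a => smash_tens act a h).
Proof. by rewrite /smash_tens; lin. Qed.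

Lemma smash_tensE a h : smash_tens act a h = smash_tens act a 1 * smash_tens act 1 h.
Proof.
rewrite -[RHS]/(smash_mul _ _) smash_mul_tens sweedler1 ?hact1 ?mulr1 ?mul1r //.
by split=> ?; apply: lin_tensl || apply: lin_tensr; lin.
Qed.

Lemma smash_1h_a1 a h : smash_tens act 1 h * smash_tens act a 1 =
  sw (fun h1 h2 => smash_tens act (h1 |> a) h2) h.
Proof.
rewrite -[LHS]/(smash_mul _ _) smash_mul_tens; apply: eq_sweedler => x y.
by rewrite mul1r mulr1.
Qed.

Definition restr_scale P (a : A) (x : restr P) : restr P := smash_tens act a 1 *: (x : P).

Lemma restr_scaleA P a b (x : restr P) :
  restr_scale a (restr_scale b x) = restr_scale (a * b) x.
Proof. by rewrite /restr_scale scalerA smash_in0M. Qed.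
Lemma restr_scale1 P : left_id 1 (@restr_scale P).
Proof. by move=> x; rewrite /restr_scale [_ *: _]scale1r. Qed.
Lemma restr_scaleDr P : right_distributive (@restr_scale P) +%R.
Proof. by move=> a x y; rewrite /restr_scale scalerDr. Qed.
Lemma restr_scaleDl P (x : restr P) : {morph (@restr_scale P)^~ x : a b / a + b}.
Proof. by move=> a b; rewrite /restr_scale (linD (smash_in0_linear 1)) scalerDl. Qed.

HB.instance Definition _ P := GRing.Zmodule_isLmodule.Build A (restr P)
  (@restr_scaleA P) (@restr_scale1 P) (@restr_scaleDr P) (@restr_scaleDl P).

End HopfKoszulModule.

(** * Homogeneous components of T(V) and ideals generated in one degree *)

Section DegreeProjection.
Variables (k : fieldType) (V : lmodType k).
Local Notation in1 := (TAin1 (scalar_bimodule V) : V -> TV V).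

Definition TVcomp_word n (w : tword (k^o : algType k) V) : TV V :=
  if size w.1 == n then TAword (scalar_bimodule V) w else 0.

Lemma TVcomp_bal n : balanced (scalar_bimodule V) (TVcomp_word n).
Proof.
have [w1 w2 _ _] := TAword_balanced (scalar_bimodule V).
rewrite /TVcomp_word; apply: scalar_balanced => [xs|xs ys c] /=.
  by case: eqP => _; [apply: w1|apply: linear_fun0].
move=> a x x'; rewrite !size_cat /=; case: eqP => _; first exact: w2.
by rewrite scaler0 addr0.
Qed.

Definition TVcomp n (t : TV V) : TV V := Defs.lift (TVcomp_word n) t.

Lemma TVcomp_linear n : linear (TVcomp n).
Proof. exact: lift_linear (TVcomp_bal n). Qed.

Lemma TVcomp_TAword n w : TVcomp n (TAword (scalar_bimodule V) w) = TVcomp_word n w.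
Proof. by rewrite /TVcomp lift_ugen //; apply: TVcomp_bal. Qed.

Lemma TVcomp_id n t : TAdeg n t -> TVcomp n t = t.
Proof.
move=> [s [/allP hs ->]]; rewrite (lin_sum (TVcomp_linear n)) big_seq [RHS]big_seq.
by apply: eq_bigr => w /hs; rewrite TVcomp_TAword /TVcomp_word => ->.
Qed.

Lemma TVcomp_0 n j t : TAdeg j t -> j != n -> TVcomp n t = 0.
Proof.
move=> [s [/allP hs ->]] jn; rewrite (lin_sum (TVcomp_linear n)) big_seq.
by apply: big1 => w /hs /eqP e; rewrite TVcomp_TAword /TVcomp_word e (negPf jn).
Qed.

(** In a product a r b of words with a relation of degree m, the component of degree m vanishes
    unless a and b are scalars. *)
Lemma ideal_gen_deg m (Rel : TV V -> Prop) t : (forall r, Rel r -> TAdeg m r) ->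
  TAdeg m t -> ideal_gen Rel t -> kspan Rel t.
Proof.
move=> Rm dt; rewrite -[X in kspan _ X](TVcomp_id dt).
move: t {dt}; apply: ideal_gen_ind => [|x y _ hx _ hy|a r b Rr].
- by rewrite (lin0 (TVcomp_linear m)); apply: kspan0.
- by rewrite (linD (TVcomp_linear m)); have := kspanL 1 hx hy; rewrite scale1r.
have L c x y : kspan Rel (TVcomp m (x : TV V)) -> kspan Rel (TVcomp m y) ->
    kspan Rel (TVcomp m (c *: x + y)).
  by move=> hx hy; rewrite (TVcomp_linear m); apply: kspanL.
have K0 : kspan Rel (TVcomp m (0 : TV V)).
  by rewrite (lin0 (TVcomp_linear m)); apply: kspan0.
move: a; apply: (univ_ind (P := fun a : TV V => kspan Rel (TVcomp m (a * r * b)))).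
  by rewrite !mul0r.
move=> c v a ha; rewrite !mulrDl -!scalerAl; apply: (L) => // {ha a c}.
move: b; apply: (univ_ind (P := fun b : TV V => kspan Rel (TVcomp m (TAword _ v * r * b)))).
  by rewrite mulr0.
move=> c u b hb; rewrite mulrDr -scalerAr; apply: (L) => // {hb b c}.
have dv : TAdeg (size v.1 + m + size u.1) ((TAword (scalar_bimodule V) v : TV V) * r * TAword _ u).
  by apply: TAdegM (TAdeg_word _ _); apply: TAdegM (TAdeg_word _ _) (Rm _ Rr).
have [e|ne] := eqVneq (size v.1 + m + size u.1)%N m; last first.
  by rewrite (TVcomp_0 dv ne); apply: kspan0.
rewrite (TVcomp_id (t := _ * _ * _)); last by rewrite -[X in TAdeg X]e.
move/eqP: e; rewrite addnAC -{2}[m]add0n eqn_add2r addn_eq0 => /andP[/nilP v0 /nilP u0].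
case: v u v0 u0 {dv} => [vs c] [us c'] /= -> ->.
change (kspan Rel ((TAin0 (scalar_bimodule V) c : TV V) * r * TAin0 (scalar_bimodule V) c')).
rewrite !TV_in0.
rewrite -scalerAr -!scalerAl mul1r mulr1 scalerA -[_ *: r]addr0.
by apply: kspanL; [apply: kspan_gen|apply: kspan0].
Qed.

End DegreeProjection.

(** * Equivariance of the Koszul complex under H *)

Section HopfKoszul.
Variables (k : fieldType) (V : vectType k) (m : nat) (Rel : TV V -> Prop).
Variables (A : algType k) (g : nat -> A -> Prop) (p : TV V -> A).
Hypothesis conn : connected_graded g.
Hypotheses (p_lin : linear p) (pM : forall s t, p (s * t) = p s * p t) (p1 : p 1 = 1).
Hypothesis p_deg : forall n t, TAdeg n t -> g n (p t).
Hypothesis p_ker : forall t, p t = 0 <-> ideal_gen Rel t.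
Hypothesis Rel_deg : forall r, Rel r -> TAdeg m r.
Hypothesis m2 : (2 <= m)%N.
Hypothesis exK : koszul_exact m Rel g p.
Variables (H : algType k) (hH : hopf H) (act : module_algebra hH A) (actV : hmodule H V).
Local Notation in1 := (TAin1 (scalar_bimodule V) : V -> TV V).
Hypothesis pH : forall h v, p (in1 (hact actV h v)) = hact act h (p (in1 v)).
Hypothesis g_sub : forall n h a, g n a -> g n (hact act h a).
Local Notation sw := (sweedler hH).
Local Notation kmod := (kmod V A).
Local Notation kgen := (@kgen k V A).
Local Notation kspace := (koszul_space m Rel).
Local Notation kterm := (koszul_term m Rel).
Local Notation kd := (koszul_d m p : nat -> kmod -> kmod).
Local Notation eps := (augmentation g).
Local Notation kaug := (koszul_aug g : kmod -> k).
Local Notation tact := (TVact hH actV).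
Local Notation HK := (hkmod act actV).
Local Notation "h |> a" := (hact act h a) (at level 45, right associativity).
Local Notation T := (tensor A (TV V)).

Lemma p_equivariant h t : p (tact h t) = h |> p t.
Proof.
have la h' : linear (fun a => h' |> a) := (hact_bilin act).2 h'.
move: t h; apply: TV_spanind => [c x y hx hy h|h|v t IH h].
- by rewrite (TVact_linear hH actV h) !p_lin hx hy la.
- by rewrite TVact_one (linZ p_lin) p1 ma_one.
rewrite TVact_in1M (sweedler_comp hH _ _ p_lin) pM ma_mul.
by apply: eq_sweedler => a b; rewrite pM pH IH.
Qed.

Lemma kspan_sweedler (U : lmodType k) (P : U -> Prop) (f : H -> H -> U) h :
  (forall a b, kspan P (f a b)) -> kspan P (sw f h).
Proof.
apply: sweedler_ind => [|x y hx hy|c x hx]; first exact: kspan0.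
  by have := kspanL 1 hx hy; rewrite scale1r.
by rewrite -[_ *: _]addr0; apply: kspanL => //; apply: kspan0.
Qed.

(** Since p is equivariant, h r lies in its kernel, the ideal of relations; having degree m, it is
    in the span of the relations. *)
Lemma Rel_stable h r : Rel r -> kspan Rel (tact h r).
Proof.
move=> Rr; apply: (ideal_gen_deg Rel_deg); first exact/TVact_deg/Rel_deg.
apply/p_ker; rewrite p_equivariant.
have -> : p r = 0.
  by apply/p_ker; rewrite -[r]mul1r -[1 * r]mulr1; apply: ideal_genM.
exact: lin0 ((hact_bilin act).2 h).
Qed.

Lemma rel_space_stable a b h t : rel_space Rel a b t -> rel_space Rel a b (tact h t).
Proof.
apply: (kspan_ind (Q := fun t => rel_space Rel a b (tact h t))) => [|c x y hx hy|].
- by rewrite (lin0 (TVact_linear hH actV h)); apply: kspan0.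
- by rewrite (TVact_linear hH actV h); apply: kspanL.
move=> _ [x [r [y [dx Rr dy ->]]]]; rewrite TVactM; apply: kspan_sweedler => h1 h2.
rewrite TVactM (sweedler_comp (F := fun u => u * tact h2 y) hH); last by apply: mulr_linear.
apply: kspan_sweedler => h3 h4.
move: (tact h4 r) (Rel_stable h4 Rr).
apply: (kspan_ind (Q := fun r => rel_space Rel a b (tact h3 x * r * tact h2 y))).
- by rewrite mulr0 mul0r; apply: kspan0.
- by move=> c u v hu hv; rewrite mulrDr mulrDl -scalerAr -scalerAl; apply: kspanL.
move=> u Ru; apply: kspan_gen; exists (tact h3 x), u, (tact h2 y).
by split=> //; apply: TVact_deg.
Qed.

Lemma kspace_stable n h t : kspace n t -> kspace n (tact h t).
Proof.
by move=> [dt ht]; split; [apply: TVact_deg|move=> a b /ht; apply: rel_space_stable].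
Qed.

Lemma hkmod_scale_gen a h b t :
  smash_tens act a h *: (b *: kgen t : HK) = sw (fun h1 h2 => (a * (h1 |> b)) *: kgen (tact h2 t)) h :> T.
Proof.
rewrite -kmodE [LHS]hkmod_scale_tens; apply: eq_sweedler => x y.
by rewrite -kmodE.
Qed.

Lemma hkmod_scale_smash (P : T -> Prop) (s : smash act) (x : HK) :
  P 0 -> (forall x y, P x -> P y -> P (x + y)) -> (forall (c : k) x, P x -> P (c *: x)) ->
  (forall a h, P (smash_tens act a h *: x)) -> P (s *: x).
Proof.
move=> P0 PD PZ PG; move: s; apply: (univ_ind (P := fun s : smash act => P (s *: x : HK))).
  by rewrite scale0r.
move=> c [a h] s hs; rewrite scalerDl; apply: (PD) => //.
rewrite [X in P X](linZ (hkmod_scale_linl x)); exact/PZ/PG.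
Qed.

Lemma ktermZk i (c : k) (x : T) : kterm i x -> kterm i (c *: x).
Proof. by move=> hx; rewrite -[_ *: _]addr0; apply: kspanL => //; apply: kspan0. Qed.

Lemma kterm_smash i (s : smash act) (x : HK) : kterm i x -> kterm i (s *: x : HK).
Proof.
move=> hx; apply: hkmod_scale_smash => [|y z|c y|a h].
- exact: kspan0.
- exact: ktermD.
- exact: ktermZk.
move: x hx; apply: kterm_ind => [|x y hx hy|b t ht].
- by rewrite scaler0; apply: kspan0.
- by rewrite [_ *: _]scalerDr; apply: ktermD.
rewrite hkmod_scale_gen; apply: kspan_sweedler => h1 h2.
exact/kterm_gen/kspace_stable.
Qed.

(** The differential moves letters from T(V) into A through the equivariant map p, and H acts
    diagonally on both factors; coassociativity matches the two groupings of the Sweedler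
    factors. *)
Lemma koszul_map_smash r a h b (x t : TV V) : TAdeg r x ->
  koszul_map p r (smash_tens act a h *: (b *: kgen (x * t) : HK)) =
  smash_tens act a h *: ((b * p x) *: kgen t : HK) :> T.
Proof.
move=> dx; have lkT : linear (koszul_map p r : T -> T) := koszul_map_linear p_lin r.
rewrite !hkmod_scale_gen (sweedler_comp hH _ _ lkT).
have la h' : linear (fun a => h' |> a) := (hact_bilin act).2 h'.
pose K h1 h2 h3 : T := tens (a * (h1 |> b) * p (tact h2 x)) (tact h3 t).
have lt1 (u : TV V) : linear (fun h => tact h u) := TVact_linearl hH actV u.
transitivity (sw (fun h1 h2 => sw (fun h21 h22 => K h1 h21 h22) h2) h).
  apply: eq_sweedler => h1 h2; rewrite -kmodE TVactM.
  have lT : linear (fun u => koszul_map p r (tens (a * (h1 |> b)) u) : T).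
    by apply: (linear_comp lkT); lin.
  rewrite (sweedler_comp hH _ _ lT); apply: eq_sweedler => h3 h4.
  by rewrite koszul_mapM //; apply: TVact_deg.
rewrite -sweedler_coassoc; last first.
  split=> [h2 h3|h1 h3|h1 h2]; rewrite /K.
  - by lin.
  - by apply: lin_tensl; apply: lin_mull; apply: (linear_comp p_lin).
  - exact: lin_tensr.
apply: eq_sweedler => h1 h2; rewrite -kmodE ma_mul.
rewrite (sweedler_comp (F := fun u => tens (a * u) (tact h2 t) : T) hH); last by lin.
by apply: eq_sweedler => h3 h4; rewrite /K p_equivariant mulrA.
Qed.

Lemma kd_smash i (s : smash act) (x : HK) : kterm i.+1 x ->
  kd i (s *: x : HK) = s *: (kd i x : HK) :> T.
Proof.
move=> hx; have lkT : linear (kd i : T -> T) := koszul_map_linear p_lin _.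
move: s; apply: (tens_eq (Z := T) (f := fun s => kd i (hkmod_scale s x))
  (g := fun s => hkmod_scale (s : smash act) (kd i x : HK))) => [||a h].
- exact: (linear_comp lkT (hkmod_scale_linl x)).
- exact: hkmod_scale_linl.
have lkH : linear (hkmod_scale (smash_tens act a h) : T -> T) := hkmod_scale_linr actV _.
move: x hx; apply: kterm_ind => [|x y hx hy|b t ht].
- by rewrite (lin0 lkH) (lin0 lkT) (lin0 lkH).
- by rewrite (linD lkH) !(linD lkT) (linD lkH) hx hy.
have := ht; rewrite {1}(rhoS m2) => ht'; have [s [s1 s2 st]] := kspace_split ht'.
have lb : linear (fun t : TV V => (b *: kgen t : T)).
  by move=> c u v; rewrite -!kmodE tensDr tensZr.
rewrite st (lin_sum lb) (lin_sum lkH) !(lin_sum lkT) (lin_sum lkH) big_seq [RHS]big_seq.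
apply: eq_bigr => q /s1 dq; rewrite [LHS]koszul_map_smash //; congr hkmod_scale.
by rewrite -kmodE -[RHS]/(koszul_map p _ _) -[X in koszul_map _ _ X]kmodE koszul_mapM // kmodE.
Qed.

Lemma eps_hact h a : eps (h |> a) = counit hH h * eps a.
Proof.
have le := augmentation_linear conn; have la := (hact_bilin act).2 h.
move: a; apply: (cg_ind conn) => [x y hx hy||c x hx|n x gx].
- by rewrite (linD la) !(linD le) hx hy -mulrDr.
- by rewrite ma_one (linZ le).
- by rewrite (linZ la) !(linZ le) hx /GRing.scale /= mulrCA.
- by rewrite (augmentation_pos conn gx) mulr0 (augmentation_pos conn (g_sub h gx)).
Qed.

Lemma TAproj0_tact h t : TAproj0 (tact h t) = counit hH h * TAproj0 t.
Proof.
have lp := TAproj0_linear (B := scalar_bimodule V).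
move: t; apply: TV_lineq => [|||v t _].
- exact: (linear_comp lp (TVact_linear _ _ h)).
- exact: lin_mulkl.
- by rewrite TVact_one -!TAin0_1 (linZ lp) TAproj0_in0.
rewrite TAproj0_in1M mulr0 TVact_in1M (sweedler_comp hH _ _ lp).
rewrite /sweedler /tlift /Defs.lift /lsum big1 // => q _.
by rewrite TAproj0_in1M scaler0.
Qed.

Lemma kaug_smash (s : smash act) (x : HK) : kaug (s *: x : HK) = smash_aug g s * kaug x.
Proof.
have bs : bilin2 (fun (a : A) h => eps a * counit hH h : k^o).
  split=> [h|a]; first exact/lin_mulkr/(augmentation_linear conn).
  by apply: lin_mulkl; exact: linearP.
have ls : linear (smash_aug g (act := act) : tensor A H -> k^o) := tlift_linear bs.
move: s; apply: (tens_eq (Z := k^o) (f := fun s => kaug (hkmod_scale s x))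
  (g := fun s => smash_aug g (s : smash act) * kaug x : k^o)) => [||a h].
- exact: (linear_comp (kaug_linear conn) (hkmod_scale_linl x)).
- exact: lin_mulkr.
rewrite [smash_aug g _](tlift_tens a h bs).
move: x; apply: (tens_eq (Z := k^o) (f := fun x => kaug (hkmod_scale (smash_tens act a h) x))
  (g := fun x => eps a * counit hH h * kaug x : k^o)) => [||b t].
- exact: (linear_comp (kaug_linear conn) (hkmod_scale_linr actV _)).
- exact/lin_mulkl/(kaug_linear conn).
rewrite hkmod_scale_tens (sweedler_comp hH _ _ (kaug_linear conn)) kaug_tens //.
have -> : eps a * counit hH h * (eps b * TAproj0 t) =
    sw (fun h1 h2 => counit hH h1 *: (eps a * eps b * (counit hH h2 * TAproj0 t) : k^o)) h.
  rewrite (sw_counitl hH (F := fun h2 => eps a * eps b * (counit hH h2 * TAproj0 t) : k^o)).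
    by rewrite -!mulrA; congr (_ * _); rewrite mulrCA.
  by apply: lin_mulkl; apply: lin_mulkr; exact: linearP.
apply: eq_sweedler => h1 h2; rewrite kaug_tens // augmentationM // eps_hact TAproj0_tact.
by rewrite {2}/GRing.scale /= -!mulrA; rewrite [RHS]mulrCA.
Qed.

Lemma kred_smash h (x : HK) : kred g (smash_tens act 1 h *: x : HK) = tact h (kred g x).
Proof.
have lr := kred_linear (V := V) conn.
move: x; apply: (tens_eq (Z := TV V) (f := fun x => kred g (hkmod_scale (smash_tens act 1 h) x))
  (g := fun x => tact h (kred g x))) => [||b t].
- exact: (linear_comp lr (hkmod_scale_linr actV _)).
- exact: (linear_comp (TVact_linear _ _ h) lr).
rewrite hkmod_scale_tens (sweedler_comp hH _ _ lr) kred_tens // (linZ (TVact_linear _ _ h)).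
rewrite -[in RHS](sw_counitl hH (F := fun h => tact h t) h); last exact: TVact_linearl.
rewrite sw_scale; apply: eq_sweedler => h1 h2.
by rewrite kred_tens // mul1r eps_hact scalerA mulrC.
Qed.

End HopfKoszul.

(** * Identification of the character of H on Ext^d with its action on w *)

Section HomologicalDeterminantSuperpotential.
Variables (k : fieldType) (V : vectType k) (m d : nat) (Rel : TV V -> Prop).
Variables (A : algType k) (g : nat -> A -> Prop) (p : TV V -> A).
Hypothesis conn : connected_graded g.
Hypotheses (p_lin : linear p) (pM : forall s t, p (s * t) = p s * p t) (p1 : p 1 = 1).
Hypothesis p_deg : forall n t, TAdeg n t -> g n (p t).
Hypothesis p_ker : forall t, p t = 0 <-> ideal_gen Rel t.
Hypothesis Rel_deg : forall r, Rel r -> TAdeg m r.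
Hypothesis m2 : (2 <= m)%N.
Hypothesis exK : koszul_exact m Rel g p.
Variables (H : algType k) (hH : hopf H) (act : module_algebra hH A) (actV : hmodule H V).
Local Notation in1 := (TAin1 (scalar_bimodule V) : V -> TV V).
Hypothesis pH : forall h v, p (in1 (hact actV h v)) = hact act h (p (in1 v)).
Hypothesis g_sub : forall n h a, g n a -> g n (hact act h a).
Local Notation S := (antipode hH).
Local Notation kmod := (kmod V A).
Local Notation kgen := (@kgen k V A).
Local Notation rho := (rho m).
Local Notation kspace := (koszul_space m Rel).
Local Notation kterm := (koszul_term m Rel).
Local Notation kd := (koszul_d m p : nat -> kmod -> kmod).
Local Notation eps := (augmentation g).
Local Notation kaug := (koszul_aug g : kmod -> k).
Local Notation tact := (TVact hH actV).
Local Notation HK := (hkmod act actV).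
Local Notation T := (tensor A (TV V)).

Variable R : proj_resolution (triv_act (smash_aug g (act := act))).

Lemma smash_aug_tens a h : smash_aug g (smash_tens act a h) = eps a * counit hH h.
Proof.
apply: (tlift_tens (Z := k^o) (f := fun a h => eps a * counit hH h)).
split=> [h'|a']; first exact/lin_mulkr/(augmentation_linear conn).
by apply: lin_mulkl; exact: linearP.
Qed.

(** The maps are asymmetric: the terms of R are projective over A # H, so h is A # H-linear, whereas
    f is built from the A-freeness of the Koszul terms and is only A-linear. Minimality is a
    statement over A, and the action of H is read off through h. *)
Lemma equivariant_comparison : exists (f : forall i, {linear kmod -> restr (pr_mod R i)})
  (h : forall i, {linear pr_mod R i -> HK}),
  [/\ forall i x, kterm i.+1 x -> pr_d R i (f i.+1 x) = f i (kd i x),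
      forall i x, kterm i (h i x), forall i x, kd i (h i.+1 x) = h i (pr_d R i x) &
      forall i t, kspace (rho i) t -> kred g (h i (f i (kgen t))) = t].
Proof.
have [h [hK ha hd]] : exists h : forall i, {linear pr_mod R i -> HK},
  [/\ forall i x, kterm i (h i x), forall x, kaug (h 0%N x) = pr_aug x &
      forall i x, kd i (h i.+1 x) = h i (pr_d R i x)].
  apply: (@map_to_exact _ _ _ R HK (fun i x => kterm i x) kd kaug).
  - exact: kterm0.
  - move=> i b x y hx hy; apply: ktermD => //.
    exact: (kterm_smash p_lin pM p1 p_ker Rel_deg pH).
  - by move=> i; apply: lin0 (kd_linear m p_lin i).
  - move=> i b x y hx hy; rewrite -(kd_smash p_lin pM p1 m2 pH b hx).
    exact: (linD (koszul_map_linear p_lin _)).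
  - exact: kaugD conn.
  - exact: (kaug_smash conn g_sub).
  - exists (kgen 1).
      apply: kterm_gen1; rewrite rho0; split; first exact: (TAdeg_in0 _ 1).
      by move=> a b; have := m2; case: (m) => // n _; rewrite addnS addSn.
    by rewrite kaug_gen // -TAin0_1 TAproj0_in0.
  - move=> c y hy; exists (c *: (y : T)); first exact: ktermZk.
    exact: (linZ (kaug_linear conn)).
  - exact: kexact0 exK.
  - exact: kexactS exK.
have [f [_ fa fd]] : exists f : forall i, {linear kmod -> restr (pr_mod R i)},
  [/\ forall i t, kspace (rho i) t -> True,
      forall x, kterm 0 x -> pr_aug (f 0%N x : pr_mod R 0) = kaug x &
      forall i x, kterm i.+1 x -> pr_d R i (f i.+1 x) = f i (kd i x)].
  apply: (map_from_koszul conn p_lin p_deg m2 exK (P := fun i => restr (pr_mod R i))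
    (d := pr_d R) (aug := @pr_aug _ _ _ R) (E := fun _ _ => True)) => //.
  - by move=> i a x y; rewrite [LHS]linearP.
  - exact: pr_augD.
  - move=> a x; rewrite [LHS](pr_augZ (p := R)) /triv_act smash_aug_tens.
    by rewrite counit1 mulr1.
  - by have [y ey] := pr_aug_surj R 1; exists y.
  - move=> s _ s0; have [X _] := pr_exact0 (p := R) (\sum_(q <- s) q.1 *: q.2 : restr _).
    by have [y ->] := X s0; exists y.
  - move=> i s _ s0; have [X _] := pr_exact (p := R) (\sum_(q <- s) q.1 *: q.2 : restr _).
    by have [y ->] := X s0; exists y.
exists f, h; split=> //.
apply: (koszul_endo_id conn p_lin p_deg m2 exK (u := fun i x => h i (f i x) : kmod)).
- move=> i a x y; rewrite linearP [h i _]linearP; congr (_ + _).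
  exact: hkmod_restrict.
- by move=> i x _.
- by move=> x hx; rewrite ha fa.
- by move=> i x hx; rewrite hd fd.
Qed.

(** Evaluating a cocycle at the H-translates of y = f(w) depends only on its class. A cocycle dual
    to w takes the values chi(b) there, and comparison with the generator e of Ext^d gives chi o S =
    eta, the S coming from the action on cochains. *)
Lemma ext_character_superpotential (eta chi : H -> k) w :
  acts_on_ext R d eta -> kspace (rho d) w -> w != 0 ->
  (forall h, tact h w = chi h *: w) -> forall h, chi (S h) = eta h.
Proof.
move=> [e [[[eD eZ] ec] _ eE eta_e]] hw w0 chiE h0.
have [f [h [fd hK hd hf]]] := equivariant_comparison.
have [psi psiw] := TV_separate hw.1 w0.
pose y : pr_mod R d := f d (kgen w).
(* Coboundaries vanish at y and at its H-translates, as d y lies in A_+ P. *)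
have cob0 th b : hom_coboundary (R := R) (i := d) th ->
    th (smash_tens act 1 b *: y) = 0.
  rewrite /y; case: (d) th hw => [|j] th hw; first by move=> ->.
  move=> [th' [[thD thZ] ->]]; rewrite linearZ /= fd; last exact: kterm_gen1.
  have th0 : th' 0 = 0 by apply: (addrI (th' 0)); rewrite -thD !addr0.
  apply: (kd_minimal conn p_lin p_deg m2 (Rel := Rel) (Y := restr (pr_mod R j)) (f := f j)
    (P := fun x => th' (smash_tens act 1 b *: (x : pr_mod R j)) = 0)) => //.
  - exact: linearP.
  - by rewrite [_ *: _]scaler0.
  - by move=> u v hu hv; rewrite [_ *: _]scalerDr thD hu hv addr0.
  (* b a = (b_1 . a) b_2 in A # H, and b_1 . a stays in A_+ because H preserves degrees. *)
  - move=> n a u ga; rewrite [_ *: _]scalerA smash_1h_a1.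
    have scb : forall s : smash act, th' (s *: u) = 0 -> forall c, th' ((c *: s) *: u) = 0.
      move=> s hs c; rewrite -[s]mul1r scalerAl -scalerA.
      have -> : c *: (1 : smash act) = smash_tens act (c *: 1) 1 by rewrite /smash_tens tensZl.
      by rewrite thZ hs mulr0.
    apply: (@sweedler_ind _ _ hH _ (fun s : smash act => th' (s *: u) = 0)) => //.
    + by rewrite scale0r.
    + by move=> s s' hs hs'; rewrite scalerDl thD hs hs' addr0.
    + by move=> c s /scb.
    move=> b1 b2; rewrite smash_tensE -scalerA thZ.
    by rewrite (augmentation_pos conn (g_sub b1 ga)) mul0r.
  exact: (kterm_gen1 A hw).
have one_y : smash_tens act 1 1 *: y = y by apply: scale1r.
(* The cocycle dual to w, normalised by psi(w); as h is A # H-linear, its value at b y is chi(b). *)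
pose th (x : pr_mod R d) : k := psi (kred g (h d x)) / psi w.
have thc : hom_cocycle (R := R) th.
  split; last first.
    move=> x; rewrite /th -hd (kred_kd conn p_lin p_deg m2 (Rel := Rel) (f := id)) //.
    by rewrite linear0 mul0r.
  split=> [x z|a x]; rewrite /th.
    by rewrite !linearD (kredD conn) linearD mulrDl.
  rewrite linearZ /=.
  have -> : kred g (smash_tens act a 1 *: h d x) = eps a *: kred g (h d x).
    by rewrite [X in kred g X]hkmod_restrict kredZ.
  by rewrite linearZ /= mulrA.
have [c cE] := eE _ thc.
have thy b : th (smash_tens act 1 b *: y) = chi b.
  rewrite /th linearZ /= (kred_smash conn g_sub) hf // chiE linearZ /=.
  by rewrite /GRing.scale /= mulfK.
have E b : chi b = c * e (smash_tens act 1 b *: y).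
  by apply/eqP; rewrite -subr_eq0 -thy; apply/eqP; apply: cob0 cE.
have chi1 : chi 1 = 1.
  have := chiE 1; rewrite TVact1 => /eqP; rewrite -{1}[w]scale1r -subr_eq0 -scalerBl.
  by rewrite scaler_eq0 (negPf w0) orbF subr_eq0 => /eqP.
have cy : c * e y = 1 by rewrite -{1}one_y -E.
have := cob0 _ 1 (eta_e h0); rewrite one_y /hom_act => /eqP; rewrite subr_eq0 => /eqP ey.
by rewrite E ey mulrCA cy mulr1.
Qed.

End HomologicalDeterminantSuperpotential.

(** * The twist *)

Section TwistRelation.
Variables (k : fieldType) (V : vectType k) (sigma : 'End(V)) (l : nat) (w : TV V).
Variables (H : algType k) (hH : hopf H) (actV : hmodule H V) (chi : H -> k^o).
Local Notation sw := (sweedler hH).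
Local Notation S := (antipode hH).
Local Notation in1 := (TAin1 (scalar_bimodule V) : V -> TV V).
Local Notation lc := (lcontract (B := scalar_bimodule V)).
Local Notation rc := (rcontract (B := scalar_bimodule V)).
Local Notation e := (vbasis {:V}).
Local Notation tact := (TVact hH actV).
Local Notation "h |> v" := (hact actV h v) (at level 45, right associativity).
Hypothesis SS : forall h, S (S h) = h.
Hypothesis l_gt0 : (0 < l)%N.
Hypothesis wS : superpotential l sigma w.
Hypothesis w_ndeg : forall psi : V -> k^o, linear psi -> lc psi w = 0 -> forall v, psi v = 0.
Hypothesis chi_lin : linear chi.
Hypothesis chiE : forall h, tact h w = (chi h : k) *: w.

(* This is lcontract psi w for linear psi (wcontractE), but here linearity in psi is visible. *)
Definition wcontract (psi : V -> k^o) : TV V :=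
  \sum_(i < \dim {:V}) (psi e`_i : k) *: dcontract i w.
Local Notation c := wcontract.

Let sl : linear sigma. Proof. exact: linearP. Qed.
Let dw : TAdeg l.-1.+1 w. Proof. by rewrite prednK //; case: wS. Qed.

Lemma wcontractE psi : linear psi -> c psi = lc psi w.
Proof. by move=> lpsi; rewrite TVlc_expand. Qed.

Lemma superpotential_first : w = \sum_(i < \dim {:V}) in1 e`_i * dcontract i w.
Proof. exact: TVexpand dw. Qed.

Lemma superpotential_last : w = \sum_(i < \dim {:V}) dcontract i w * in1 (sigma e`_i).
Proof.
have lt : linear (fun t => on_last sigma (theta t)) :=
  linear_comp (on_last_linear sl) (@theta_linear _ _).
have [_ {1}<-] := wS; rewrite {1}superpotential_first (lin_sum lt); apply: eq_bigr => i _.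
exact: rotate_in1M.
Qed.

Lemma wcontract_lin (U : lmodType k) (psi : U -> V -> k^o) :
  (forall v, linear (fun x => psi x v)) -> linear (fun x => c (psi x)).
Proof. by move=> lpsi; apply: lin_sumr => i; apply: lin_scalel. Qed.

Lemma wcontract_last psi h : linear psi ->
  sw (fun a b => tact a (c (fun v => psi (b |> sigma v)))) h = (chi h : k) *: c (fun v => psi (sigma v)).
Proof.
move=> lpsi; have lr := TVrc_linear lpsi; have la := TVact_linear hH actV.
transitivity (rc psi (tact h w)).
  rewrite {1}superpotential_last (lin_sum (la h)) (lin_sum lr).
  rewrite /wcontract.
  transitivity (sw (fun a b => \sum_(i < \dim {:V}) (psi (b |> sigma e`_i) : k) *: tact a (dcontract i w)) h).
    apply: eq_sweedler => a b; rewrite (lin_sum (la a)); apply: eq_bigr => i _.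
    by rewrite (linZ (la a)).
  rewrite sw_sum; apply: eq_bigr => i _; rewrite TVactM (sweedler_comp hH _ _ lr).
  by apply: eq_sweedler => a b; rewrite TVact_in1 TVrc_Min1.
rewrite chiE (linZ lr); congr (_ *: _); rewrite {1}superpotential_last (lin_sum lr).
by apply: eq_bigr => i _; rewrite TVrc_Min1.
Qed.

Lemma wcontract_first psi h : linear psi ->
  sw (fun a b => tact b (c (fun v => psi (sigma (a |> v))))) h = (chi h : k) *: c (fun v => psi (sigma v)).
Proof.
move=> lpsi; have lr := TVrc_linear lpsi; have la := TVact_linear hH actV.
have lt : linear (fun t => rc psi (on_last sigma (theta t))).
  exact: (linear_comp lr (linear_comp (on_last_linear sl) (@theta_linear _ _))).
transitivity (rc psi (on_last sigma (theta (tact h w)))).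
  rewrite {1}superpotential_first (lin_sum (la h)) [RHS](lin_sum lt).
  rewrite /wcontract.
  transitivity (sw (fun a b => \sum_(i < \dim {:V}) (psi (sigma (a |> e`_i)) : k) *: tact b (dcontract i w)) h).
    apply: eq_sweedler => a b; rewrite (lin_sum (la b)); apply: eq_bigr => i _.
    by rewrite (linZ (la b)).
  rewrite sw_sum; apply: eq_bigr => i _; rewrite TVact_in1M (sweedler_comp hH _ _ lt).
  by apply: eq_sweedler => a b; rewrite rotate_in1M // TVrc_Min1.
rewrite chiE [LHS](linZ lt); congr (_ *: _); have [_ ->] := wS.
by rewrite {1}superpotential_last (lin_sum lr); apply: eq_bigr => i _; rewrite TVrc_Min1.
Qed.

(** Solves [wcontract_last] for the contraction by psi(h sigma(-)): applying S(h_1) to that formula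
    for h_2 cancels the action on the contracted element. *)
Lemma wcontract_actr psi h : linear psi ->
  c (fun v => psi (h |> sigma v)) =
  sw (fun a b => (chi b : k) *: tact (S a) (c (fun v => psi (sigma v)))) h.
Proof.
move=> lpsi; have la := TVact_linear hH actV.
have lcb : linear (fun b : H => c (fun v => psi (b |> sigma v))).
  by apply: wcontract_lin => v; apply: (linear_comp lpsi); lin.
transitivity (sw (fun a b => sw (fun b1 b2 =>
    tact (S a * b1) (c (fun v => psi (b2 |> sigma v)))) b) h); last first.
  apply: eq_sweedler => a b; rewrite -(linZ (la _)) -wcontract_last //.
  rewrite (sweedler_comp hH _ _ (la (S a))); apply: eq_sweedler => b1 b2.
  by rewrite TVact_comp.
rewrite -(sweedler_coassoc hH (f := fun a b1 b2 =>
   tact (S a * b1) (c (fun v => psi (b2 |> sigma v))))); last first.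
  split=> [b d|a d|a b]; last exact: (linear_comp (la _) lcb).
    by apply: (linear_comp (TVact_linearl hH actV _)); lin.
  by apply: (linear_comp (TVact_linearl hH actV _)); lin.
rewrite -[LHS](sw_counitl hH (F := fun b => c (fun v => psi (b |> sigma v))) h) //.
apply: eq_sweedler => a b.
rewrite -(sweedler_comp (F := fun x => tact x (c (fun v => psi (b |> sigma v)))) hH (fun a1 a2 => S a1 * a2)).
  by rewrite sw_antipodel [RHS](linZ (TVact_linearl hH actV _)) TVact1.
exact: TVact_linearl.
Qed.

(** Mirror of [wcontract_actr], starting from [wcontract_first]. The product that cancels now has
    the shape S(h_2) h_1, so S^2 = id enters. *)
Lemma wcontract_actl psi h : linear psi ->
  c (fun v => psi (sigma (h |> v))) =
  sw (fun a b => (chi a : k) *: tact (S b) (c (fun v => psi (sigma v)))) h.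
Proof.
move=> lpsi; have la := TVact_linear hH actV.
have lcb : linear (fun b : H => c (fun v => psi (sigma (b |> v)))).
  by apply: wcontract_lin => v; apply: (linear_comp lpsi); apply: (linear_comp sl); lin.
transitivity (sw (fun a b => sw (fun a1 a2 =>
    tact (S b * a2) (c (fun v => psi (sigma (a1 |> v))))) a) h); last first.
  apply: eq_sweedler => a b; rewrite -(linZ (la _)) -wcontract_first //.
  rewrite (sweedler_comp hH _ _ (la (S b))); apply: eq_sweedler => b1 b2.
  by rewrite TVact_comp.
rewrite (sweedler_coassoc hH (f := fun a1 a2 b =>
   tact (S b * a2) (c (fun v => psi (sigma (a1 |> v)))))); last first.
  split=> [b d|a d|a b]; first exact: (linear_comp (la _) lcb).
    by apply: (linear_comp (TVact_linearl hH actV _)); lin.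
  by apply: (linear_comp (TVact_linearl hH actV _)); lin.
rewrite -[LHS](sw_counitr hH (F := fun b => c (fun v => psi (sigma (b |> v)))) h) //.
apply: eq_sweedler => a b.
rewrite -(sweedler_comp (F := fun x => tact x (c (fun v => psi (sigma (a |> v))))) hH (fun b1 b2 => S b2 * b1)).
  by rewrite sw_antipodel_op // [RHS](linZ (TVact_linearl hH actV _)) TVact1.
exact: TVact_linearl.
Qed.

(** Contracting w by psi applied to either side gives chi(h_1) chi(h_3) S(h_2) acting on the same
    contraction of w; nondegeneracy of w then removes the contraction. *)
Lemma twist_commutes h v :
  sw (fun a b => (chi b : k) *: sigma (a |> v)) h = sw (fun a b => (chi a : k) *: (b |> sigma v)) h.
Proof.
pose X v := sw (fun a b => (chi b : k) *: sigma (a |> v)) h.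
pose Y v := sw (fun a b => (chi a : k) *: (b |> sigma v)) h.
have lX : linear X.
  by apply: sweedler_par => a b; apply: lin_scaler; apply: (linear_comp sl); lin.
have lY : linear Y.
  by apply: sweedler_par => a b; apply: lin_scaler; lin.
suff XY i : forall v, coord e i (X v) - coord e i (Y v) = 0 :> k.
  rewrite -/(X v) -/(Y v) (coord_vbasis (memvf (X v))) (coord_vbasis (memvf (Y v))).
  by apply: eq_bigr => i _; congr (_ *: _); apply/eqP; rewrite -subr_eq0 XY.
pose psi := (fun v => coord e i v : k^o).
have lpsi : linear psi := coordV_linear i.
have lXY : linear (fun v => coord e i (X v) - coord e i (Y v) : k^o).
  apply: lin_add; first exact: (linear_comp lpsi lX).
  exact/lin_opp/(linear_comp lpsi lY).
apply: (w_ndeg lXY); rewrite -wcontractE //.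
have cD : c (fun v => coord e i (X v) - coord e i (Y v)) =
    c (fun v => psi (X v)) - c (fun v => psi (Y v)).
  by rewrite /wcontract -sumrB; apply: eq_bigr => j _; rewrite scalerBl.
have csw (f : H -> H -> V -> V) : c (fun v => psi (sw (fun a b => f a b v) h)) =
    sw (fun a b => c (fun v => psi (f a b v))) h.
  rewrite /wcontract sw_sum; apply: eq_bigr => j _; rewrite (sweedler_comp hH _ _ lpsi).
  have l1 : linear (fun x : k^o => (x : k) *: dcontract j w).
    by move=> a x y; rewrite scalerDl scalerA.
  by rewrite (sweedler_comp hH _ _ l1).
have cZ x (f : V -> V) : c (fun v => psi ((x : k) *: f v)) = x *: c (fun v => psi (f v)).
  rewrite /wcontract scaler_sumr; apply: eq_bigr => j _.
  by rewrite (linZ lpsi) scalerA.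
rewrite cD !csw; apply/eqP; rewrite subr_eq0; apply/eqP.
transitivity (sw (fun a b => sw (fun a1 a2 =>
   (chi b : k) *: ((chi a1 : k) *: tact (S a2) (c (fun v => psi (sigma v))))) a) h).
  by apply: eq_sweedler => a b; rewrite cZ wcontract_actl // sw_scale.
rewrite (sweedler_coassoc hH (f := fun a1 a2 b =>
   (chi b : k) *: ((chi a1 : k) *: tact (S a2) (c (fun v => psi (sigma v)))))).
  apply: eq_sweedler => a b; rewrite cZ wcontract_actr // sw_scale.
  by apply: eq_sweedler => b1 b2; rewrite !scalerA mulrC.
split=> [b d|a d|a b]; last exact: (lin_scalel _ chi_lin).
  exact: lin_scaler (lin_scalel _ chi_lin).
do 2 apply: lin_scaler.
by apply: (linear_comp (TVact_linearl hH actV _)); lin.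
Qed.

End TwistRelation.

(** * Existence and uniqueness of the one-sided duals R psi and L psi *)

Section TraceDuals.
Variables (k : fieldType) (H : falgType k) (hH : hopf H) (Tr : {linear H -> k^o}).
Hypotheses (ss : semisimple_hopf hH) (TrP : is_trace hH Tr).
Variables (M : lmodType k) (B : bimodule H M).

Lemma RpsiP (psi : M -> k^o) : linear psi ->
  [/\ linear (Rpsi B Tr psi), forall x h, Rpsi B Tr psi (ract B x h) = Rpsi B Tr psi x * h &
      forall x, Tr (Rpsi B Tr psi x) = psi x].
Proof.
move=> lpsi; have [r1 r2] := ract_bilin B.
have /choice [f fE] x := trace_repr TrP (linear_comp lpsi (r2 x)).
have lf : linear f.
  move=> c x y; apply: (trace_inj TrP) => h.
  by rewrite mulrDl -scalerAl linearD linearZ /= !fE r1 lpsi.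
have H0 : [set f : M -> H | [/\ linear f, forall x h, f (ract B x h) = f x * h &
    forall x, Tr (f x) = psi x]]%classic f.
  split=> // [x h|x].
    by apply: (trace_inj TrP) => g; rewrite fE -ractM -mulrA fE.
  by rewrite -[f x]mulr1 fE ract1.
exact: (xgetI (fun _ => 0) H0).
Qed.

(** The value at x represents h |-> psi(h x) as Tr(a h), which by itself is adapted to right
    linearity; the symmetry of the trace turns it into left linearity. *)
Lemma LpsiP (psi : M -> k^o) : linear psi ->
  [/\ linear (Lpsi B Tr psi), forall h x, Lpsi B Tr psi (lact B h x) = h * Lpsi B Tr psi x &
      forall x, Tr (Lpsi B Tr psi x) = psi x].
Proof.
move=> lpsi; have [r1 r2] := lact_bilin B.
have /choice [f fE] x := trace_repr TrP (linear_comp lpsi (r1 x)).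
have lf : linear f.
  move=> c x y; apply: (trace_inj TrP) => h.
  by rewrite mulrDl -scalerAl linearD linearZ /= !fE r2 lpsi.
have H0 : [set f : M -> H | [/\ linear f, forall h x, f (lact B h x) = h * f x &
    forall x, Tr (f x) = psi x]]%classic f.
  split=> // [h x|x].
    apply: (trace_inj TrP) => g.
    by rewrite fE -lactM -mulrA (traceC ss TrP h) -mulrA fE.
  by rewrite -[f x]mulr1 fE lact1.
exact: (xgetI (fun _ => 0) H0).
Qed.

Lemma Rpsi_unique (psi : M -> k^o) f : linear psi ->
  (forall x h, f (ract B x h) = f x * h) -> (forall x, Tr (f x) = psi x) ->
  forall x, Rpsi B Tr psi x = f x.
Proof.
move=> lpsi fr fT x; have [_ Rr RT] := RpsiP lpsi.
by apply: (trace_inj TrP) => h; rewrite -Rr -fr RT fT.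
Qed.

End TraceDuals.

(** * The twist as a graded automorphism *)

Section TwistAutomorphism.
Variables (k : fieldType) (H : falgType k) (hH : hopf H).
Variables (V : lmodType k) (actV : hmodule H V).
Local Notation sw := (sweedler hH).
Local Notation B := (VH_bimodule hH actV).
Local Notation "h |> v" := (hact actV h v) (at level 45, right associativity).

Section Winding.
Variable chi : H -> k^o.
Hypotheses (chi_lin : linear chi) (chi1 : chi 1 = 1)
  (chiM : forall g h, chi (g * h) = chi g * chi h).
Local Notation Xi := (winding hH chi).

Let bXi : bilin2 (fun h1 h2 : H => (chi h1 : k) *: h2).
Proof. by split=> [y|x]; [exact: (lin_scalel _ chi_lin)|lin]. Qed.

Lemma winding_linear : linear Xi.
Proof. exact: sweedler_linear. Qed.

Lemma winding1 : Xi 1 = 1.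
Proof. by rewrite /winding sweedler1 // chi1 scale1r. Qed.

Lemma windingM g h : Xi (g * h) = Xi g * Xi h.
Proof.
rewrite /winding sweedlerM // (sweedler_comp (F := fun x => x * sw _ h) hH); last by lin.
apply: eq_sweedler => a b; rewrite (sweedler_comp (F := fun x => (chi a *: b) * x) hH); last by lin.
by apply: eq_sweedler => c d; rewrite chiM -scalerAl -scalerAr scalerA.
Qed.

End Winding.

Section Twist.
Variables (chi : H -> k^o) (s : V -> V).
Hypotheses (chi_lin : linear chi) (chi1 : chi 1 = 1)
  (chiM : forall g h, chi (g * h) = chi g * chi h) (s_lin : linear s).
Hypothesis twist : forall h v,
  sw (fun a b => (chi b : k) *: s (a |> v)) h = sw (fun a b => (chi a : k) *: (b |> s v)) h.
Local Notation Xi := (winding hH chi).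

Definition twist_mod (x : tensor V H) : tensor V H :=
  tlift (fun v h => tens (s v) (Xi h)) x.

Let lXi := winding_linear chi_lin.

Let btw : bilin2 (fun v h => tens (s v) (Xi h) : tensor V H).
Proof. by split=> ?; [exact: lin_tensl|exact: lin_tensr]. Qed.

Lemma twist_mod_linear : linear twist_mod.
Proof. exact: tlift_linear btw. Qed.

Lemma twist_mod_tens v h : twist_mod (tens v h) = tens (s v) (Xi h).
Proof. exact: (tlift_tens v h btw). Qed.

Lemma twist_modr x h : twist_mod (ract B x h) = ract B (twist_mod x) (Xi h).
Proof.
have [r1 r2] := ract_bilin B.
move: x; apply: (tens_eq (f := fun x => twist_mod (ract B x h))
   (g := fun x => ract B (twist_mod x) (Xi h))) => [||v g].
- exact: (linear_comp twist_mod_linear (r1 h)).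
- exact: (linear_comp (r1 _) twist_mod_linear).
by rewrite /= twist_mod_tens !VHract_tens twist_mod_tens windingM.
Qed.

(** By coassociativity both sides involve three Sweedler factors of h, with chi on the second in one
    and on the first in the other; the relation [twist] exchanges them. *)
Lemma twist_modl h x : twist_mod (lact B h x) = lact B (Xi h) (twist_mod x).
Proof.
have [r1 r2] := lact_bilin B.
move: x; apply: (tens_eq (f := fun x => twist_mod (lact B h x))
   (g := fun x => lact B (Xi h) (twist_mod x))) => [||v g].
- exact: (linear_comp twist_mod_linear (r2 h)).
- exact: (linear_comp (r2 _) twist_mod_linear).
rewrite /= twist_mod_tens VHlact_tens (sweedler_comp hH _ _ twist_mod_linear).
pose Z a1 a2 b : tensor V H := tens ((chi a2 : k) *: s (a1 |> v)) (b * Xi g).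
pose Z' a1 a2 b : tensor V H := tens ((chi a1 : k) *: (a2 |> s v)) (b * Xi g).
transitivity (sw (fun a b => sw (fun a1 a2 => Z a1 a2 b) a) h).
  rewrite (sweedler_coassoc hH (f := Z)); last first.
    split=> [y z|x z|x y]; rewrite /Z; last by lin.
      by apply: lin_tensl; apply: lin_scaler; apply: (linear_comp s_lin); lin.
    by apply: lin_tensl; apply: (lin_scalel _ chi_lin).
  apply: eq_sweedler => a b; rewrite twist_mod_tens windingM // /winding.
  rewrite (sweedler_comp (F := fun u => tens (s (a |> v)) (u * sw _ g) : tensor V H) hH); last by lin.
  by apply: eq_sweedler => b1 b2; rewrite /Z tensZl -tensZr scalerAl.
transitivity (sw (fun a b => sw (fun a1 a2 => Z' a1 a2 b) a) h).
  apply: eq_sweedler => a b.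
  have lT : linear (fun u : V => tens u (b * Xi g) : tensor V H) by lin.
  by rewrite -!(sweedler_comp hH _ _ lT) twist.
rewrite (sweedler_coassoc hH (f := Z')); last first.
  by split=> [y z|x z|x y]; rewrite /Z'; lin.
rewrite /winding (sweedler_comp (F := fun u => VHlact hH actV u (tens (s v) (Xi g))) hH);
  last exact: (VHlact_bilin hH actV).1.
apply: eq_sweedler => a b.
rewrite [RHS](linZ ((VHlact_bilin hH actV).1 _)) VHlact_tens sw_scale.
by apply: eq_sweedler => b1 b2; rewrite /Z' tensZl.
Qed.

Definition twist_nu (t : TA B) : TA B :=
  TAlift (fun h => TAin0 B (Xi h)) (fun x => TAin1 B (twist_mod x)) t.

Let f0l : linear (fun h => TAin0 B (Xi h)) := linear_comp (TAin0_linear B) lXi.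
Let f1l : linear (fun x => TAin1 B (twist_mod x)) :=
  linear_comp (TAin1_linear B) twist_mod_linear.
Let f01 : TAin0 B (Xi 1) = 1. Proof. by rewrite winding1 // TAin0_1. Qed.
Let f0M g h : TAin0 B (Xi (g * h)) = TAin0 B (Xi g) * TAin0 B (Xi h).
Proof. by rewrite windingM // TAin0M. Qed.
Let f1L h x : TAin1 B (twist_mod (lact B h x)) = TAin0 B (Xi h) * TAin1 B (twist_mod x).
Proof. by rewrite twist_modl TAin01. Qed.
Let f1R x h : TAin1 B (twist_mod (ract B x h)) = TAin1 B (twist_mod x) * TAin0 B (Xi h).
Proof. by rewrite twist_modr TAin10. Qed.

Lemma twist_nu_linear : linear twist_nu.
Proof. exact: TAlift_linear. Qed.

Lemma twist_nuM x y : twist_nu (x * y) = twist_nu x * twist_nu y.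
Proof. exact: TAliftM. Qed.

Lemma twist_nu1 : twist_nu 1 = 1.
Proof. exact: TAlift_1. Qed.

Lemma twist_nu_in0 h : twist_nu (TAin0 B h) = TAin0 B (Xi h).
Proof. exact: TAlift0. Qed.

Lemma twist_nu_in1 x : twist_nu (TAin1 B x) = TAin1 B (twist_mod x).
Proof. exact: TAlift1. Qed.

Lemma twist_nu_deg n t : TAdeg n t -> TAdeg n (twist_nu t).
Proof.
elim: n t => [|n IH] t; first by move=> /TAdeg0P[h ->]; rewrite twist_nu_in0; apply: TAdeg_in0.
move: t; apply: TAdegS_ind => [|x y hx hy|x t dt].
- by rewrite (lin0 twist_nu_linear); apply: TAdeg0.
- by rewrite (linD twist_nu_linear); apply: TAdegD.
by rewrite twist_nuM twist_nu_in1; apply: (TAdegM (m := 1)) (TAdeg_in1 _ _) (IH _ dt).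
Qed.

End Twist.
End TwistAutomorphism.

Section TwistInverse.
Variables (k : fieldType) (H : falgType k) (hH : hopf H).
Variables (V : lmodType k) (actV : hmodule H V).
Local Notation sw := (sweedler hH).
Local Notation S := (antipode hH).
Local Notation B := (VH_bimodule hH actV).
Local Notation "h |> v" := (hact actV h v) (at level 45, right associativity).
Variable chi : H -> k^o.
Hypotheses (chi_lin : linear chi) (chi1 : chi 1 = 1)
  (chiM : forall g h, chi (g * h) = chi g * chi h).

Lemma chi_antipodel h : sw (fun a b => chi (S a) * chi b : k^o) h = counit hH h.
Proof.
have := congr1 chi (sw_antipodel hH h); rewrite (linZ chi_lin) chi1 /GRing.scale /= mulr1 => <-.
by rewrite (sweedler_comp hH _ _ chi_lin); apply: eq_sweedler => a b; rewrite chiM.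
Qed.

Lemma chi_antipoder h : sw (fun a b => chi a * chi (S b) : k^o) h = counit hH h.
Proof.
have := congr1 chi (sw_antipoder hH h); rewrite (linZ chi_lin) chi1 /GRing.scale /= mulr1 => <-.
by rewrite (sweedler_comp hH _ _ chi_lin); apply: eq_sweedler => a b; rewrite chiM.
Qed.

Lemma winding_comp (x y : H -> k^o) : linear x -> linear y ->
  (forall h, sw (fun a b => y a * x b : k^o) h = counit hH h) ->
  forall h, winding hH x (winding hH y h) = h.
Proof.
move=> lx ly xy h; rewrite {2}/winding (sweedler_comp hH _ _ (winding_linear hH lx)).
transitivity (sw (fun a b => sw (fun b1 b2 => (y a * x b1 : k) *: b2) b) h).
  apply: eq_sweedler => a b; rewrite (linZ (winding_linear hH lx)) /winding sw_scale.
  by apply: eq_sweedler => b1 b2; rewrite scalerA.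
rewrite -(sweedler_coassoc hH (f := fun a b1 b2 => (y a * x b1 : k) *: b2)); last first.
  split=> [b c|a c|a b]; last by lin.
    by apply: lin_scalel; apply: lin_mulkr.
  by apply: lin_scalel; apply: lin_mulkl.
rewrite -[RHS](sw_counitl hH (F := fun x => x) h) //; apply: eq_sweedler => a b.
have l1 : linear (fun u : k^o => (u : k) *: b) by move=> c u v; rewrite scalerDl scalerA.
by rewrite -(sweedler_comp hH _ _ l1) xy.
Qed.

Variables (s s' : V -> V).
Hypotheses (s_lin : linear s) (s'_lin : linear s').
Hypotheses (ss' : forall v, s (s' v) = v) (s's : forall v, s' (s v) = v).
Hypothesis twist : forall h v,
  sw (fun a b => (chi b : k) *: s (a |> v)) h = sw (fun a b => (chi a : k) *: (b |> s v)) h.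

Let lchiS : linear (fun h => chi (S h)). Proof. by apply: (linear_comp chi_lin); lin. Qed.

(** After applying s, the relation [twist] gives s(h s^-1(v)) = chi(h_1) chi(S(h_3)) h_2 v, and chi
    o S, the convolution inverse of chi, cancels the first factor. *)
Lemma twist_inverse h v :
  sw (fun a b => (chi (S b) : k) *: s' (a |> v)) h =
  sw (fun a b => (chi (S a) : k) *: (b |> s' v)) h.
Proof.
apply: (can_inj s's); rewrite !(sweedler_comp hH _ _ s_lin).
transitivity (sw (fun a b => (chi (S b) : k) *: (a |> v)) h).
  by apply: eq_sweedler => a b; rewrite (linZ s_lin) ss'.
transitivity (sw (fun a b => (chi (S a) : k) *: s (b |> s' v)) h); last first.
  by apply: eq_sweedler => a b; rewrite (linZ s_lin).
pose P h := sw (fun x y => (chi x : k) *: (y |> v)) h.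
have lP : linear P.
  apply: sweedler_linear; split=> [y|x]; last by lin.
  exact: lin_scalel.
have sP b : s (b |> s' v) = sw (fun b1 b2 => (chi (S b2) : k) *: P b1) b.
  transitivity (sw (fun a b => sw (fun a1 a2 => (chi (S b) : k) *: ((chi a2 : k) *: s (a1 |> s' v))) a) b).
    rewrite (sweedler_coassoc hH (f := fun a1 a2 b => (chi (S b) : k) *: ((chi a2 : k) *: s (a1 |> s' v)))).
      rewrite -[LHS](sw_counitr hH (F := fun b => s (b |> s' v)) b); last first.
        by apply: (linear_comp s_lin); lin.
      apply: eq_sweedler => x y; rewrite -chi_antipoder.
      have l1 : linear (fun u : k^o => (u : k) *: s (x |> s' v)).
        by move=> c u w; rewrite scalerDl scalerA.
      by rewrite (sweedler_comp hH _ _ l1); apply: eq_sweedler => c d; rewrite scalerA mulrC.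
    split=> [y z|x z|x y]; last exact: (lin_scalel _ lchiS).
      by do 2 apply: lin_scaler; apply: (linear_comp s_lin); lin.
    by apply: lin_scaler; apply: lin_scalel.
  by apply: eq_sweedler => x y; rewrite -sw_scale twist ss'.
transitivity (sw (fun a b => sw (fun b1 b2 => (chi (S a) : k) *: ((chi (S b2) : k) *: P b1)) b) h); last first.
  by apply: eq_sweedler => a b; rewrite sP sw_scale.
rewrite -(sweedler_coassoc hH (f := fun a b1 b2 => (chi (S a) : k) *: ((chi (S b2) : k) *: P b1))); last first.
  split=> [y z|x z|x y]; first exact: (lin_scalel _ lchiS).
    by do 2 apply: lin_scaler.
  by apply: lin_scaler; exact: (lin_scalel _ lchiS).
apply: eq_sweedler => a b.
transitivity ((chi (S b) : k) *: sw (fun a1 a2 => (chi (S a1) : k) *: P a2) a); last first.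
  by rewrite sw_scale; apply: eq_sweedler => x y; rewrite !scalerA mulrC.
congr (_ *: _).
transitivity (sw (fun a1 a2 => sw (fun x y => (chi (S a1) : k) *: ((chi x : k) *: (y |> v))) a2) a); last first.
  by apply: eq_sweedler => x y; rewrite -sw_scale.
rewrite -(sweedler_coassoc hH (f := fun a1 x y => (chi (S a1) : k) *: ((chi x : k) *: (y |> v)))); last first.
  split=> [y z|x z|x y]; first exact: (lin_scalel _ lchiS).
    by apply: lin_scaler; apply: lin_scalel.
  by lin.
rewrite -[LHS](sw_counitl hH (F := fun a => a |> v) a); last by lin.
apply: eq_sweedler => x y; rewrite -chi_antipodel.
have l1 : linear (fun u : k^o => (u : k) *: (y |> v)) by move=> c u w; rewrite scalerDl scalerA.
by rewrite (sweedler_comp hH _ _ l1); apply: eq_sweedler => c d; rewrite scalerA.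
Qed.

Lemma twist_nu_comp (x y : H -> k^o) (f f' : V -> V) :
  linear x -> x 1 = 1 -> (forall g h, x (g * h) = x g * x h) ->
  linear y -> y 1 = 1 -> (forall g h, y (g * h) = y g * y h) ->
  linear f -> linear f' ->
  (forall h v, sw (fun a b => (x b : k) *: f (a |> v)) h = sw (fun a b => (x a : k) *: (b |> f v)) h) ->
  (forall h v, sw (fun a b => (y b : k) *: f' (a |> v)) h = sw (fun a b => (y a : k) *: (b |> f' v)) h) ->
  (forall h, sw (fun a b => y a * x b : k^o) h = counit hH h) ->
  (forall v, f (f' v) = v) ->
  forall t, twist_nu (hH := hH) (actV := actV) x f (twist_nu (hH := hH) (actV := actV) y f' t) = t.
Proof.
move=> lx x1 xM ly y1 yM lf lf' tx ty xy ff'.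
have lX := twist_nu_linear lx xM lf tx; have lY := twist_nu_linear ly yM lf' ty.
apply: TA_lineq => [||h|z t IH].
- exact: (linear_comp lX lY).
- by [].
- by rewrite !twist_nu_in0 // (winding_comp lx ly).
rewrite (twist_nuM ly yM lf' ty) (twist_nuM lx xM lf tx) IH !twist_nu_in1 //.
congr (TAin1 _ _ * _); move: z; apply: (tens_eq (f := fun z => twist_mod hH x f (twist_mod hH y f' z)) (g := fun z => z)) => [||v h].
- exact: (linear_comp (twist_mod_linear hH lx lf) (twist_mod_linear hH ly lf')).
- by [].
by rewrite !twist_mod_tens // ff' (winding_comp lx ly).
Qed.

Lemma twist_nu_bij : bijective (twist_nu (hH := hH) (actV := actV) chi s).
Proof.
have S1 : chi (S 1) = 1 by rewrite antipode1.
(* S reverses products, but the values of chi commute, so chi o S is again a character. *)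
have SM g h : chi (S (g * h)) = chi (S g) * chi (S h) by rewrite antipodeM chiM mulrC.
exists (twist_nu (hH := hH) (actV := actV) (fun h => chi (S h)) s').
- by apply: twist_nu_comp => //; [apply: twist_inverse|apply: chi_antipoder].
- by apply: twist_nu_comp => //; [apply: twist_inverse|apply: chi_antipodel].
Qed.

End TwistInverse.

(** * Psi(w # 1) as a twisted superpotential over H *)

Section SuperpotentialOverH.
Variables (k : fieldType) (V : vectType k) (sigma : 'End(V)) (l : nat) (w : TV V).
Variables (H : falgType k) (hH : hopf H) (actV : hmodule H V) (chi : H -> k^o).
Local Notation sw := (sweedler hH).
Local Notation S := (antipode hH).
Local Notation B := (VH_bimodule hH actV).
Local Notation lc := (lcontract (B := scalar_bimodule V)).
Local Notation e := (vbasis {:V}).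
Local Notation tact := (TVact hH actV).
Local Notation Psi := (@Psi k H hH V actV).
Local Notation "h |> v" := (hact actV h v) (at level 45, right associativity).
Variable Tr : {linear H -> k^o}.
Hypotheses (hss : semisimple_hopf hH) (TrP : is_trace hH Tr).
Hypothesis sigma_GL : lker sigma == 0%VS.
Hypothesis l_gt0 : (0 < l)%N.
Hypothesis wS : superpotential l sigma w.
Hypothesis w_ndeg : forall psi : V -> k^o, linear psi -> lc psi w = 0 -> forall v, psi v = 0.
Hypotheses (chi_lin : linear chi) (chi1 : chi 1 = 1)
  (chiM : forall g h, chi (g * h) = chi g * chi h).
Hypothesis chiE : forall h, tact h w = (chi h : k) *: w.
Local Notation Xi := (winding hH chi).
Local Notation u := (Psi (tens w 1)).
Local Notation nu := (twist_nu (hH := hH) (actV := actV) chi sigma).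
Local Notation c := (wcontract w).

Let SS : forall h, S (S h) = h. Proof. by case: hss. Qed.
Let sl : linear sigma. Proof. exact: linearP. Qed.
Let twist := twist_commutes SS l_gt0 wS w_ndeg chi_lin chiE.

(** A dual basis for the trace form writes coordinates in H as traces. Testing with Tr(h -)
    eliminates the unknown values of R psi and L psi. *)
Lemma tensor_trace_ext (U : lmodType k) (X Y : tensor U H) :
  (forall h, tlift (fun t x => (Tr (h * x) : k) *: t) X =
             tlift (fun t x => (Tr (h * x) : k) *: t) Y) -> X = Y.
Proof.
move=> XY; have [f fE] := trace_dual_basis TrP.
have bE h : bilin2 (fun (t : U) x => (Tr (h * x) : k) *: t).
  by split=> [x|t]; [lin|apply: lin_scalel; lin].
have E (Z : tensor U H) : Z = \sum_i tens (tlift (fun t x => (Tr (f i * x) : k) *: t) Z) (vbasis {:H})`_i.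
  move: Z; apply: (tens_eq (f := fun Z => Z)) => // [|t x].
    by apply: lin_sumr => i; apply: lin_tensl; exact: (tlift_linear (bE (f i))).
  rewrite {1}(fE x) (lin_sum (f := fun x => tens t x)); last by lin.
  by apply: eq_bigr => i _; rewrite tlift_tens // tensZl tensZr.
by rewrite (E X) (E Y); apply: eq_bigr => i _; rewrite XY.
Qed.

Lemma Psi_contractl f : linear f -> (forall x h, f (ract B x h) = f x * h) ->
  lcontract f u = Psi (\sum_(i < \dim {:V})
    sw (fun a b => tens (tact a (dcontract i w)) b) (f (tens e`_i 1))).
Proof.
move=> lf fr; have lP := @Psi_linear k H hH V actV.
rewrite {1}(superpotential_first l_gt0 wS) (lin_sum (Psi_tensl hH actV 1)) /=.
rewrite (lin_sum (lcontract_linear lf fr)) (lin_sum lP); apply: eq_bigr => i _.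
rewrite Psi_in1M lcontract_in1M // in0_Psi (sweedler_comp hH _ _ lP).
by apply: eq_sweedler => a b; rewrite mulr1.
Qed.

Lemma Psi_contractr f : linear f -> (forall h x, f (lact B h x) = h * f x) ->
  rcontract f u = Psi (\sum_(i < \dim {:V})
    tens (dcontract i w) (f (tens (sigma e`_i) 1))).
Proof.
move=> lf fl; have lP := @Psi_linear k H hH V actV.
rewrite {1}(superpotential_last l_gt0 wS) (lin_sum (Psi_tensl hH actV 1)) /=.
rewrite (lin_sum (rcontract_linear lf fl)) (lin_sum lP); apply: eq_bigr => i _.
rewrite Psi_mull; have := Psi_in1M hH actV (sigma e`_i) 1 1.
rewrite mulr1 Psi_one TAin0_1 mulr1 => ->; rewrite rcontract_Min1 //.
by rewrite -Psi_mulr mul1r.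
Qed.

(** After pairing with Tr(h -), the left side is S(h_1) acting on the contraction of w by
    psi(sigma(-) (x) Xi(h_2)), the right side the contraction by psi(h_1 sigma(-) (x) h_2);
    [wcontract_actr] identifies them. *)
Lemma Psi_contraction (psi : tensor V H -> k^o) : linear psi ->
  lcontract (Rpsi B Tr (fun x => psi (twist_mod hH chi sigma x))) u = rcontract (Lpsi B Tr psi) u.
Proof.
move=> lpsi; have lm := twist_mod_linear hH chi_lin sl.
have [lR Rr RT] := RpsiP TrP B (linear_comp lpsi lm).
have [lL Ll LT] := LpsiP hss TrP B lpsi.
rewrite Psi_contractl // Psi_contractr //; congr Psi; apply: tensor_trace_ext => h.
have bE : bilin2 (fun (t : TV V) x => (Tr (h * x) : k) *: t).
  by split=> [x|t]; [lin|apply: lin_scalel; lin].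
have lE := tlift_linear bE; have la := TVact_linearl hH actV.
rewrite !(lin_sum lE).
pose c' b := c (fun v => psi (tens (sigma v) b)).
have lc' : linear c'.
  by apply: wcontract_lin => v; apply: (linear_comp lpsi); lin.
transitivity (sw (fun h1 h2 => tact (S h1) (c' (Xi h2))) h).
  transitivity (\sum_(i < \dim {:V}) sw (fun h1 h2 =>
      (psi (tens (sigma e`_i) (Xi h2)) : k) *: tact (S h1) (dcontract i w)) h).
    apply: eq_bigr => i _; set a := Rpsi _ _ _ _.
    rewrite (sweedler_comp hH _ _ lE).
    transitivity (tact (sw (fun x y => (Tr (h * y) : k) *: x) a) (dcontract i w)).
      rewrite (sweedler_comp (F := fun x => tact x (dcontract i w)) hH) //.
      by apply: eq_sweedler => x y; rewrite tlift_tens // (linZ (la _)).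
    (* Moves the coproduct from the unknown value a of R psi onto h; what remains is Tr(h_2 a),
       which right linearity of R psi evaluates. *)
    rewrite -(trace_shiftr (trace_integral TrP).1).
    rewrite (sweedler_comp (F := fun x => tact x (dcontract i w)) hH) //.
    apply: eq_sweedler => x y; rewrite (linZ (la _)); congr (_ *: _).
    rewrite (traceC hss TrP) -Rr RT /= VHract_tens mul1r twist_mod_tens //.
  rewrite -sw_sum; apply: eq_sweedler => x y.
  rewrite /c' /wcontract (lin_sum (TVact_linear hH actV _)); apply: eq_bigr => i _.
  by rewrite (linZ (TVact_linear hH actV _)).
transitivity (sw (fun h1 h2 => c (fun v => psi (tens (h1 |> sigma v) h2))) h); last first.
  rewrite /wcontract sw_sum; apply: eq_bigr => i _; rewrite tlift_tens // -Ll LT /=.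
  have l1 : linear (fun z : tensor V H => (psi z : k) *: dcontract i w).
    by move=> a x y; rewrite lpsi scalerDl scalerA.
  rewrite VHlact_tens (sweedler_comp hH _ _ l1).
  by apply: eq_sweedler => x y; rewrite mulr1.
transitivity (sw (fun a b => sw (fun a1 a2 => (chi a2 : k) *: tact (S a1) (c' b)) a) h); last first.
  apply: eq_sweedler => a b; symmetry.
  have lb : linear (fun v => psi (tens v b)) by apply: (linear_comp lpsi); lin.
  exact: (wcontract_actr l_gt0 wS chiE a lb).
rewrite (sweedler_coassoc hH (f := fun a1 a2 b => (chi a2 : k) *: tact (S a1) (c' b))); last first.
  split=> [y z|x z|x y].
  - by apply: lin_scaler; apply: (linear_comp (la _)); lin.
  - exact: lin_scalel.
  - by apply: lin_scaler; apply: (linear_comp (TVact_linear hH actV _)).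
apply: eq_sweedler => a b; rewrite /winding (sweedler_comp (F := fun x => tact (S a) (c' x)) hH).
  by apply: eq_sweedler => x y; rewrite (linZ lc') (linZ (TVact_linear hH actV _)).
exact: (linear_comp (TVact_linear hH actV _) lc').
Qed.

Lemma Psi_superpotential : [/\ forall h, nu (TAin0 B h) = TAin0 B (Xi h),
  forall v h, nu (TAin1 B (tens v h)) = TAin1 B (tens (sigma v) (Xi h)) &
  Hsuperpotential Tr l nu u].
Proof.
have sK : cancel sigma (sigma^-1)%VF by apply: lker0_lfunK.
have sK' : cancel (sigma^-1)%VF sigma by apply: lker0_lfunVK.
have lm := twist_mod_linear hH chi_lin sl.
split=> [h|v h|]; first exact: twist_nu_in0.
  by rewrite twist_nu_in1 // twist_mod_tens.
split.
- split.
  + exact: (twist_nu_linear chi_lin chiM sl twist).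
  + split; first exact: twist_nu1.
    exact: (twist_nuM chi_lin chiM sl twist).
  + by apply: (twist_nu_bij chi_lin chi1 chiM sl _ sK' sK twist); exact: linearP.
  + by move=> n t; apply: twist_nu_deg.
(* The convolution chi * Tr equals chi(1) Tr = Tr, since Tr is an integral. *)
- move=> h; rewrite twist_nu_in0 // TAproj0_in0; have [_ T1 _] := TrP.
  have [x xE] := linear_packed chi_lin; have := T1 x h; rewrite xE chi1 mul1r => <-.
  rewrite /winding (sweedler_comp hH _ _ (linearP Tr)).
  by apply: (@eq_sweedler _ _ _ k^o) => a b; rewrite linearZ /= xE.
- by apply: Psi_deg; case: wS.
- move=> h; rewrite in0_Psi twist_nu_in0 // -Psi_mulr mul1r.
  rewrite /winding (sweedler_comp hH _ _ (Psi_tensr hH actV w)).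
  apply: eq_sweedler => a b; rewrite chiE mulr1 tensZl tensZr //.
- move=> psi.
  have -> : dual_twist nu psi = fun x => psi (twist_mod hH chi sigma x).
    by apply/funext => x; rewrite /dual_twist twist_nu_in1 // TAproj1_in1.
  by apply: Psi_contraction; exact: linearP.
Qed.

End SuperpotentialOverH.

(** * The derivation-quotient algebra over H *)

Section DerivationQuotient.
Variables (k : fieldType) (V : vectType k) (l i : nat) (w : TV V).
Variables (A : algType k) (phi : dquot w i -> A).
Hypothesis phi_iso : alg_iso phi.
Variables (H : falgType k) (hH : hopf H) (act : module_algebra hH A) (actV : hmodule H V).
Local Notation p := (dquot_map phi).
Local Notation g := (dquot_deg phi).
Local Notation sw := (sweedler hH).
Local Notation S := (antipode hH).
Local Notation B := (VH_bimodule hH actV).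
Local Notation in1 := (TAin1 (scalar_bimodule V) : V -> TV V).
Local Notation lc := (lcontract (B := scalar_bimodule V)).
Local Notation tact := (TVact hH actV).
Local Notation Psi := (@Psi k H hH V actV).
Local Notation "h |> v" := (hact act h v) (at level 45, right associativity).
Variable Tr : {linear H -> k^o}.
Hypotheses (TrP : is_trace hH Tr) (chi : H -> k).
Hypothesis dw : TAdeg l w.
Hypothesis i_le_l : (i <= l)%N.
Hypothesis chiE : forall h, tact h w = (chi h : k) *: w.
Hypothesis pH : forall h v, p (in1 (hact actV h v)) = h |> p (in1 v).
Hypothesis g_sub : forall n h a, g n a -> g n (h |> a).
Local Notation u := (Psi (tens w 1)).
Local Notation st := (smash_tens act).

Lemma dquot_map_linear : linear p.
Proof.
case: phi_iso => lf _ _ c x y; rewrite /dquot_map -lf; congr phi.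
by rewrite -qclassD -[qclass _ (c *: x)](qscaleE (partial i w) c x).
Qed.

Lemma dquot_map1 : p 1 = 1. Proof. by case: phi_iso => _ [h _] _. Qed.

Lemma dquot_mapM x y : p (x * y) = p x * p y.
Proof.
case: phi_iso => _ [_ h] _; rewrite /dquot_map -h; congr phi.
by rewrite -[qclass _ (x * y)](qmulE (partial i w) x y).
Qed.

Lemma dquot_map_ker t : p t = 0 <-> ideal_gen (partial i w) t.
Proof.
have p0 := lin0 dquot_map_linear; case: phi_iso => _ _ /bij_inj phiI.
rewrite -{1}p0 /dquot_map; split => [/phiI /qclassP|pt].
  by rewrite subr0.
by congr phi; apply/qclassP; rewrite subr0.
Qed.

Lemma dquot_map_surj a : exists t, p t = a.
Proof.
case: phi_iso => _ _ [psi _ phiK]; exists (qrepr (psi a)).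
by rewrite /dquot_map qreprK phiK.
Qed.

Lemma partialS j r (f : {linear V -> k^o}) : partial j w r -> partial j.+1 w (lc f r).
Proof.
move=> [fs ->]; exists [tuple of rcons fs f] => /=.
by rewrite -cats1 foldl_cat.
Qed.

Lemma partial_deg j r : (j <= l)%N -> partial j w r -> TAdeg (l - j) r.
Proof.
have gen n (fs : seq {linear V -> k^o}) t : TAdeg (size fs + n) t ->
    TAdeg n (foldl (fun s (f : {linear V -> k^o}) => lc f s) t fs).
  elim: fs t => [|f fs IH] t /=; first by rewrite add0n.
  by rewrite addSn => /(lc_deg f); apply: IH.
by move=> jl [fs ->]; apply: gen; rewrite size_tuple subnKC.
Qed.

(** Evaluation V^* (x) V -> k is H-linear for the action (h f)(v) = f(S(h) v) on V^*. *)
Lemma TVact_lc h (f : V -> k^o) t : linear f ->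
  tact h (lc f t) = sw (fun h1 h2 => lc (fun v => f (hact actV (S h1) v)) (tact h2 t)) h.
Proof.
move=> lf; have la := TVact_linear hH actV; have l0 := TVact_linearl hH actV.
have lfS x : linear (fun v => f (hact actV (S x) v)) by apply: (linear_comp lf); lin.
move: t; apply: TV_lineq => [|||v t _].
- exact: (linear_comp (la h) (TVlc_linear lf)).
- apply: sweedler_par => x y; exact: (linear_comp (TVlc_linear (lfS x)) (la y)).
- rewrite TVlc_one // (lin0 (la h)) /sweedler /tlift /Defs.lift /lsum big1 // => q _.
  by rewrite TVact_one (linZ (TVlc_linear (lfS _))) TVlc_one // !scaler0.
rewrite TVlc_in1M // (linZ (la h)).
transitivity (sw (fun h1 h2 => sw (fun h21 h22 =>
    (f (hact actV (S h1 * h21) v) : k) *: tact h22 t) h2) h); last first.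
  apply: eq_sweedler => a b; rewrite TVact_in1M (sweedler_comp hH _ _ (TVlc_linear (lfS a))).
  by apply: eq_sweedler => x y; rewrite TVlc_in1M // hactM.
have lfv : linear (fun x => f (hact actV x v)) by apply: (linear_comp lf); lin.
rewrite -(sweedler_coassoc hH (f := fun h1 h21 h22 =>
    (f (hact actV (S h1 * h21) v) : k) *: tact h22 t)); last first.
  split=> [y z|x z|x y].
  - by apply: lin_scalel; apply: (linear_comp lfv); lin.
  - by apply: lin_scalel; apply: (linear_comp lfv); lin.
  - by apply: lin_scaler.
rewrite -[X in _ *: X](sw_counitl hH (F := fun h => tact h t) h) // sw_scale.
apply: eq_sweedler => a b.
have lF : linear (fun x : H => (f (hact actV x v) : k) *: tact b t).
  by move=> c x y; rewrite lfv scalerDl scalerA.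
rewrite -(sweedler_comp hH _ a lF) sw_antipodel (linZ lfv) hact1.
by rewrite !scalerA mulrC.
Qed.

Lemma partial_stable j r h : kspan (partial j w) r -> kspan (partial j w) (tact h r).
Proof.
have la := TVact_linear hH actV.
have red : (forall r, partial j w r -> kspan (partial j w) (tact h r)) ->
    kspan (partial j w) r -> kspan (partial j w) (tact h r).
  move=> Hg; apply: (kspan_ind (Q := fun r => kspan (partial j w) (tact h r))) => //.
  - by rewrite (lin0 (la h)); apply: kspan0.
  - by move=> c x y hx hy; rewrite (la h); apply: kspanL.
apply: red; elim: j h {r} => [|j IH] h _ [fs ->].
  rewrite tuple0 /= chiE -[_ *: _]addr0; apply: kspanL; last exact: kspan0.
  by apply: kspan_gen; exists [tuple].
(* [partial] applies its functionals by [foldl], so the last contraction performed is the last entry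
   of the tuple. *)
case: fs => s /= ss; case/lastP: s ss => [//|s f]; rewrite size_rcons eqSS => ss.
rewrite -cats1 foldl_cat /=; set r := foldl _ _ _.
have hr : partial j w r by exists (Tuple ss).
rewrite TVact_lc; last exact: linearP.
apply: (@kspan_sweedler _ _ hH) => a b.
have lfS : linear (fun v => f (hact actV (S a) v)) by lin.
have [f' f'E] := linear_packed lfS.
have -> : (fun v => f (hact actV (S a) v)) = f' by apply/funext => v; rewrite f'E.
move: (tact b r) (IH b _ hr); apply: (kspan_ind (Q := fun r => kspan _ (lc f' r))).
- by rewrite (lin0 (TVlc_linear (linear_of f'))); apply: kspan0.
- by move=> c x y hx hy; rewrite (TVlc_linear (linear_of f')); apply: kspanL.
- by move=> x hx; apply: kspan_gen; apply: partialS.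
Qed.

Definition Psi_partial j : TA B -> Prop :=
  kspan (fun x => exists r h, partial j w r /\ x = Psi (tens r h)).

Lemma Psi_partial_span j r h : kspan (partial j w) r -> Psi_partial j (Psi (tens r h)).
Proof.
have lP := Psi_tensl hH actV h.
apply: (kspan_ind (Q := fun r => Psi_partial j (Psi (tens r h)))).
- by rewrite (lin0 lP); apply: kspan0.
- by move=> c x y hx hy; rewrite (lP c x y); apply: kspanL.
- by move=> x hx; apply: kspan_gen; exists x, h.
Qed.

(** Once the first letter is split off, R psi leaves an element of H in front. [in0_Psi] moves it to
    the right while it acts on a contraction of w, and [partial_stable] keeps the result in the
    span. *)
Lemma Psi_partialS j f x : (j < l)%N -> linear f -> (forall y h, f (ract B y h) = f y * h) ->
  Psi_partial j x -> Psi_partial j.+1 (lcontract f x).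
Proof.
move=> jl lf fr; have ll := lcontract_linear lf fr.
apply: (kspan_ind (Q := fun x => Psi_partial j.+1 (lcontract f x))).
- by rewrite (lin0 ll); apply: kspan0.
- by move=> c y z hy hz; rewrite (ll c y z); apply: kspanL.
move=> _ [r [h [hr ->]]].
have dr : TAdeg (l - j.+1).+1 r by rewrite -subSn //; apply: partial_deg (ltnW jl) hr.
rewrite (TVexpand dr) (lin_sum (Psi_tensl hH actV h)) (lin_sum ll).
apply: big_ind => [|y z hy hz|q _]; first exact: kspan0.
  by have := kspanL 1 hy hz; rewrite scale1r.
rewrite Psi_in1M lcontract_in1M // in0_Psi; apply: (@kspan_sweedler _ _ hH) => a b.
apply: Psi_partial_span; apply: partial_stable; apply: kspan_gen.
have [f' f'E] := linear_packed (coordV_linear (V := V) q).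
have := partialS f' hr; congr (partial _ _ _); rewrite /dcontract.
by congr (lcontract _ r); apply/funext => v; rewrite f'E.
Qed.

Lemma Hpartial_Psi t : Hpartial Tr i u t -> Psi_partial i t.
Proof.
move=> [fs [h ->]]; rewrite -Psi_mulr mul1r.
have := size_tuple fs; move: (tval fs) => s si.
have : (size s <= l)%N by rewrite si.
rewrite -si => {fs si}; elim: s => [_|f s IH sl] /=.
  by apply: kspan_gen; exists w, h; split=> //; exists [tuple].
have [lR Rr _] := RpsiP TrP B (linear_of f).
by apply: Psi_partialS => //; apply: IH; apply: ltnW.
Qed.

(** A functional f on V extends to f (x) Tr on V (x) H, and R(f (x) Tr) = f (x) id; contraction of
    Psi(t # h) by it is Psi of the contraction of t by f. *)
Lemma partial_Hpartial r : partial i w r -> Hpartial Tr i u (Psi (tens r 1)).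
Proof.
move=> [fs ->].
have bf (f : {linear V -> k^o}) : bilin2 (fun (v : V) (h : H) => (f v : k) *: h).
  by split=> [h|v]; [apply: lin_scalel|]; lin.
have bT (f : {linear V -> k^o}) : bilin2 (fun (v : V) (h : H) => (f v : k) * Tr h : k^o).
  by split=> [h|v]; [apply: lin_mulkr|apply: lin_mulkl]; lin.
have /choice [ext extE] f := linear_packed (tlift_linear (bT f)).
have extR f x : Rpsi B Tr (ext f) x = tlift (fun (v : V) (h : H) => (f v : k) *: h) x.
  apply: (Rpsi_unique TrP) => [|y h|y].
  - exact: linearP.
  - have [r1 r2] := ract_bilin B.
    move: y; apply: (tens_eq (f := fun y => tlift (fun (v : V) (h : H) => (f v : k) *: h) (ract B y h))
      (g := fun y => tlift (fun (v : V) (h : H) => (f v : k) *: h) y * h)) => [||v z].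
    + exact: (linear_comp (tlift_linear (bf f)) (r1 h)).
    + exact: lin_mulr (tlift_linear (bf f)).
    by rewrite /= VHract_tens !tlift_tens // scalerAl.
  - rewrite extE; move: y; apply: (tens_eq (Z := k^o)
      (f := fun y => Tr (tlift (fun (v : V) (h : H) => (f v : k) *: h) y))) => [||v z].
    + exact: lin_app (tlift_linear (bf f)).
    + exact: tlift_linear (bT f).
    by rewrite !tlift_tens // linearZ.
have lcE (f : {linear V -> k^o}) t h : lcontract (Rpsi B Tr (ext f)) (Psi (tens t h)) = Psi (tens (lc f t) h).
  have [lR Rr _] := RpsiP TrP B (linear_of (ext f)).
  move: t; apply: TV_lineq => [|||v t _].
  - exact: (linear_comp (lcontract_linear lR Rr) (Psi_tensl _ _ h)).
  - exact: (linear_comp (Psi_tensl _ _ h) (TVlc_linear (linear_of f))).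
  - rewrite Psi_one lcontract_in0 // TVlc_one; last exact: linearP.
    by rewrite (lin0 (Psi_tensl hH actV h)).
  rewrite Psi_in1M lcontract_in1M // extR tlift_tens // TVlc_in1M; last exact: linearP.
  rewrite (linZ (TAin0_linear B)) TAin0_1 -scalerAl mul1r.
  by have /= -> := linZ (Psi_tensl hH actV h) (f v) t.
(* The tuple is reversed because [partial] folds from the left and [Hpartial] from the right. *)
exists [tuple of rev (map ext fs)], 1; rewrite TAin0_1 mulr1 /= -foldl_rev revK.
elim: (tval fs) (w) => //= f s IH t.
by rewrite lcE -IH.
Qed.

Let bSm : bilin2 (fun v h => st (p (in1 v)) h).
Proof.
split=> [h|v]; rewrite /smash_tens; last by lin.
by apply: lin_tensl; apply: (linear_comp dquot_map_linear); apply: TV_in1_linear.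
Qed.

Definition to_smash1 (x : tensor V H) : smash act := tlift (fun v h => st (p (in1 v)) h) x.
Definition to_smash (t : TA B) : smash act := TAlift (st 1) to_smash1 t.

Let ls0 : linear (st 1). Proof. by rewrite /smash_tens; lin. Qed.
Let ls1 : linear to_smash1. Proof. exact: tlift_linear bSm. Qed.
Lemma to_smash1_tens v h : to_smash1 (tens v h) = st (p (in1 v)) h.
Proof. exact: tlift_tens v h bSm. Qed.

Lemma smash_mulr_in0 a g' h : st a g' * st 1 h = st a (g' * h).
Proof.
rewrite -[LHS]/(smash_mul _ _) smash_mul_tens.
rewrite -[RHS](sw_counitl hH (F := fun x => st a (x * h)) g').
  apply: eq_sweedler => x y; rewrite ma_one -scalerAr mulr1 /smash_tens.
  by rewrite tensZl.
by rewrite /smash_tens; lin.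
Qed.

Lemma to_smash_l h x : to_smash1 (lact B h x) = st 1 h * to_smash1 x.
Proof.
have [r1 r2] := lact_bilin B.
move: x; apply: (tens_eq (Z := smash act) (f := fun x => to_smash1 (lact B h x))
  (g := fun x => st 1 h * to_smash1 x)) => [||v z].
- exact: (linear_comp ls1 (r2 h)).
- exact: (lin_mull (R := smash act) _ ls1).
rewrite /= VHlact_tens (sweedler_comp hH _ _ ls1) to_smash1_tens.
rewrite -[RHS]/(smash_mul _ _) smash_mul_tens; apply: eq_sweedler => a b.
by rewrite to_smash1_tens pH mul1r.
Qed.

Lemma to_smash_r x h : to_smash1 (ract B x h) = to_smash1 x * st 1 h.
Proof.
have [r1 r2] := ract_bilin B.
move: x; apply: (tens_eq (Z := smash act) (f := fun x => to_smash1 (ract B x h))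
  (g := fun x => to_smash1 x * st 1 h)) => [||v z].
- exact: (linear_comp ls1 (r1 h)).
- exact: (lin_mulr (R := smash act) _ ls1).
by rewrite /= VHract_tens !to_smash1_tens smash_mulr_in0.
Qed.

Let s0M g' h : st 1 (g' * h) = st 1 g' * st 1 h.
Proof. by rewrite smash_mulr_in0. Qed.

Lemma to_smash_linear : linear to_smash.
Proof. exact: (TAlift_linear ls0 s0M ls1 to_smash_l to_smash_r). Qed.

Lemma to_smashM x y : to_smash (x * y) = to_smash x * to_smash y.
Proof. exact: (TAliftM ls0 s0M ls1 to_smash_l to_smash_r). Qed.

Lemma to_smash_in0 h : to_smash (TAin0 B h) = st 1 h.
Proof. exact: (TAlift0 ls0 s0M ls1 to_smash_l to_smash_r). Qed.

Lemma to_smash_in1 x : to_smash (TAin1 B x) = to_smash1 x.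
Proof. exact: (TAlift1 ls0 (erefl _) s0M ls1 to_smash_l to_smash_r). Qed.

Lemma to_smash_Psi t h : to_smash (Psi (tens t h)) = st (p t) h.
Proof.
move: t; apply: TV_lineq => [|||v t IH].
- exact: (linear_comp to_smash_linear (Psi_tensl _ _ h)).
- by rewrite /smash_tens; apply: lin_tensl; apply: dquot_map_linear.
- by rewrite Psi_one to_smash_in0 dquot_map1.
rewrite Psi_in1M to_smashM to_smash_in1 to_smash1_tens IH dquot_mapM.
rewrite -[LHS]/(smash_mul _ _) smash_mul_tens sweedler1 ?hact1 ?mul1r //.
by rewrite /smash_tens; lin.
Qed.

Lemma to_smash_ideal t : ideal_gen (Hpartial Tr i u) t -> to_smash t = 0.
Proof.
have lF := to_smash_linear.
elim=> [|x y _ hx _ hy|a s b hs].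
- exact: lin0 lF.
- by rewrite (linD lF) hx hy addr0.
rewrite !to_smashM (_ : to_smash s = 0) ?mulr0 ?mul0r //.
move/Hpartial_Psi: hs; move: s; apply: kspan_ind => [|c x y hx hy|_ [r [h [hr ->]]]].
- exact: lin0 lF.
- by rewrite (lF c x y) hx hy scaler0 addr0.
rewrite to_smash_Psi (_ : p r = 0); last first.
  by apply/dquot_map_ker; rewrite -[r]mul1r -[1 * r]mulr1; apply: ideal_genM.
by rewrite /smash_tens -(scale0r (0 : A)) tensZl scale0r.
Qed.

Lemma Psi_ideal t h : ideal_gen (partial i w) t -> ideal_gen (Hpartial Tr i u) (Psi (tens t h)).
Proof.
have lP := Psi_tensl hH actV h.
elim=> [|x y _ hx _ hy|a r b hr].
- by rewrite (lin0 lP); apply: ideal_gen0.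
- by rewrite (linD lP); apply: ideal_genD.
by rewrite -mulrA !Psi_mull mulrA; apply: ideal_genM; apply: partial_Hpartial.
Qed.

(** The isomorphism is induced by [to_smash]. Its inverse sends a # h to the class of Psi(t # h) for
    a chosen t with p(t) = a; by [Psi_ideal] the class is independent of t, hence linear in a. *)
Lemma dquot_smash_iso : exists f : Hdquot Tr u i -> smash act, alg_iso f /\
  forall n t, TAdeg n t -> smash_deg g n (f (qclass _ t)).
Proof.
pose f (q : Hdquot Tr u i) : smash act := to_smash (qrepr q).
have lF := to_smash_linear.
have fE t : f (qclass _ t) = to_smash t.
  apply/eqP; rewrite -subr_eq0 /f -(linB lF); apply/eqP/to_smash_ideal.
  exact: qrepr_class.
have lq : linear (qclass (Hpartial Tr i u) : TA B -> Hdquot Tr u i).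
  by move=> c x y; rewrite -qclassD -[qclass _ (c *: x)](qscaleE (Hpartial Tr i u) c x).
have lf : linear f.
  by move=> c; elim/qind => x; elim/qind => y; rewrite -lq !fE lF.
have /choice [q qE] := dquot_map_surj.
have key t t' h : p t = p t' ->
    qclass (Hpartial Tr i u) (Psi (tens t h)) = qclass _ (Psi (tens t' h)).
  move=> tt'; apply/qclassP; rewrite -(linB (Psi_tensl hH actV h)); apply: Psi_ideal.
  by apply/dquot_map_ker; rewrite (linB dquot_map_linear) tt' subrr.
have bG : bilin2 (fun a h => qclass _ (Psi (tens (q a) h)) : Hdquot Tr u i).
  split=> [h c a b|a c h h']; last first.
    by rewrite -lq -(Psi_tensr hH actV (q a)).
  rewrite -lq -(Psi_tensl hH actV h); apply: key.
  by rewrite dquot_map_linear !qE.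
pose G (s : smash act) : Hdquot Tr u i := tlift (fun a h => qclass _ (Psi (tens (q a) h))) s.
have lG : linear G := tlift_linear bG.
have GE a h : G (st a h) = qclass _ (Psi (tens (q a) h)) := tlift_tens a h bG.
exists f; split; last first.
  move=> n t; rewrite fE; elim: n t => [|n IH] t.
    move=> /TAdeg0P[h ->]; rewrite to_smash_in0; apply: kspan_gen; exists 1, h; split=> //.
    by exists 1; split; [apply: (TAdeg_in0 _ 1)|rewrite dquot_map1].
  have sD x y : smash_deg (act := act) g n.+1 x -> smash_deg g n.+1 y -> smash_deg g n.+1 (x + y).
    by move=> hx hy; have := kspanL 1 hx hy; rewrite scale1r.
  have sZ c x : smash_deg (act := act) g n.+1 x -> smash_deg g n.+1 (c *: x).
    by move=> hx; rewrite -[_ *: _]addr0; apply: kspanL => //; apply: kspan0.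
  move: t; apply: TAdegS_ind => [|x y hx hy|x t /IH].
  - by rewrite (lin0 lF); apply: kspan0.
  - by rewrite (linD lF); apply: sD.
  rewrite to_smashM to_smash_in1; move: (to_smash t) => s hs.
  move: x; apply: univ_ind => [|c [v z] x hx].
    by rewrite (lin0 ls1) mul0r; apply: kspan0.
  rewrite (ls1 c) mulrDl -scalerAl; apply: (sD) => //; apply: (sZ).
  rewrite -/(tens v z) to_smash1_tens.
  move: s hs {hx}; apply: kspan_ind => [|d y y' hy hy'|_ [a [h [ga ->]]]].
  - by rewrite mulr0; apply: kspan0.
  - by rewrite mulrDr -scalerAr; apply: sD => //; apply: sZ.
  rewrite -[_ * _]/(smash_mul _ _) smash_mul_tens.
  apply: (@kspan_sweedler _ _ hH) => z1 z2; apply: kspan_gen.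
  exists (p (in1 v) * (z1 |> a)), (z2 * h); split=> //.
  have [t' [dt' ->]] := g_sub z1 ga; exists (in1 v * t'); rewrite dquot_mapM; split=> //.
  by apply: (TAdegM (m := 1)) dt'; apply: TAdeg_in1.
split=> //.
- split; first by rewrite [f 1]fE -TAin0_1 to_smash_in0.
  elim/qind => x; elim/qind => y.
  rewrite (_ : _ * _ = qclass _ (x * y)) ?fE ?to_smashM //; exact: qmulE.
exists G.
- elim/qind => t; rewrite fE; have [x ->] := Psi_surj t.
  move: x; apply: (tens_eq (Z := Hdquot Tr u i) (f := fun x => G (to_smash (Psi x)))
    (g := fun x => qclass _ (Psi x))) => [||t' h].
  + exact: (linear_comp lG (linear_comp lF (@Psi_linear _ _ hH _ actV))).
  + exact: (linear_comp lq (@Psi_linear _ _ hH _ actV)).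
  by rewrite to_smash_Psi GE; apply: key; rewrite qE.
- apply: (tens_eq (Z := smash act) (f := fun s => f (G s)) (g := fun s => s)) => [||a h].
  + exact: (linear_comp lf lG).
  + by [].
  by rewrite [G _]GE fE to_smash_Psi qE.
Qed.

End DerivationQuotient.

Theorem theorem1p3 (R : realType) (k : closedFieldType)
  (char0 : [pchar k] =i pred0)
  (V : vectType k) (sigma : 'End(V)) (l m d : nat) (w : TV V)
  (sigma_GL : lker sigma == 0%VS) (m_le_l : (m <= l)%N)
  (w_superpotential : superpotential l sigma w)
  (A : algType k) (phi : dquot w (l - m) -> A) (phi_iso : alg_iso phi)
  (A_koszul : m_koszul m (partial (l - m) w) (dquot_deg phi) (dquot_map phi))
  (A_regular : AS_regular R (dquot_deg phi) d l)
  (A_GKdim : GKdim R A = (d%:R)%:E)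
  (H : falgType k) (hH : hopf H) (H_semisimple : semisimple_hopf hH)
  (act : module_algebra hH A)
  (A_submodules : forall n h a, dquot_deg phi n a -> dquot_deg phi n (hact act h a))
  (act_faithful : inner_faithful act)
  (* the H-module structure of V = A_1 *)
  (actV : hmodule H V)
  (actVE : forall h v, dquot_map phi (TAin1 _ (hact actV h v))
                       = hact act h (dquot_map phi (TAin1 _ v)))
  (Tr : {linear H -> k^o}) (Tr_trace : is_trace hH Tr)
  (hdet : H -> k) (hdetE : is_hdet act (dquot_deg phi) d hdet) :
  (exists nu : TA (VH_bimodule hH actV) -> TA (VH_bimodule hH actV),
     [/\ forall h, nu (TAin0 _ h) = TAin0 _ (winding hH hdet h),
         forall v h, nu (TAin1 _ (tens v h))
                     = TAin1 _ (tens (sigma v) (winding hH hdet h)) &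
         Hsuperpotential Tr l nu (Psi hH actV (tens w 1))]) /\
  (exists f : Hdquot Tr (Psi hH actV (tens w 1)) (l - m) -> smash act,
     alg_iso f /\
     forall n t, TAdeg n t -> smash_deg (dquot_deg phi) n (f (qclass _ t))).
Proof.
have [m2 Rel_deg exK] := A_koszul; have [conn _ [gor _] [gl _] _] := A_regular.
have p_lin := dquot_map_linear phi_iso; have p1 := dquot_map1 phi_iso.
have pM := dquot_mapM phi_iso; have p_ker := dquot_map_ker phi_iso.
have p_deg n t : TAdeg n t -> dquot_deg phi n (dquot_map phi t) by exists t.
have w0 := superpotential_neq0 conn p_lin p_deg m_le_l m2 exK gl gor.
have w_line := superpotential_line conn p_lin p_deg m_le_l w_superpotential m2 exK gl gor.
have w_ndeg := superpotential_ndeg conn p_lin p_deg sigma_GL m_le_l w_superpotential m2 exK gl gor.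
have [rho_d _ _ _] := koszul_top conn p_lin p_deg m2 exK gl gor.
have w_kspace := superpotential_kspace m w_superpotential.
(* H preserves K_l, which is the line k w. *)
have /choice [chi chiE] h : exists c : k, TVact hH actV h w = c *: w.
  by apply: w_line; exact: (kspace_stable p_lin pM p1 p_ker Rel_deg actVE).
have [eta [[P [G [_ extP]]] hdet_eta]] := hdetE.
have hdet_chi h : hdet h = chi h.
  (* hdet(h) = eta(S(h)) = chi(S(S(h))) = chi(h). *)
  have SS := H_semisimple.2 h.
  rewrite hdet_eta -{2}SS; symmetry.
  have w_top : koszul_space m (partial (l - m) w) (rho m d) w by rewrite rho_d.
  exact: (ext_character_superpotential conn p_lin pM p1 p_deg p_ker Rel_deg m2 exK
    actVE A_submodules extP w_top w0 chiE).
have hdetE' h : TVact hH actV h w = (hdet h : k) *: w by rewrite hdet_chi.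
(* [hdet] is given as a bare function; that it is a character is read off from its values as
   eigenvalues on the nonzero vector w. *)
have w_inj (a b : k) : a *: w = b *: w -> a = b.
  move/eqP; rewrite -subr_eq0 -scalerBl scaler_eq0 (negPf w0) orbF subr_eq0.
  by move/eqP.
have hdet_lin : linear (hdet : H -> k^o).
  move=> c x y; apply: w_inj.
  by rewrite -hdetE' TVact_linearl scalerDl -!scalerA -!hdetE'.
have hdet1 : hdet 1 = 1 by apply: w_inj; rewrite -hdetE' TVact1 scale1r.
have hdetM g h : hdet (g * h) = hdet g * hdet h.
  by apply: w_inj; rewrite -hdetE' TVact_comp hdetE' (linZ (TVact_linear hH actV g)) hdetE' scalerA mulrC.
have l_gt0 : (0 < l)%N by apply: leq_trans m_le_l; apply: leq_trans m2.
split.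
  exists (twist_nu (hH := hH) (actV := actV) (hdet : H -> k^o) sigma).
  exact: Psi_superpotential.
by apply: (dquot_smash_iso phi_iso Tr_trace w_superpotential.1 (leq_subr m l) hdetE') => //.
Qed.
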